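(* Let $k$ be a field of characteristic $2$, let $S$ be a $k$-scheme with global sections $r,s\in H^0(S,\mathcal O_S)$, and let $\mathfrak Z=(Y\times S)/\alpha_2\to S$ be the flat family defined by the vector field $\delta=(u^{-2}+r)D_u+(v^{-2}+s)D_v$ on $Y\times S$, where $Y=C\times C$. Then for every $\sigma\in S$ the fiber $\mathfrak Z_\sigma$ of $\mathfrak Z\to S$ is normal.
   Context: $C$ denotes the cuspidal rational curve of arithmetic genus one, $C=\operatorname{Spec} k[u^2,u^3]\cup\operatorname{Spec} k[u^{-1}]$ (glued along $\operatorname{Spec} k[u,u^{-1}]$); for a second copy of $C$ the coordinate is called $v$. $Y=C\times C$, with coordinate $u$ on the first and $v$ on the second factor. $D_u=\partial/\partial u$, $D_v=\partial/\partial v$. The expression $\delta=(u^{-2}+r)D_u+(v^{-2}+s)D_v$ defines a global vector field in $H^0(Y\times S,\Theta_{Y\times S/S})$ with $\delta\circ\delta=0$, hence an action of $\alpha_2=\operatorname{Spec} k[t]/(t^2)$ on $Y\times S$ over $S$, via $f\mapsto f\otimes 1+\delta(f)\otimes t$. The quotient $\mathfrak Z=(Y\times S)/\alpha_2$ has the same underlying topological space as $Y\times S$ and structure sheaf $\ker(\delta:\mathcal O_{Y\times S}\to\mathcal O_{Y\times S})$. *)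

(* Defs.v *)
From HB Require Import structures.
From mathcomp Require Import all_boot all_order all_algebra.
From mathcomp Require Import boolp classical_sets functions filter.
From mathcomp Require Import topology.

Set Implicit Arguments.
Unset Strict Implicit.
Unset Printing Implicit Defensive.

Import GRing.Theory.
Local Open Scope classical_set_scope.
Local Open Scope ring_scope.

(* Schemes over a field k.

   A sheaf of k-algebras on a topological space is given, as in Serre's FAC or
   Hartshorne's construction of Spec, by its stalks together with the families
   of germs that are its sections.  Such a family is a function defined at all
   points; [section U s] only depends on the values of s on U (by
   [section_glue]), and two sections over U are the same when they agree on U.
   Only open sets U are relevant. *)
Record lrs (k : fieldType) := LRS {
  points :> topologicalType;
  stalk : points -> comUnitAlgType k;
  section : set points -> (forall x, stalk x) -> Prop;
  section_glue : forall (U : set points) (s : forall x, stalk x), open U ->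
    (forall x, U x -> exists V t,
       [/\ open V, V x, section V t & forall y, U y -> V y -> s y = t y]) ->
    section U s;
  section_scalar : forall (U : set points) (c : k), open U ->
    section U (fun x => c%:A);
  section_sub : forall (U : set points) (s t : forall x, stalk x), open U ->
    section U s -> section U t -> section U (fun x => s x - t x);
  section_mul : forall (U : set points) (s t : forall x, stalk x), open U ->
    section U s -> section U t -> section U (fun x => s x * t x);
  (* every germ is the germ of a section near the point *)
  germ_section : forall x (a : stalk x),
    exists U s, [/\ open U, U x, section U s & s x = a];
  (* sections with the same germ at x agree near x *)
  germ_eq : forall (U : set points) (s t : forall x, stalk x) x, open U ->
    section U s -> section U t -> U x -> s x = t x -> \forall y \near x, s y = t y;
  stalk_local : forall x (a b : stalk x), a + b \is a GRing.unit ->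
    a \is a GRing.unit \/ b \is a GRing.unit
}.

Arguments section {k} X U s : rename.
Arguments stalk {k} X x : rename.

Definition is_prime_ideal (A : comNzRingType) (p : set A) : Prop :=
  [/\ p 0, (forall a b, p a -> p b -> p (a + b)), (forall a b, p b -> p (a * b)),
      ~ p 1 & forall a b, p (a * b) -> p a \/ p b].

(* The open subspace U of X, with phi : A -> H^0(U, O_X), is the spectrum of A:
   its points correspond to the prime ideals of A, the sets D(a) form a basis of
   its topology, and its stalks are the localizations of A at the corresponding
   prime ideals.  The sections over V `<=` U are then the families of germs that
   are locally of the form a / b, by [section_glue] and [germ_eq]. *)
Record is_spec (k : fieldType) (X : lrs k) (U : set X) (A : comAlgType k)
    (phi : A -> forall x, stalk X x) : Prop := IsSpec {
  spec_open : open U;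
  spec_section : forall a, section X U (phi a);
  spec_morphism : forall x, U x ->
    exists g : {lrmorphism A -> stalk X x}, forall a, phi a x = g a;
  spec_points : forall p : set A, is_prime_ideal p ->
    exists! x, U x /\ forall a, p a <-> phi a x \isn't a GRing.unit;
  spec_basis : forall (V : set X) x, open V -> U x -> V x ->
    exists a, phi a x \is a GRing.unit /\
      forall y, U y -> phi a y \is a GRing.unit -> V y;
  spec_stalk_frac : forall x (g : stalk X x), U x ->
    exists a b, phi b x \is a GRing.unit /\ g = phi a x / phi b x;
  spec_stalk_ker : forall x a, U x -> phi a x = 0 ->
    exists b, phi b x \is a GRing.unit /\ b * a = 0
}.

Definition affine (k : fieldType) (X : lrs k) (U : set X) : Prop :=
  exists (A : comAlgType k) (phi : A -> forall x, stalk X x), is_spec U phi.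

Record scheme (k : fieldType) := Scheme {
  scheme_lrs :> lrs k;
  locally_affine : forall x : scheme_lrs, exists U, affine U /\ U x
}.

Record lrs_morphism (k : fieldType) (X Y : lrs k) := Morphism {
  on_points :> X -> Y;
  on_stalks : forall x, {lrmorphism stalk Y (on_points x) -> stalk X x};
  morphism_continuous : continuous on_points;
  morphism_local : forall x a,
    on_stalks x a \is a GRing.unit -> a \is a GRing.unit;
  morphism_section : forall V t, open V -> section Y V t ->
    section X (on_points @^-1` V) (fun x => on_stalks x (t (on_points x)))
}.

Definition pullback_section (k : fieldType) (X Y : lrs k) (f : lrs_morphism X Y)
    (t : forall y, stalk Y y) : forall x, stalk X x :=
  fun x => on_stalks f x (t (f x)).

Section Composition.
Context (k : fieldType) (X Y Z : lrs k) (g : lrs_morphism Y Z) (f : lrs_morphism X Y).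

Let comp_points (x : X) : Z := g (f x).

Let comp_stalks (x : X) : {lrmorphism stalk Z (comp_points x) -> stalk X x} :=
  (on_stalks f x \o on_stalks g (f x)).

Let comp_continuous : continuous comp_points.
Proof.
by move=> x; apply: continuous_comp; apply: morphism_continuous.
Qed.

Let comp_local x a : comp_stalks x a \is a GRing.unit -> a \is a GRing.unit.
Proof. by move=> /morphism_local/morphism_local. Qed.

Let comp_section V t : open V -> section Z V t ->
  section X (comp_points @^-1` V) (fun x => comp_stalks x (t (comp_points x))).
Proof.
move=> oV tV.
have oW : open (g @^-1` V).
  by apply: open_comp => // x _; exact: morphism_continuous.
exact: (morphism_section f oW (morphism_section g oV tV)).
Qed.

Definition compose : lrs_morphism X Z :=
  Morphism comp_continuous comp_local comp_section.

End Composition.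

(* P, with the projections p and q, is the product X x_k Y of k-schemes. *)
Definition is_product (k : fieldType) (X Y P : scheme k)
    (p : lrs_morphism P X) (q : lrs_morphism P Y) : Prop :=
  forall (T : scheme k) (f : lrs_morphism T X) (g : lrs_morphism T Y),
    exists! h : lrs_morphism T P, compose p h = f /\ compose q h = g.

(* P, with the projections p and q, is the fibre product X x_S Y. *)
Definition is_fibre_product (k : fieldType) (X Y S P : scheme k)
    (f : lrs_morphism X S) (g : lrs_morphism Y S)
    (p : lrs_morphism P X) (q : lrs_morphism P Y) : Prop :=
  compose f p = compose g q /\
  forall (T : scheme k) (a : lrs_morphism T X) (b : lrs_morphism T Y),
    compose f a = compose g b ->
    exists! h : lrs_morphism T P, compose p h = a /\ compose q h = b.

(* i : K -> S is the canonical morphism Spec kappa(sigma) -> S: K is a single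
   point whose local ring is a field, and O_(S, sigma) surjects onto it. *)
Record is_residue_spec (k : fieldType) (S : scheme k) (sigma : S)
    (K : scheme k) (i : lrs_morphism K S) : Prop := IsResidueSpec {
  residue_point : exists! y : K, True;
  residue_field : forall (y : K) (a : stalk K y), a != 0 -> a \is a GRing.unit;
  residue_image : forall y : K, i y = sigma;
  residue_surj : forall (y : K) (a : stalk K y), exists b, on_stalks i y b = a
}.

(* F, with its projection to Z, is the fibre of f : Z -> S over sigma. *)
Definition is_fibre (k : fieldType) (Z S F : scheme k) (f : lrs_morphism Z S)
    (sigma : S) (j : lrs_morphism F Z) : Prop :=
  exists (K : scheme k) (i : lrs_morphism K S) (q : lrs_morphism F K),
    is_residue_spec sigma i /\ is_fibre_product f i j q.

Definition integrally_closed (D : idomainType) : Prop :=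
  forall z : {fraction D}, integralOver (@tofrac D) z -> exists d, z = tofrac d.

Definition normal_ring (R : comNzRingType) : Prop :=
  exists (D : idomainType) (f : {rmorphism R -> D}),
    bijective f /\ integrally_closed D.

Definition normal_scheme (k : fieldType) (X : scheme k) : Prop :=
  forall x : X, normal_ring (stalk X x).

Section CoordinateRings.
Context (k : fieldType) (X : lrs k).
Implicit Types (V W : set X) (a b s : forall x, stalk X x).

(* the families of germs that agree on W with an element of k[a] *)
Definition gen1 W a s : Prop :=
  exists q : {poly k}, forall x, W x -> s x = horner_alg (a x) q.

(* the families of germs that agree on W with an element of k[a, b] *)
Definition gen2 W a b s : Prop :=
  exists q : {poly {poly k}}, forall x, W x ->
    s x = (map_poly (horner_alg (a x)) q).[b x].

(* V is affine and restriction to W identifies H^0(V, O_X) with the ring R of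
   sections over W, i.e. V = Spec R. *)
Definition coordinate_ring V W (R : (forall x, stalk X x) -> Prop) : Prop :=
  [/\ affine V,
      forall s, section X V s -> R s,
      forall s, R s ->
        exists t, section X V t /\ forall x, W x -> t x = s x &
      forall s, section X V s -> (forall x, W x -> s x = 0) ->
        forall x, V x -> s x = 0].

End CoordinateRings.

(* C = Spec k[u^2, u^3] \cup Spec k[u^-1], glued along Spec k[u, u^-1]; u is a
   section over the overlap of the two charts, and k[u, u^-1] is a ring of
   Laurent polynomials by [cusp_free]. *)
Record cuspidal_curve (k : fieldType) := CuspidalCurve {
  curve :> scheme k;
  chart0 : set curve;
  chart1 : set curve;
  cusp_coord : forall x, stalk curve x;
  overlap := chart0 `&` chart1;
  cusp_cover : chart0 `|` chart1 = setT;
  coord_unit : forall x, overlap x -> cusp_coord x \is a GRing.unit;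
  cusp_free : forall q : {poly k},
    (forall x, overlap x -> horner_alg (cusp_coord x) q = 0) -> q = 0;
  overlap_ring : coordinate_ring overlap overlap
    (gen2 overlap cusp_coord (fun x => (cusp_coord x)^-1));
  chart0_ring : coordinate_ring chart0 overlap
    (gen2 overlap (fun x => cusp_coord x ^+ 2) (fun x => cusp_coord x ^+ 3));
  chart1_ring : coordinate_ring chart1 overlap
    (gen1 overlap (fun x => (cusp_coord x)^-1))
}.

Arguments chart0 {k} c.
Arguments chart1 {k} c.
Arguments cusp_coord {k} c x.
Arguments overlap {k} c.

(* D is a vector field over the open set V of X relative to f : X -> S, i.e.
   an element of H^0(V, Theta_(X/S)), given by its action on germs. *)
Record is_vector_field (k : fieldType) (X S : scheme k) (f : lrs_morphism X S)
    (V : set X) (D : forall x, stalk X x -> stalk X x) : Prop := IsVectorField {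
  vf_add : forall x a b, V x -> D x (a + b) = D x a + D x b;
  vf_leibniz : forall x a b, V x -> D x (a * b) = a * D x b + D x a * b;
  vf_base : forall x a, V x -> D x (on_stalks f x a) = 0;
  vf_section : forall (W : set X) s, open W -> W `<=` V -> section X W s ->
    section X W (fun x => D x (s x))
}.

(* q : X -> Z identifies Z with the space X endowed with the structure sheaf
   ker(D : O_X -> O_X). *)
Record is_kernel_quotient (k : fieldType) (X Z : scheme k)
    (D : forall x, stalk X x -> stalk X x) (q : lrs_morphism X Z) : Prop :=
  IsKernelQuotient {
  quotient_bij : bijective q;
  quotient_open : forall U : set X, open U -> open (q @` U);
  quotient_inj : forall x, injective (on_stalks q x);
  quotient_ker : forall x a, D x a = 0 <-> exists b, on_stalks q x b = a
}.

(* Main.v *)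
Require Import Defs.
From HB Require Import structures.
From mathcomp Require Import all_boot all_order all_algebra.
From mathcomp Require Import generic_quotient polyXY ring.
From mathcomp Require Import boolp classical_sets functions filter.
From mathcomp Require Import topology.

(** Let x be a point of the fibre over sigma and y the point of Y x S above it; write
    R for the local ring of S at the image of y and kappa for the residue field.

    The coordinate rings of the two charts of C have the form k[a] + k[a] x with
    x^2 = a^(2l+1): in the smooth chart a = u^-2, x = u^-1, l = 0, and in the chart of
    the cusp a = u^2, x = u^3, l = 1. With b, y, m for the second factor, the local
    ring of Y x S is therefore a localization of the free R[a,b]-module on 1, x, y, xy
    (product_stalk). In characteristic two delta is linear over R[a,b], and
    delta(x) = al(a), delta(y) = be(b), where al is a^2 + r a or 1 + r a, and
    similarly for be (delta_a, delta_x). Since al and be depend on different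
    variables they form a regular sequence, and solving
    delta(f0 + f1 x + f2 y + f3 xy) = 0 shows that the local ring of the quotient is
    free on 1 and w = al y + be x over a localization of R[a,b] (der_kernel).

    Consequently forming the quotient commutes with passing to the fibre, and the
    local ring of the fibre is a localization of kappa[a,b][w], where
    w^2 = h = al^2 b^(2m+1) + be^2 a^(2l+1). This ring is normal (cover_normal): if
    z = (f + g w) / D is integral, then so is z^2 = (f^2 + g^2 h) / D^2, which lies in
    kappa(a,b), so D^2 divides f^2 + g^2 h. Derivations kill squares, and the two
    derivatives of h are the squares of al b^m and be a^l; hence D divides g al b^m
    and g be a^l. These two polynomials have no common factor, so D divides g and
    then f.

    The schemes Y, Y x S and the fibre are known only by their universal properties.
    Their stalks are computed by mapping spectra of rings into them: a ring that maps
    to a stalk, and whose spectrum maps compatibly to the scheme, has the stalk as a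
    localization (stalk_recognition). For Y x S the ring is the free R[a,b]-module
    above, for the fibre it is the quotient of a local ring of Z by the maximal ideal
    of R (fibre_stalk). The formula for delta is given where u and v are invertible;
    it extends to the cusp because a and b are not zero divisors
    (vanish_unit_locus). *)

Set Implicit Arguments.
Unset Strict Implicit.
Unset Printing Implicit Defensive.

Import GRing.Theory.
Local Open Scope classical_set_scope.
Local Open Scope ring_scope.

(** * Rings of fractions modulo an ideal *)

(** Fractions a / s with s in [dens], modulo the ideal [nulls]: with [nulls] zero
    this is a localization, with [dens] trivial a quotient ring. The stalks of a
    spectrum are of the first kind, the test ring for a fibre of the second. *)
Record mult_mod (A : comNzRingType) := MultMod {
  dens : set A;
  nulls : set A;
  dens1 : dens 1;
  densM : forall s t, dens s -> dens t -> dens (s * t);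
  nulls0 : nulls 0;
  nullsD : forall a b, nulls a -> nulls b -> nulls (a + b);
  nullsM : forall a b, nulls b -> nulls (a * b);
  dens_nulls : forall s, dens s -> ~ nulls s
}.

Section Fractions.
Local Open Scope quotient_scope.
Context (k : fieldType) (A : comAlgType k) (S : mult_mod A).
Implicit Types (a b c s t u : A) (p q : A * A).

(** Pairs with a forbidden denominator are read as having denominator 1, so that
    the quotient can be taken on all of A * A. *)
Definition den p : A := if `[< dens S p.2 >] then p.2 else 1.

Lemma den_dens p : dens S (den p).
Proof. by rewrite /den; case: asboolP => // _; exact: dens1. Qed.

Lemma den_pair a s : dens S s -> den (a, s) = s.
Proof. by move=> Ss; rewrite /den /=; case: asboolP. Qed.

Definition frac_rel p q : bool :=
  `[< exists u, dens S u /\ nulls S (u * (p.1 * den q - q.1 * den p)) >].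

Lemma frac_rel_equiv : equiv_class_of frac_rel.
Proof.
split.
- move=> p; apply/asboolP; exists 1; split; first exact: dens1.
  by rewrite subrr mulr0; exact: nulls0.
- have sym p q : frac_rel p q -> frac_rel q p.
    move=> /asboolP[u [Su Ju]]; apply/asboolP; exists u; split=> //.
    have := nullsM (-1) Ju; congr (nulls S); ring.
  by move=> p q; apply/idP/idP; exact: sym.
- move=> q p r /asboolP[u [Su Ju]] /asboolP[v [Sv Jv]]; apply/asboolP.
  exists (u * v * den q); split; first by do 2?apply: densM => //; exact: den_dens.
  have := nullsD (nullsM (v * den r) Ju) (nullsM (u * den p) Jv).
  congr (nulls S); ring.
Qed.

Canonical frac_equiv := EquivRelPack frac_rel_equiv.

Definition fractions := {eq_quot frac_equiv}.

HB.instance Definition _ := Choice.on fractions.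
HB.instance Definition _ := EqQuotient.on fractions.

Definition mkfrac a s : fractions := \pi_fractions (a, s).

Lemma mkfracP (x : fractions) : exists a s, dens S s /\ x = mkfrac a s.
Proof.
elim/quotW: x => -[a s].
exists a, (den (a, s)); split; first exact: den_dens.
apply/eqmodP/asboolP; exists 1; split; first exact: dens1.
rewrite /= (den_pair a (den_dens _)) subrr mulr0; exact: nulls0.
Qed.

Lemma mkfrac_eq a s b t : dens S s -> dens S t ->
  mkfrac a s = mkfrac b t <->
  exists u, dens S u /\ nulls S (u * (a * t - b * s)).
Proof.
move=> Ss St; split.
  move=> /eqmodP /asboolP[u]; rewrite /= !den_pair //; by exists u.
move=> [u Hu]; apply/eqmodP/asboolP; exists u.
by rewrite /= !den_pair.
Qed.

Definition frac_lift2 (f : A -> A -> A -> A -> A) (x y : fractions) : fractions :=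
  let p := repr x in let q := repr y in
  mkfrac (f p.1 (den p) q.1 (den q)) (den p * den q).

Lemma repr_mkfrac a s : dens S s ->
  exists u, dens S u /\
    nulls S (u * ((repr (mkfrac a s)).1 * s - a * den (repr (mkfrac a s)))).
Proof.
move=> Ss; have /eqmodP/asboolP[u] : repr (mkfrac a s) = (a, s) %[mod fractions].
  by rewrite reprK.
by rewrite /= (den_pair a Ss); exists u.
Qed.

Definition frac_add : fractions -> fractions -> fractions :=
  frac_lift2 (fun a s b t => a * t + b * s).
Definition frac_mul : fractions -> fractions -> fractions := frac_lift2 (fun a s b t => a * b).
Definition frac_opp (x : fractions) : fractions :=
  let p := repr x in mkfrac (- p.1) (den p).

Lemma frac_addE a s b t : dens S s -> dens S t ->
  frac_add (mkfrac a s) (mkfrac b t) = mkfrac (a * t + b * s) (s * t).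
Proof.
move=> Ss St; rewrite /frac_add /frac_lift2.
have [u [Su Ju]] := repr_mkfrac a Ss; have [v [Sv Jv]] := repr_mkfrac b St.
move: (repr (mkfrac a s)) (repr (mkfrac b t)) Ju Jv => p q Ju Jv.
have Sp := den_dens p; have Sq := den_dens q.
apply/mkfrac_eq; try exact: densM.
exists (u * v); split; first exact: densM.
have := nullsD (nullsM (v * t * den q) Ju) (nullsM (u * s * den p) Jv).
congr (nulls S); ring.
Qed.

Lemma frac_mulE a s b t : dens S s -> dens S t ->
  frac_mul (mkfrac a s) (mkfrac b t) = mkfrac (a * b) (s * t).
Proof.
move=> Ss St; rewrite /frac_mul /frac_lift2.
have [u [Su Ju]] := repr_mkfrac a Ss; have [v [Sv Jv]] := repr_mkfrac b St.
move: (repr (mkfrac a s)) (repr (mkfrac b t)) Ju Jv => p q Ju Jv.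
have Sp := den_dens p; have Sq := den_dens q.
apply/mkfrac_eq; try exact: densM.
exists (u * v); split; first exact: densM.
have := nullsD (nullsM (v * t * q.1) Ju) (nullsM (u * a * den p) Jv).
congr (nulls S); ring.
Qed.

Lemma frac_oppE a s : dens S s -> frac_opp (mkfrac a s) = mkfrac (- a) s.
Proof.
move=> Ss; rewrite /frac_opp.
have [u [Su Ju]] := repr_mkfrac a Ss.
move: (repr _) Ju => p Ju; have Sp := den_dens p.
apply/mkfrac_eq => //; exists u; split=> //.
have := nullsM (-1) Ju; congr (nulls S); ring.
Qed.

Lemma mkfrac_eqE a s b t : dens S s -> dens S t -> a * t = b * s ->
  mkfrac a s = mkfrac b t.
Proof.
move=> Ss St e; apply/mkfrac_eq => //; exists 1; split; first exact: dens1.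
by rewrite e subrr mulr0; exact: nulls0.
Qed.

Let S1 := dens1 S.

Ltac fracs := repeat match goal with
  | x : fractions |- _ => let a := fresh "a" in let s := fresh "s" in
    let Ss := fresh "Ss" in have [a [s [Ss ->]]] := mkfracP x; clear x end.
Ltac dens_tac := repeat first [assumption | exact: S1 | apply: densM].
Ltac fracring := fracs; rewrite ?(frac_addE, frac_mulE, frac_oppE); try dens_tac;
  apply: mkfrac_eqE; [dens_tac | dens_tac | ring].

Fact frac_addA : associative frac_add.
Proof. by move=> x y z; fracring. Qed.
Fact frac_addC : commutative frac_add.
Proof. by move=> x y; fracring. Qed.
Fact frac_add0 : left_id (mkfrac 0 1) frac_add.
Proof. by move=> x; fracring. Qed.
Fact frac_addN : left_inverse (mkfrac 0 1) frac_opp frac_add.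
Proof. by move=> x; fracring. Qed.
Fact frac_mulA : associative frac_mul.
Proof. by move=> x y z; fracring. Qed.
Fact frac_mulC : commutative frac_mul.
Proof. by move=> x y; fracring. Qed.
Fact frac_mul1 : left_id (mkfrac 1 1) frac_mul.
Proof. by move=> x; fracring. Qed.
Fact frac_mulD : left_distributive frac_mul frac_add.
Proof. by move=> x y z; fracring. Qed.
Fact frac_1neq0 : mkfrac 1 1 != mkfrac 0 1.
Proof.
apply/eqP => /mkfrac_eq-/(_ S1 S1)[u [Su]].
by rewrite mul0r mulr1 subr0 mulr1; exact: dens_nulls.
Qed.

HB.instance Definition _ := GRing.isZmodule.Build fractions
  frac_addA frac_addC frac_add0 frac_addN.
HB.instance Definition _ := GRing.Zmodule_isComNzRing.Build fractions
  frac_mulA frac_mulC frac_mul1 frac_mulD frac_1neq0.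

Definition frac_scale (c : k) (x : fractions) : fractions := mkfrac c%:A 1 * x.

Fact frac_scaleA (c d : k) x : frac_scale c (frac_scale d x) = frac_scale (c * d) x.
Proof.
rewrite /frac_scale mulrA; congr (_ * _); rewrite [LHS]frac_mulE //.
by rewrite mulr1 mulr_algl scalerA.
Qed.
Fact frac_scale1 : left_id 1 frac_scale.
Proof. by move=> x; rewrite /frac_scale scale1r mul1r. Qed.
Fact frac_scaleDr : right_distributive frac_scale +%R.
Proof. by move=> c x y; rewrite /frac_scale mulrDr. Qed.
Fact frac_scaleDl x : {morph frac_scale^~ x : c d / c + d}.
Proof.
move=> c d; rewrite /frac_scale -mulrDl; congr (_ * _); rewrite [RHS]frac_addE //.
by rewrite !mulr1 scalerDl.
Qed.
HB.instance Definition _ := GRing.Zmodule_isLmodule.Build k fractions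
  frac_scaleA frac_scale1 frac_scaleDr frac_scaleDl.
Fact frac_scaleAl (c : k) (x y : fractions) : c *: (x * y) = c *: x * y.
Proof. exact: mulrA. Qed.
HB.instance Definition _ := GRing.Lmodule_isLalgebra.Build k fractions frac_scaleAl.
HB.instance Definition _ := GRing.Lalgebra_isComAlgebra.Build k fractions.

Definition frac_unit : {pred fractions} := fun x => `[< exists y, y * x = 1 >].
Definition frac_inv (x : fractions) : fractions :=
  if pselect (exists y, y * x = 1) is left h then projT1 (cid h) else x.
Fact frac_mulVr : {in frac_unit, left_inverse 1 frac_inv *%R}.
Proof.
move=> x /asboolP h; rewrite /frac_inv; case: pselect => // h'.
by case: cid.
Qed.
Fact frac_unitP (x y : fractions) : y * x = 1 -> frac_unit x.
Proof. by move=> e; apply/asboolP; exists y. Qed.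
Fact frac_invr_out : {in [predC frac_unit], frac_inv =1 id}.
Proof. by move=> x /asboolP h; rewrite /frac_inv; case: pselect. Qed.
HB.instance Definition _ := GRing.ComNzRing_hasMulInverse.Build fractions
  frac_mulVr frac_unitP frac_invr_out.

Definition tofr (a : A) : fractions := mkfrac a 1.

Fact tofr_additive : {morph tofr : a b / a - b}.
Proof.
move=> a b; rewrite /tofr -[RHS]/(frac_add (mkfrac a 1) (frac_opp (mkfrac b 1))).
by rewrite frac_oppE // frac_addE // !mulr1.
Qed.
Fact tofr_mul : monoid_morphism tofr.
Proof. split=> // a b.
by rewrite /tofr -[RHS]/(frac_mul (mkfrac a 1) (mkfrac b 1)) frac_mulE // mulr1. Qed.
Fact tofr_scale : scalable tofr.
Proof.
move=> c a; rewrite /tofr -[RHS]/(frac_mul (mkfrac _ _) _) frac_mulE // mulr1.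
by rewrite mulr_algl.
Qed.
HB.instance Definition _ := GRing.isZmodMorphism.Build A fractions tofr tofr_additive.
HB.instance Definition _ := GRing.isMonoidMorphism.Build A fractions tofr tofr_mul.
HB.instance Definition _ := GRing.isScalable.Build k A fractions *:%R tofr tofr_scale.

Lemma tofr_eq0 a : tofr a = 0 <-> exists u, dens S u /\ nulls S (u * a).
Proof.
rewrite -[0]/(mkfrac 0 1) /tofr; split.
  by move=> /mkfrac_eq-/(_ S1 S1)[u]; rewrite mulr1 mul0r subr0; exists u.
by move=> [u Hu]; apply/mkfrac_eq => //; exists u; rewrite mulr1 mul0r subr0.
Qed.

Lemma tofr_dens s : dens S s -> tofr s \is a GRing.unit.
Proof.
move=> Ss; apply/unitrP; exists (mkfrac 1 s); rewrite mulrC; split.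
  rewrite [LHS]frac_mulE //; apply: mkfrac_eqE; rewrite ?mulr1 ?mul1r //.
rewrite [LHS]frac_mulE //; apply: mkfrac_eqE; rewrite ?mulr1 ?mul1r //.
Qed.

Lemma fracP (x : fractions) : exists a s, dens S s /\ x = tofr a / tofr s.
Proof.
have [a [s [Ss ->]]] := mkfracP x; exists a, s; split=> //.
apply: (canRL (mulrK (tofr_dens Ss))); rewrite [LHS]frac_mulE //.
by apply: mkfrac_eqE; rewrite ?mulr1.
Qed.

End Fractions.

(** * Extending algebra maps to fractions *)

Lemma lrmorph_exists (k : fieldType) (A : comAlgType k) (B : comAlgType k) (f : A -> B) :
  {morph f : a b / a - b} -> f 1 = 1 -> {morph f : a b / a * b} -> scalable f ->
  exists g : {lrmorphism A -> B}, forall a, g a = f a.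
Proof.
move=> fB f1 fM fZ.
pose fa := GRing.isZmodMorphism.Build A B f fB.
pose fm := GRing.isMonoidMorphism.Build A B f (conj f1 fM).
pose fs := GRing.isScalable.Build k A B *:%R f fZ.
pose g : {lrmorphism A -> B} := HB.pack f fa fm fs.
by exists g.
Qed.

(** E need not be a ring of fractions by construction: it is enough that its
    elements are fractions and that f kills the kernel of g. Both the stalks of
    an affine open set and [fractions] are covered by this. *)
Lemma fraction_extension (k : fieldType) (A : comAlgType k)
    (E E' : comUnitAlgType k) (g : {lrmorphism A -> E}) (f : {lrmorphism A -> E'}) :
  (forall e, exists a b,
     [/\ g b \is a GRing.unit, f b \is a GRing.unit & e = g a / g b]) ->
  (forall a, g a = 0 -> f a = 0) ->
  exists h : {lrmorphism E -> E'}, forall a, h (g a) = f a.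
Proof.
move=> gF fK.
pose num e := projT1 (cid (gF e)); pose dn e := projT1 (cid (projT2 (cid (gF e)))).
have numP e : [/\ g (dn e) \is a GRing.unit, f (dn e) \is a GRing.unit
                & e * g (dn e) = g (num e)].
  rewrite /dn /num; case: (cid (gF e)) => a /= ?; case: cid => b /= [gb fb ->].
  by rewrite divrK.
pose h e := f (num e) / f (dn e).
have hE a b e : f b \is a GRing.unit -> e * g b = g a -> h e = f a / f b.
  move=> fb eab; have [gd fd eE] := numP e.
  apply: (canRL (mulrK fb)); rewrite /h mulrAC; apply: (canLR (mulrK fd)).
  apply/eqP; rewrite -subr_eq0 -!rmorphM -rmorphB; apply/eqP/fK.
  by rewrite rmorphB !rmorphM /= -eab mulrAC eE subrr.
have hg a : h (g a) = f a.
  by rewrite (hE a 1) ?rmorph1 ?unitr1 ?mulr1 // divr1.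
have [h' hh'] : exists h' : {lrmorphism E -> E'}, forall e, h' e = h e.
  apply: lrmorph_exists.
  - move=> x y /=; have [ux fx ex] := numP x; have [uy fy ey] := numP y.
    rewrite (hE (num x * dn y - num y * dn x) (dn x * dn y)).
    + rewrite /h !(rmorphB, rmorphM) mulrBl invrM // !mulrA mulrK //.
      by rewrite [X in _ - X]mulrAC mulrK.
    + by rewrite rmorphM unitrMl.
    + rewrite rmorphB !rmorphM /= mulrBl mulrA ex.
      by rewrite [g (dn x) * _]mulrC mulrA ey.
  - by rewrite -(rmorph1 g) hg rmorph1.
  - move=> x y /=; have [ux fx ex] := numP x; have [uy fy ey] := numP y.
    rewrite (hE (num x * num y) (dn x * dn y)).
    + by rewrite /h !rmorphM invrM // [(f (dn y))^-1 * _]mulrC mulrACA.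
    + by rewrite rmorphM unitrMl.
    + by rewrite !rmorphM /= mulrACA ex ey.
  - move=> c x /=; have [ux fx ex] := numP x.
    rewrite (hE (c *: num x) (dn x)) //.
    + by rewrite /h linearZ /= scalerAl.
    + by rewrite linearZ /= -scalerAl ex.
by exists h' => a; rewrite hh' hg.
Qed.

Lemma frac_extension (k : fieldType) (A : comAlgType k) (S : mult_mod A)
    (B : comUnitAlgType k) (f : {lrmorphism A -> B}) :
  (forall s, dens S s -> f s \is a GRing.unit) ->
  (forall a, nulls S a -> f a = 0) ->
  exists h : {lrmorphism fractions S -> B}, forall a, h (tofr S a) = f a.
Proof.
move=> fU fJ; apply: fraction_extension.
  move=> x; have [a [s [Ss ->]]] := fracP x; exists a, s.
  by split=> //; [exact: tofr_dens | exact: fU].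
move=> a /tofr_eq0[u [Su Ju]]; apply: (mulrI (fU _ Su)).
by rewrite mulr0 -rmorphM; exact: fJ.
Qed.

(** * Sections of locally ringed spaces *)

Section Lrs.
Context (k : fieldType) (X : lrs k).
Implicit Types (U V : set X) (s t : forall x, stalk X x).

Lemma section_restr U V s : open U -> open V -> section X U s -> V `<=` U ->
  section X V s.
Proof. by move=> oU oV sU VU; apply: section_glue => // x Vx; exists U, s; split=> //; exact: VU. Qed.

Lemma section_ext U s t : open U -> section X U s -> (forall x, U x -> t x = s x) ->
  section X U t.
Proof. by move=> oU sU ts; apply: section_glue => // x Vx; exists U, s; split=> // y Uy _; exact: ts. Qed.

Lemma section1 U : open U -> section X U (fun x => 1).
Proof.
move=> oU; apply: section_ext (section_scalar 1 oU) _ => // x _.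
by rewrite scale1r.
Qed.

Lemma section0 U : open U -> section X U (fun x => 0).
Proof.
move=> oU; apply: section_ext (section_scalar 0 oU) _ => // x _.
by rewrite scale0r.
Qed.

Lemma section_opp U s : open U -> section X U s -> section X U (fun x => - s x).
Proof.
move=> oU sU; apply: section_ext (section_sub oU (section0 oU) sU) _ => // x _.
by rewrite sub0r.
Qed.

Lemma section_add U s t : open U -> section X U s -> section X U t ->
  section X U (fun x => s x + t x).
Proof.
move=> oU sU tU; apply: section_ext (section_sub oU sU (section_opp oU tU)) _ => // x _.
by rewrite opprK.
Qed.

Lemma section_exp U s n : open U -> section X U s -> section X U (fun x => s x ^+ n).
Proof.
move=> oU sU; elim: n => [|n IH].
  by apply: section_ext (section1 oU) _ => // x _; rewrite expr0.
by apply: section_ext (section_mul oU sU IH) _ => // x _; rewrite exprS.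
Qed.

Lemma near_open (P : set X) x : (\forall y \near x, P y) ->
  exists V, [/\ open V, V x & forall y, V y -> P y].
Proof.
move=> h; exists (interior [set y | P y]); split; first exact: open_interior.
  exact: h.
by move=> y /interior_subset.
Qed.

(** A germ of the inverse extends to a section near x, and its product with s,
    having germ 1, is 1 near x. *)
Lemma section_inv_near U s x : open U -> section X U s -> U x ->
  s x \is a GRing.unit -> exists V t,
    [/\ open V, V x, V `<=` U, section X V t & forall y, V y -> s y * t y = 1].
Proof.
move=> oU sU Ux sx; have [V [t [oV Vx tV tx]]] := germ_section (s x)^-1.
have oUV : open (U `&` V) by exact: openI.
have sUV := section_restr oU oUV sU (@subIsetl _ U V).
have tUV := section_restr oV oUV tV (@subIsetr _ U V).
have e : s x * t x = 1 by rewrite tx mulrV.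
have [O [oO Ox OP]] := near_open
  (germ_eq oUV (section_mul oUV sUV tUV) (section1 oUV) (conj Ux Vx) e).
have oOUV : open (O `&` (U `&` V)) by exact: openI.
exists (O `&` (U `&` V)), t; split=> //.
- by move=> y [_ []].
- by apply: section_restr tUV _ => // y [].
- by move=> y [Oy _]; exact: OP.
Qed.

Lemma unit_near U s x : open U -> section X U s -> U x -> s x \is a GRing.unit ->
  exists V, [/\ open V, V x, V `<=` U & forall y, V y -> s y \is a GRing.unit].
Proof.
move=> oU sU Ux sx; have [V [t [oV Vx VU _ st]]] := section_inv_near oU sU Ux sx.
exists V; split=> // y Vy; apply/unitrP; exists (t y).
by rewrite [t y * _]mulrC st.
Qed.

Lemma section_inv U s : open U -> section X U s ->
  (forall x, U x -> s x \is a GRing.unit) -> section X U (fun x => (s x)^-1).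
Proof.
move=> oU sU su; apply: section_glue => // x Ux.
have [V [t [oV Vx VU tV st]]] := section_inv_near oU sU Ux (su x Ux).
exists V, t; split=> // y Uy Vy; apply: (mulrI (su y Uy)).
by rewrite mulrV ?st //; exact: su.
Qed.

Lemma section_eq_near U V s t x : open U -> open V -> section X U s -> section X V t ->
  U x -> V x -> s x = t x ->
  exists O, [/\ open O, O x, O `<=` U `&` V & forall y, O y -> s y = t y].
Proof.
move=> oU oV sU tV Ux Vx e.
have oUV : open (U `&` V) by exact: openI.
have sUV := section_restr oU oUV sU (@subIsetl _ U V).
have tUV := section_restr oV oUV tV (@subIsetr _ U V).
have [O [oO Ox OP]] := near_open (germ_eq oUV sUV tUV (conj Ux Vx) e).
exists (O `&` (U `&` V)); split=> //; first exact: openI.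
by move=> y [Oy _]; exact: OP.
Qed.

Lemma nonunit_prime (A : comAlgType k) x (f : {lrmorphism A -> stalk X x}) :
  is_prime_ideal [set a | f a \isn't a GRing.unit].
Proof.
split=> /=.
- by rewrite rmorph0 unitr0.
- move=> a b /negP fa /negP fb; apply/negP; rewrite rmorphD => /stalk_local[] //.
- by move=> a b fb; rewrite rmorphM unitrM negb_and fb orbT.
- by rewrite rmorph1 unitr1.
- by move=> a b; rewrite rmorphM unitrM negb_and => /orP.
Qed.

End Lrs.

(** * The spectrum of an algebra *)

Section Spectrum.
Context (k : fieldType) (A : comAlgType k).

Definition spec_pt := {p : set A | is_prime_ideal p}.

HB.instance Definition _ := gen_eqMixin spec_pt.
HB.instance Definition _ := gen_choiceMixin spec_pt.

Implicit Types (x y : spec_pt).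

(** The basic open set of a contains x. *)
Definition nz x (a : A) : Prop := ~ proj1_sig x a.

Lemma nz1 x : nz x 1.
Proof. by case: x => p []. Qed.
Arguments nz1 : clear implicits.
Lemma nzM x a b : nz x (a * b) <-> nz x a /\ nz x b.
Proof.
case: x => p [p0 pD pM p1 pP] /=; rewrite /nz /=; split.
  by move=> ab; split=> h; apply: ab; [rewrite mulrC|]; exact: pM.
by move=> [ha hb] /pP[].
Qed.
Lemma nz0 x : ~ nz x 0.
Proof. by case: x => p [p0 ? ? ? ?] /=; rewrite /nz /= => /(_ p0). Qed.
Arguments nz0 : clear implicits.

Definition spec_open_set (V : set spec_pt) : Prop :=
  forall x, V x -> exists c, nz x c /\ forall y, nz y c -> V y.

Fact spec_openT : spec_open_set setT.
Proof. by move=> x _; exists 1; split=> //; exact: nz1. Qed.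
Fact spec_openI : setI_closed spec_open_set.
Proof.
move=> U V oU oV x [/oU[c [xc cU]] /oV[d [xd dV]]]; exists (c * d).
split; first exact/nzM.
by move=> y /nzM[yc yd]; split; [exact: cU | exact: dV].
Qed.
Fact spec_openU : forall (I : Type) (f : I -> set spec_pt),
  (forall i, spec_open_set (f i)) -> spec_open_set (\bigcup_i f i).
Proof.
move=> I f oF x [i _ fx]; have [c [xc cF]] := oF i x fx.
by exists c; split=> // y /cF fy; exists i.
Qed.
HB.instance Definition _ :=
  isOpenTopological.Build spec_pt spec_openT spec_openI spec_openU.

Lemma spec_openE (V : set spec_pt) : open V <-> spec_open_set V.
Proof. by []. Qed.

Lemma open_nz (c : A) : open [set x | nz x c].
Proof. by apply/spec_openE => x xc; exists c. Qed.

Definition loc_data x : mult_mod A.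
Proof.
apply: (@MultMod A (nz x) [set 0]) => [|s t xs xt|||a b ->|s xs s0].
- exact: nz1.
- exact/nzM.
- by [].
- by move=> a b -> ->; rewrite addr0.
- by rewrite mulr0.
- by move: xs; rewrite s0; exact: nz0.
Defined.

Definition spec_stalk x : comUnitAlgType k := fractions (loc_data x).

Definition germ (a : A) x : spec_stalk x := tofr (loc_data x) a.

(** An inverse b / s of the germ of a gives u b a = u s off the prime ideal, so a
    is not in it. *)
Lemma germ_unit a x : germ a x \is a GRing.unit <-> nz x a.
Proof.
split; last by move=> xa; exact: (@tofr_dens _ _ (loc_data x)).
move=> /unitrP[g [ga _]] pa; have [b [s [xs eg]]] := fracP g.
have us : germ s x \is a GRing.unit by exact: (@tofr_dens _ _ (loc_data x)).
have e : germ (b * a) x = germ s x.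
  rewrite /germ rmorphM /= -/(germ b x) -/(germ a x) -/(germ s x).
  by rewrite -[RHS]mul1r -ga eg [RHS]mulrAC divrK.
have : germ (b * a - s) x = 0 by rewrite /germ rmorphB /= -/(germ _ x) e subrr.
move=> /tofr_eq0[u [xu]]; rewrite /= mulrBr => /eqP; rewrite subr_eq0 => /eqP eu.
have : nz x (u * s) by apply/nzM.
by rewrite -eu mulrA => /nzM[_].
Qed.

Lemma germ_eq0 a x : germ a x = 0 <-> exists u, nz x u /\ u * a = 0.
Proof. exact: tofr_eq0. Qed.

Lemma germP x (g : spec_stalk x) : exists a b, nz x b /\ g = germ a x / germ b x.
Proof. exact: (@fracP _ _ (loc_data x) g). Qed.

Lemma germM a b x : germ (a * b) x = germ a x * germ b x.
Proof. exact: rmorphM. Qed.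
Lemma germB a b x : germ (a - b) x = germ a x - germ b x.
Proof. exact: rmorphB. Qed.

(** The open set of definition of the fraction is cut out by its denominator: a
    smaller basic open set D(c) is reached by expanding a / b to a c / (b c). *)
Definition regular (U : set spec_pt) (s : forall x, spec_stalk x) : Prop :=
  forall x, U x -> exists a b, nz x b /\
    forall y, U y -> nz y b -> s y = germ a y / germ b y.

Lemma divr_expand (R : comUnitRingType) (a b c : R) : b \is a GRing.unit ->
  c \is a GRing.unit -> a / b = (a * c) / (b * c).
Proof. by move=> ub uc; rewrite invrM // mulrA mulrK. Qed.

Fact spec_glue U s : open U ->
  (forall x, U x -> exists V t,
    [/\ open V, V x, regular V t & forall y, U y -> V y -> s y = t y]) ->
  regular U s.
Proof.
move=> oU loc x Ux; have [V [t [oV Vx tV st]]] := loc x Ux.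
have [a [b [xb tab]]] := tV x Vx; have [c [xc cV]] := oV x Vx.
exists (a * c), (b * c); split; first exact/nzM.
move=> y Uy /nzM[yb yc]; rewrite st ?tab //; try exact: cV.
by rewrite !germM; apply: divr_expand; exact/germ_unit.
Qed.

Fact regular_scalar U (c : k) : open U -> regular U (fun x => c%:A).
Proof.
move=> oU x Ux; exists c%:A, 1; split; first exact: nz1.
by move=> y _ _; rewrite /germ rmorph1 divr1 rmorph_alg.
Qed.

Fact regular_sub U s t : open U -> regular U s -> regular U t ->
  regular U (fun x => s x - t x).
Proof.
move=> oU sU tU x Ux; have [a [b [xb sab]]] := sU x Ux.
have [c [d [xd tcd]]] := tU x Ux; exists (a * d - c * b), (b * d).
split; first exact/nzM.
move=> y Uy /nzM[yb yd]; have ub := (germ_unit b y).2 yb.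
have ud := (germ_unit d y).2 yd; rewrite sab // tcd // (divr_expand _ ub ud).
by rewrite (divr_expand _ ud ub) [germ d y * _]mulrC -mulrBl germB !germM.
Qed.

Fact regular_mul U s t : open U -> regular U s -> regular U t ->
  regular U (fun x => s x * t x).
Proof.
move=> oU sU tU x Ux; have [a [b [xb sab]]] := sU x Ux.
have [c [d [xd tcd]]] := tU x Ux; exists (a * c), (b * d).
split; first exact/nzM.
move=> y Uy /nzM[yb yd]; have ub := (germ_unit b y).2 yb.
have ud := (germ_unit d y).2 yd; rewrite sab // tcd // !germM invrM //.
by rewrite mulrACA [(germ b y)^-1 * _]mulrC.
Qed.

Fact spec_germ_section x (g : spec_stalk x) :
  exists U s, [/\ open U, U x, regular U s & s x = g].
Proof.
have [a [b [xb ->]]] := germP g.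
exists [set y | nz y b], (fun y => germ a y / germ b y); split=> //.
  exact: open_nz.
by move=> y yb; exists a, b.
Qed.

Fact spec_germ_eq U s t x : open U -> regular U s -> regular U t ->
  U x -> s x = t x -> \forall y \near x, s y = t y.
Proof.
move=> oU sU tU Ux; have [a [b [xb sab]]] := sU x Ux.
have [c [d [xd tcd]]] := tU x Ux; rewrite sab // tcd // => e.
have key y : nz y b -> nz y d ->
    germ a y / germ b y = germ c y / germ d y <-> germ (a * d - c * b) y = 0.
  move=> /germ_unit ub /germ_unit ud; rewrite germB !germM.
  split=> [e'|/eqP]; last first.
    rewrite subr_eq0 => /eqP e'; apply: (canRL (mulrK ud)); rewrite mulrAC.
    exact: (canLR (mulrK ub)).
  apply/eqP; rewrite subr_eq0; apply/eqP.
  by move/(canRL (mulrVK ub)): e' => ->; rewrite mulrAC divrK.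
have /germ_eq0[u [xu eu]] := (key x xb xd).1 e.
have [w [xw wU]] := oU x Ux.
rewrite /prop_near1 nbhsE; exists [set y | nz y (u * b * d * w)].
  split; first exact: open_nz.
  by apply/nzM; split=> //; apply/nzM; split=> //; apply/nzM.
move=> y /nzM[/nzM[/nzM[yu yb] yd] yw] /=.
have Uy := wU y yw; rewrite sab // tcd //; apply/(key y yb yd)/germ_eq0.
by exists u.
Qed.

Fact spec_stalk_local x (a b : spec_stalk x) : a + b \is a GRing.unit ->
  a \is a GRing.unit \/ b \is a GRing.unit.
Proof.
have [a1 [a2 [/germ_unit xa ->]]] := germP a.
have [b1 [b2 [/germ_unit xb ->]]] := germP b.
have e : germ a1 x / germ a2 x + germ b1 x / germ b2 x =
    germ (a1 * b2 + b1 * a2) x / (germ a2 x * germ b2 x).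
  rewrite (divr_expand _ xa xb) (divr_expand _ xb xa) [germ b2 x * _]mulrC -mulrDl.
  by rewrite /germ rmorphD !rmorphM.
have uab : (germ a2 x * germ b2 x)^-1 \is a GRing.unit by rewrite unitrV unitrM xa xb.
rewrite e (unitrMl _ uab) => /germ_unit h.
have ua : (germ a2 x)^-1 \is a GRing.unit by rewrite unitrV.
have ub : (germ b2 x)^-1 \is a GRing.unit by rewrite unitrV.
rewrite (unitrMl _ ua) (unitrMl _ ub).
have [/germ_unit xa1|xa1] := pselect (nz x a1); first by left.
right; apply/germ_unit => xb1; apply: h; case: x {uab ua ub xa xb e a b} xb1 xa1 => p [p0 pD pM p1 pP] /=.
rewrite /nz /= => pb1 /contrapT pa1.
by apply: pD; rewrite mulrC; exact: pM.
Qed.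

Definition spec_lrs : lrs k := @LRS k spec_pt spec_stalk regular
  spec_glue regular_scalar regular_sub regular_mul
  spec_germ_section spec_germ_eq spec_stalk_local.

Lemma spec_is_spec : @is_spec k spec_lrs setT A germ.
Proof.
split.
- exact: openT.
- move=> a x _; exists a, 1; split; first exact: nz1.
  by move=> y _ _; rewrite /germ rmorph1 divr1.
- by move=> x _; exists (tofr (loc_data x)).
- move=> p pp; exists (exist _ p pp); split.
    split=> // a; split=> [pa|]; first by apply/negP => /germ_unit; apply.
    by move=> /negP h; apply: contrapT => pa; apply: h; exact/germ_unit.
  move=> [p' pp'] [_ h]; apply: eq_exist; apply/seteqP; split=> a.
    by move=> /h/negP h'; apply: contrapT => pa; apply: h'; exact/germ_unit.
  by move=> pa; apply/h; apply/negP => /germ_unit; apply.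
- move=> V x oV _ Vx; have [c [xc cV]] := oV x Vx.
  exists c; split; first exact/germ_unit.
  by move=> y _ /germ_unit; exact: cV.
- move=> x g _; have [a [b [xb eg]]] := germP g; exists a, b; split=> //.
  exact/germ_unit.
- move=> x a _ /germ_eq0[u [xu ua]]; exists u; split=> //; exact/germ_unit.
Qed.

Fact spec_locally_affine (x : spec_lrs) : exists U, affine U /\ U x.
Proof. by exists setT; split=> //; exists A, germ; exact: spec_is_spec. Qed.

Definition Spec : scheme k := Scheme spec_locally_affine.

End Spectrum.

(** * Morphisms into an affine open set *)

Lemma lrmorph_eq (k : fieldType) (A B : comAlgType k) (g h : {lrmorphism A -> B}) :
  g =1 h -> g = h.
Proof.
case: g => g [[cg0] [cg1] [cg2]]; case: h => h [[ch0] [ch1] [ch2]] /= /funext e; subst h.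
by congr (GRing.LRMorphism.Pack (GRing.LRMorphism.Class _ _ _));
  congr (_ _); exact: Prop_irrelevance.
Qed.

(** Pullbacks of families avoid comparing on_stalks m t with on_stalks m' t, whose
    types differ until m t and m' t are identified. *)
Lemma morphism_eq (k : fieldType) (T X : lrs k) (m m' : lrs_morphism T X) :
  (forall t, m t = m' t) ->
  (forall s, pullback_section m s = pullback_section m' s) -> m = m'.
Proof.
case: m => f F f1 f2 f3; case: m' => g G g1 g2 g3 /= /funext e; subst g.
rewrite /pullback_section /= => e.
have e' : F = G.
  apply: functional_extensionality_dep => t; apply: lrmorph_eq => a.
  have [U [s [_ _ _ <-]]] := germ_section a.
  by have /(congr1 (fun h => h t)) := e s.
subst G; congr Morphism; exact: Prop_irrelevance.
Qed.

Section ToSpec.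
Context (k : fieldType) (X : lrs k) (U : set X) (A : comAlgType k)
  (phi : A -> forall x, stalk X x) (HU : is_spec U phi).

Lemma spec_pt_unique x y : U x -> U y ->
  (forall a, phi a x \is a GRing.unit <-> phi a y \is a GRing.unit) -> x = y.
Proof.
move=> Ux Uy e; have [g gE] := spec_morphism HU Ux.
have [z [_ uz]] := spec_points HU (nonunit_prime g).
rewrite -(uz x) ?(uz y) //; split=> // a; rewrite /= -gE.
  by split=> /negP h; apply/negP => h'; apply: h; apply/e.
by [].
Qed.

(** A morphism into an affine open set is the same as an algebra map to global
    sections: t goes to the point whose prime ideal is the set of functions that
    are not invertible at t, and the map of stalks is the extension to
    fractions. *)
Section Construction.
Context (T : lrs k) (theta : A -> forall t, stalk T t).
Hypothesis theta_section : forall a, section T setT (theta a).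
Hypothesis theta_morphism : forall t,
  exists g : {lrmorphism A -> stalk T t}, forall a, theta a t = g a.

Lemma to_spec_pointwise t : exists x, U x /\
  exists h : {lrmorphism stalk X x -> stalk T t},
    (forall a, h (phi a x) = theta a t) /\
    (forall e, h e \is a GRing.unit -> e \is a GRing.unit).
Proof.
have [g gE] := theta_morphism t.
have [x [[Ux xE] _]] := spec_points HU (nonunit_prime g).
exists x; split=> //; have [f fE] := spec_morphism HU Ux.
have gU a : f a \is a GRing.unit <-> g a \is a GRing.unit.
  have := xE a; rewrite /= fE => -[h h']; split=> ua; apply: contrapT => /negP.
    by move=> /h; rewrite ua.
  by move=> /h'; rewrite ua.
have fF e : exists a b, f b \is a GRing.unit /\ e = f a / f b.
  by have [a [b]] := spec_stalk_frac HU e Ux; rewrite !fE; exists a, b.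
have [h hE] : exists h : {lrmorphism stalk X x -> stalk T t}, forall a, h (f a) = g a.
  apply: fraction_extension.
    move=> e; have [a [b [ub ->]]] := fF e; exists a, b; split=> //; exact/gU.
  move=> a fa0; have := @spec_stalk_ker _ _ _ _ _ HU x a Ux; rewrite fE => /(_ fa0)[b].
  rewrite fE => -[/gU ub ba0]; apply: (mulrI ub).
  by rewrite mulr0 -rmorphM ba0 rmorph0.
exists h; split=> [a|e]; first by rewrite fE hE gE.
have [a [b [ub ->]]] := fF e; rewrite rmorphM /= unitrM => /andP[].
by rewrite hE => /gU ua _; rewrite unitrM ua unitrV.
Qed.

Let mp t := projT1 (cid (to_spec_pointwise t)).
Let mpU t : U (mp t).
Proof. by rewrite /mp; case: cid => x []. Qed.
Let ms t : {lrmorphism stalk X (mp t) -> stalk T t} :=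
  projT1 (cid (proj2 (projT2 (cid (to_spec_pointwise t))))).
Let ms_phi t a : ms t (phi a (mp t)) = theta a t.
Proof. exact: (proj1 (projT2 (cid (proj2 (projT2 (cid (to_spec_pointwise t))))))). Qed.
Let ms_local t e : ms t e \is a GRing.unit -> e \is a GRing.unit.
Proof. exact: (proj2 (projT2 (cid (proj2 (projT2 (cid (to_spec_pointwise t)))))) e). Qed.

Let mp_continuous : continuous mp.
Proof.
apply/continuousP => V oV; rewrite openE => t /= Vt.
have [a [ua aV]] := spec_basis HU oV (mpU t) Vt.
have : theta a t \is a GRing.unit by rewrite -ms_phi; exact: rmorph_unit.
move=> /(unit_near openT (theta_section a) I)[O [oO Ot _ Ou]].
rewrite /interior nbhsE; exists O => // y /Ou uy.
apply: aV; first exact: mpU.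
by apply: (@ms_local y); rewrite ms_phi.
Qed.

Let ms_section V s : open V -> section X V s ->
  section T (mp @^-1` V) (fun t => ms t (s (mp t))).
Proof.
move=> oV sV; have oW : open (mp @^-1` V).
  by apply: open_comp => // t _; exact: mp_continuous.
apply: section_glue => // t /= Vt.
have [a [b [ub sE]]] := spec_stalk_frac HU (s (mp t)) (mpU t).
have [O1 [oO1 O1x O1U O1u]] := unit_near (spec_open HU) (spec_section HU b) (mpU t) ub.
have frO1 : section X O1 (fun x => phi a x / phi b x).
  apply: section_mul => //.
    exact: section_restr (spec_open HU) _ (spec_section HU a) O1U.
  by apply: section_inv => //; apply: section_restr (spec_open HU) _ (spec_section HU b) O1U.
have [O [oO Ox OV OE]] := section_eq_near oV oO1 sV frO1 Vt O1x sE.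
have oO' : open (mp @^-1` O) by apply: open_comp => // y _; exact: mp_continuous.
have uO y : O (mp y) -> theta b y \is a GRing.unit.
  by move=> /OV[_ /O1u uy]; rewrite -ms_phi; exact: rmorph_unit.
exists (mp @^-1` O), (fun t => theta a t / theta b t); split=> //.
  apply: section_mul => //; first exact: section_restr openT _ (theta_section a) _.
  by apply: section_inv => //; apply: section_restr openT _ (theta_section b) _.
move=> y Vy Oy; rewrite OE // rmorph_div //=; last by have [_ /O1u] := OV _ Oy.
by rewrite !ms_phi.
Qed.

Lemma to_spec : exists m : lrs_morphism T X,
  (forall t, U (m t)) /\ forall a, pullback_section m (phi a) = theta a.
Proof.
exists (Morphism mp_continuous ms_local ms_section); split=> // a.
by apply: functional_extensionality_dep => t; exact: ms_phi.
Qed.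

End Construction.

Lemma to_spec_unique (T : lrs k) (m m' : lrs_morphism T X) :
  (forall t, U (m t)) -> (forall t, U (m' t)) ->
  (forall a, pullback_section m (phi a) = pullback_section m' (phi a)) -> m = m'.
Proof.
move=> Um Um' e.
have eat a t : on_stalks m t (phi a (m t)) = on_stalks m' t (phi a (m' t)).
  by have /(congr1 (fun h => h t)) := e a.
have ept t : m t = m' t.
  apply: spec_pt_unique => // a; split=> ua.
    by apply: (@morphism_local _ _ _ m' t); rewrite -eat; exact: rmorph_unit.
  by apply: (@morphism_local _ _ _ m t); rewrite eat; exact: rmorph_unit.
apply: morphism_eq => // s; apply: functional_extensionality_dep => t.
rewrite /pullback_section; have [a [b [ub sE]]] := spec_stalk_frac HU (s (m t)) (Um t).
have [ub' sE'] : phi b (m' t) \is a GRing.unit /\ s (m' t) = phi a (m' t) / phi b (m' t).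
  by rewrite -ept.
by rewrite sE sE' !rmorph_div //= !eat.
Qed.

End ToSpec.

(** * Morphisms from the spectrum of a ring to a scheme *)

Lemma germ_of_unit (k : fieldType) (E : comUnitAlgType k) (B : comAlgType k)
    (f : {lrmorphism E -> B}) e (t : spec_pt B) :
  e \is a GRing.unit -> germ (f e) t \is a GRing.unit.
Proof. by move=> ue; exact: (rmorph_unit (tofr (loc_data t) \o f)). Qed.

Section FromStalk.
Context (k : fieldType) (X : scheme k).

(** The morphism from the spectrum of B to X that is given by an algebra map from a
    single stalk of X: it factors through every neighbourhood O of x, and pulls a
    section over O back to the image of its germ at x. *)
Definition from_stalk (B : comAlgType k) x (f : {lrmorphism stalk X x -> B})
    (m : lrs_morphism (Spec B) X) : Prop :=
  forall (O : set X) s, open O -> O x -> section X O s ->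
    (forall t, O (m t)) /\ pullback_section m s = @germ k B (f (s x)).

(** In an affine neighbourhood U of x the map O(U) -> O_x -> B defines it. A section
    over any O is a fraction on a basic open set D(c) around x, and the image of c
    is a unit of B, so all of the spectrum lands in D(c). *)
Lemma from_stalk_exists (B : comAlgType k) x (f : {lrmorphism stalk X x -> B}) :
  exists m, from_stalk f m.
Proof.
have [U [[A [phi HU]] Ux]] := locally_affine x.
have [g gE] := spec_morphism HU Ux.
have [m [mU mE]] : exists m : lrs_morphism (Spec B) X,
    (forall t, U (m t)) /\ forall a, pullback_section m (phi a) = @germ k B (f (g a)).
  apply: (to_spec HU) => [a|t]; first exact: (spec_section (spec_is_spec B)).
  by exists (tofr (loc_data t) \o f \o g).
exists m => O s oO Ox sO.
have [a [b [ub sE]]] := spec_stalk_frac HU (s x) Ux.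
have [O1 [oO1 O1x O1U O1u]] := unit_near (spec_open HU) (spec_section HU b) Ux ub.
have frO1 : section X O1 (fun x => phi a x / phi b x).
  apply: section_mul => //.
    exact: section_restr (spec_open HU) _ (spec_section HU a) O1U.
  by apply: section_inv => //; apply: section_restr (spec_open HU) _ (spec_section HU b) O1U.
have [V [oV Vx VO VE]] := section_eq_near oO oO1 sO frO1 Ox O1x sE.
have [c [uc cV]] := spec_basis HU oV Ux Vx.
have phiE a' t : on_stalks m t (phi a' (m t)) = germ (f (g a')) t.
  by have /(congr1 (fun h => h t)) := mE a'.
have mV t : V (m t).
  apply: cV => //; apply: (@morphism_local _ _ _ m t); rewrite phiE.
  by apply: germ_of_unit; rewrite -gE.
split=> [t|]; first by have [] := VO _ (mV t).
apply: functional_extensionality_dep => t; rewrite /pullback_section VE //.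
have [_ /O1u ubt] := VO _ (mV t).
rewrite rmorph_div //= !phiE sE !gE.
have ugb : g b \is a GRing.unit by rewrite -gE.
by symmetry; exact: (rmorph_div (tofr (loc_data t) \o f) (g a) ugb).
Qed.

Lemma from_stalk_pt (B : comAlgType k) x (f : {lrmorphism stalk X x -> B}) m t :
  from_stalk f m -> (forall e, nz t (f e) -> e \is a GRing.unit) -> m t = x.
Proof.
move=> fm loc; have [U [[A [phi HU]] Ux]] := locally_affine x.
have mU : U (m t) by have [] := fm U (phi 0) (spec_open HU) Ux (spec_section HU 0).
apply: (spec_pt_unique HU) => // a.
have [_ /(congr1 (fun h => h t)) e] := fm U (phi a) (spec_open HU) Ux (spec_section HU a).
split=> ua; last first.
  apply: (@morphism_local _ _ _ m t); move: e; rewrite /pullback_section => ->.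
  exact: germ_of_unit.
by apply: loc; apply/germ_unit; rewrite -e; exact: rmorph_unit.
Qed.

Lemma from_stalk_unique (T : lrs k) (m m' : lrs_morphism T X) x :
  (forall (O : set X) s, open O -> O x -> section X O s ->
    [/\ forall t, O (m t), forall t, O (m' t)
       & pullback_section m s = pullback_section m' s]) -> m = m'.
Proof.
move=> e; have [U [[A [phi HU]] Ux]] := locally_affine x.
have eU a := e U (phi a) (spec_open HU) Ux (spec_section HU a).
by apply: (to_spec_unique HU) => [||a]; [have [] := eU 0 | have [] := eU 0 | have [] := eU a].
Qed.

End FromStalk.

Lemma Spec_map (k : fieldType) (A B : comAlgType k) (f : {lrmorphism A -> B}) :
  exists g : lrs_morphism (Spec B) (Spec A),
    forall a, pullback_section g (@germ k A a) = @germ k B (f a).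
Proof.
have [g [_ gE]] : exists m : lrs_morphism (Spec B) (Spec A), (forall t, setT (m t)) /\
    forall a, pullback_section m (@germ k A a) = @germ k B (f a).
  apply: (to_spec (spec_is_spec A)) => [a|t].
    exact: (spec_section (spec_is_spec B)).
  by exists (tofr (loc_data t) \o f).
by exists g.
Qed.

Section ClosedPoint.
Context (k : fieldType) (X : lrs k) (x : X).
Let E := stalk X x.

Lemma nonunits_prime : is_prime_ideal [set a : E | a \isn't a GRing.unit].
Proof. exact: (nonunit_prime (idfun : {lrmorphism E -> stalk X x})). Qed.

Definition closed_pt : spec_pt E := exist _ _ nonunits_prime.

Lemma nz_closed_pt (e : E) : nz closed_pt e <-> e \is a GRing.unit.
Proof.
by rewrite /nz /=; split=> [h|-> //]; apply: contrapT => /negP.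
Qed.

Lemma germ_closed_pt (e : E) : germ e closed_pt = 0 -> e = 0.
Proof.
move=> /germ_eq0[u [/nz_closed_pt uu ue]]; apply: (mulrI uu).
by rewrite mulr0.
Qed.
End ClosedPoint.

(** This is how stalks of an object with a universal property are computed. Given
    h : Spec B -> P that induces mu : B -> O_y, the composite
    Spec O_y -> Spec B -> P is, by uniqueness in the universal property, the
    canonical morphism. On stalks over the closed point this composite is the
    identity of O_y, so germs at y are fractions from B; and h splits mu near the
    image of the closed point, so the kernel of mu is that of a localization. *)
Lemma stalk_recognition (k : fieldType) (P : scheme k) (y : P) (B : comAlgType k)
    (mu : {lrmorphism B -> stalk P y}) (h : lrs_morphism (Spec B) P)
    (i : lrs_morphism (Spec (stalk P y)) P) (g : lrs_morphism (Spec (stalk P y)) (Spec B)) :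
  from_stalk (idfun : {lrmorphism stalk P y -> stalk P y}) i ->
  (forall b, pullback_section g (@germ k B b) = @germ k (stalk P y) (mu b)) ->
  compose h g = i ->
  (forall b, exists s, s y = mu b /\ forall t, h t = y -> pullback_section h s t = germ b t) ->
  (forall e, exists a b, mu b \is a GRing.unit /\ e * mu b = mu a) /\
  (forall b, mu b = 0 -> exists u, mu u \is a GRing.unit /\ u * b = 0).
Proof.
move=> iP gP hg hP; pose c := closed_pt y; pose x0 := g c.
have gE b : on_stalks g c (germ b x0) = germ (mu b) c.
  by have /(congr1 (fun h => h c)) := gP b.
have hx0 : h x0 = y.
  rewrite -(from_stalk_pt (t := c) iP) -?hg //.
  by move=> e /nz_closed_pt.
have gU b : nz x0 b -> mu b \is a GRing.unit.
  move=> /germ_unit ub; apply/nz_closed_pt/germ_unit; rewrite -gE.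
  exact: rmorph_unit.
split=> [e|b mub0].
  have [O [s [oO Oy sO sE]]] := germ_section e.
  have [_ /(congr1 (fun h => h c))] := iP O s oO Oy sO; rewrite sE -hg => se.
  have [a [b [xb ab]]] := germP (pullback_section h s x0).
  exists a, b; split; first exact: gU.
  have ub := (germ_unit _ _).2 xb.
  apply/eqP; rewrite -subr_eq0; apply/eqP/(@germ_closed_pt _ _ y).
  rewrite germB germM -!gE -se; apply/eqP; rewrite subr_eq0; apply/eqP.
  have -> : pullback_section (compose h g) s c = on_stalks g c (pullback_section h s x0).
    by [].
  by rewrite ab -rmorphM divrK.
have [s [sE ht]] := hP b; move: (ht x0 hx0).
have s0 : s (h x0) = 0 by rewrite hx0 sE.
rewrite /pullback_section s0 rmorph0 => /esym/germ_eq0[u [xu ub]].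
by exists u; split=> //; exact: gU.
Qed.

(** * Stalks of a fibre *)

Lemma compose_assoc (k : fieldType) (X Y Z T : lrs k) (h : lrs_morphism Z T)
    (g : lrs_morphism Y Z) (f : lrs_morphism X Y) :
  compose h (compose g f) = compose (compose h g) f.
Proof. exact: morphism_eq. Qed.

Lemma from_stalk_pull (k : fieldType) (X Y : scheme k) (B : comAlgType k) (p : lrs_morphism X Y)
    x (f : {lrmorphism stalk X x -> B}) m (O : set Y) s :
  from_stalk f m -> open O -> O (p x) -> section Y O s ->
  (forall t, O (p (m t))) /\
  pullback_section (compose p m) s = @germ k B (f (on_stalks p x (s (p x)))).
Proof.
move=> fm oO Ox sO; have oO' : open (p @^-1` O).
  by apply: open_comp => // t _; exact: morphism_continuous.
exact: (fm _ _ oO' Ox (morphism_section p oO sO)).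
Qed.

Section FibreStalk.
Context (k : fieldType) (Z S F K : scheme k) (pi : lrs_morphism Z S)
  (j : lrs_morphism F Z) (i : lrs_morphism K S) (q : lrs_morphism F K).
Context (sigma : S) (Hres : is_residue_spec sigma i) (Hfib : is_fibre_product pi i j q).
Context (x : F).

(** The ideal generated by the maximal ideal of O_sigma, where q x is the point of
    the residue spectrum K. Germs on S are written as values of families, which
    avoids transporting them along the equality of pi (j x) and i (q x). *)
Definition fibre_ideal (e : stalk Z (j x)) : Prop :=
  forall I : set (stalk Z (j x)), I 0 -> (forall a b, I a -> I b -> I (a + b)) ->
    (forall a b, I b -> I (a * b)) ->
    (forall r, pullback_section i r (q x) = 0 -> I (pullback_section pi r (j x))) -> I e.

Lemma fibre_pull r : on_stalks j x (pullback_section pi r (j x)) =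
  on_stalks q x (pullback_section i r (q x)).
Proof.
have := Hfib.1 => /(congr1 (fun m => pullback_section m r)).
by move=> /(congr1 (fun h => h x)).
Qed.

Lemma fibre_ideal_ker e : fibre_ideal e -> on_stalks j x e = 0.
Proof.
move=> Ie; apply: (Ie [set e | on_stalks j x e = 0]) => [|a b ea eb|a b eb|r r0] /=.
- exact: rmorph0.
- by rewrite rmorphD /= ea eb addr0.
- by rewrite rmorphM /= eb mulr0.
- by rewrite fibre_pull r0 rmorph0.
Qed.

Definition fibre_data : mult_mod (stalk Z (j x)).
Proof.
apply: (@MultMod (stalk Z (j x)) [set 1] fibre_ideal) => [|s t|I||a b Ib I|s].
- by [].
- by move=> -> ->; rewrite mulr1.
- by [].
- by move=> a b ha hb I I0 ID IM Ir; apply: (ID); [exact: ha | exact: hb].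
- by move=> I0 ID IM Ir; apply: (IM); exact: Ib.
- by move=> -> /fibre_ideal_ker/eqP; rewrite rmorph1 oner_eq0.
Defined.

Let B : comAlgType k := fractions fibre_data.

Let red : {lrmorphism stalk Z (j x) -> B} := tofr fibre_data.

Let redP (b : B) : exists e, b = red e.
Proof.
have [e [s [-> ->]]] := fracP b; exists e.
by rewrite /red /= rmorph1 divr1.
Qed.

Let red_eq0 e : red e = 0 -> fibre_ideal e.
Proof. by move=> /tofr_eq0[u [-> ]]; rewrite mul1r. Qed.

Let red_ideal e : fibre_ideal e -> red e = 0.
Proof. by move=> Ie; apply/tofr_eq0; exists 1; split=> //; rewrite mul1r. Qed.

Let lift (c : stalk K (q x)) : exists r, pullback_section i r (q x) = c.
Proof.
have [b bc] := residue_surj Hres c.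
have [O [r [_ _ _ rb]]] := germ_section b; exists r.
by rewrite /pullback_section rb.
Qed.

(* kappa is a quotient of O_sigma, hence maps to the quotient B of O_z. *)
Let residue_red : exists psi : {lrmorphism stalk K (q x) -> B}, forall r,
  psi (pullback_section i r (q x)) = red (pullback_section pi r (j x)).
Proof.
pose psi c := red (pullback_section pi (projT1 (cid (lift c))) (j x)).
have psiE r : psi (pullback_section i r (q x)) = red (pullback_section pi r (j x)).
  rewrite /psi; case: cid => s /= sE; apply/eqP.
  rewrite -subr_eq0 -rmorphB; apply/eqP/red_ideal => I I0 ID IM Ir.
  have := Ir (fun y => s y - r y); rewrite /pullback_section !rmorphB; apply.
  by apply/eqP; rewrite subr_eq0; apply/eqP.
have [psi' psi'E] : exists psi' : {lrmorphism stalk K (q x) -> B}, forall c, psi' c = psi c.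
  apply: lrmorph_exists => [c d /=||c d /=|a c /=].
  - have [r <-] := lift c; have [s <-] := lift d.
    have -> : pullback_section i r (q x) - pullback_section i s (q x) =
      pullback_section i (fun y => r y - s y) (q x) by rewrite /pullback_section rmorphB.
    rewrite !psiE -rmorphB; congr (red _); exact: rmorphB.
  - have -> : 1 = pullback_section i (fun y => 1) (q x) by rewrite /pullback_section rmorph1.
    by rewrite psiE /pullback_section rmorph1 rmorph1.
  - have [r <-] := lift c; have [s <-] := lift d.
    have -> : pullback_section i r (q x) * pullback_section i s (q x) =
      pullback_section i (fun y => r y * s y) (q x) by rewrite /pullback_section rmorphM.
    rewrite !psiE -rmorphM; congr (red _); exact: rmorphM.
  - have [r <-] := lift c.
    have -> : a *: pullback_section i r (q x) =
      pullback_section i (fun y => a *: r y) (q x) by rewrite /pullback_section linearZ.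
    rewrite !psiE -linearZ; congr (red _); exact: linearZ.
by exists psi' => r; rewrite psi'E.
Qed.

(** The fibre has the expected stalk O_z / m_sigma O_z: this quotient maps to the
    fibre by the universal property, since its map from O_sigma factors through
    kappa, and stalk_recognition applies to it. *)
Theorem fibre_stalk :
  (forall g, exists e, on_stalks j x e = g) /\
  (forall e, on_stalks j x e = 0 -> fibre_ideal e).
Proof.
have [psi psiE] := residue_red.
have [mZ mZE] := from_stalk_exists red.
have [mK mKE] := from_stalk_exists psi.
have comm : compose pi mZ = compose i mK.
  have pt : pi (j x) = i (q x).
    by have := Hfib.1 => /(congr1 (fun m => on_points m x)).
  apply: (@from_stalk_unique _ _ _ _ _ (pi (j x))) => O s oO Ox sO.
  have [mZO mZs] := from_stalk_pull mZE oO Ox sO.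
  have Ox' : O (i (q x)) by rewrite -pt.
  have [mKO mKs] := from_stalk_pull mKE oO Ox' sO.
  by split=> //; rewrite mZs mKs -[on_stalks i _ _]/(pullback_section i s (q x)) psiE.
have [h [[hj hq] _]] := Hfib.2 _ mZ mK comm.
have [mu muE] : exists mu : {lrmorphism B -> stalk F x}, forall e, mu (red e) = on_stalks j x e.
  apply: frac_extension; first by move=> s ->; rewrite rmorph1 unitr1.
  exact: fibre_ideal_ker.
have [io ioE] := from_stalk_exists (idfun : {lrmorphism stalk F x -> stalk F x}).
have [g gE] := Spec_map mu.
have pullg (X : lrs k) (m : lrs_morphism (Spec B) X) s b : pullback_section m s = @germ k B b ->
    pullback_section (compose m g) s = @germ k _ (mu b).
  by move=> mb; rewrite -gE -mb.
have ej : compose j io = compose mZ g.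
  apply: (@from_stalk_unique _ _ _ _ _ (j x)) => O s oO Ox sO.
  have [ioO ios] := from_stalk_pull ioE oO Ox sO.
  have [mZO mZs] := mZE O s oO Ox sO.
  by split=> // [t|]; [exact: mZO | rewrite ios (pullg _ _ _ _ mZs) muE].
have eq : compose q io = compose mK g.
  apply: (@from_stalk_unique _ _ _ _ _ (q x)) => O s oO Ox sO.
  have [ioO ios] := from_stalk_pull ioE oO Ox sO.
  have [mKO mKs] := mKE O s oO Ox sO.
  split=> // [t|]; first exact: mKO.
  rewrite ios (pullg _ _ _ _ mKs); have [r <-] := lift (s (q x)).
  by rewrite psiE muE fibre_pull.
have hg : compose h g = io.
  have comm' : compose pi (compose mZ g) = compose i (compose mK g).
    by rewrite !compose_assoc comm.
  have [h' [_ h'u]] := Hfib.2 _ _ _ comm'.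
  rewrite -(h'u io) // -(h'u (compose h g)) //.
  by rewrite !compose_assoc hj hq.
have hs b : exists s, s x = mu b /\
    forall t, h t = x -> pullback_section h s t = germ b t.
  have [e ->] := redP b; have [O [s [oO Ox sO se]]] := germ_section e.
  exists (pullback_section j s); rewrite muE /pullback_section se; split=> // t _.
  have [_ /(congr1 (fun h => h t)) mZs] := mZE O s oO Ox sO.
  by move: mZs; rewrite -hj se => <-.
have [surj ker] := stalk_recognition ioE gE hg hs.
split=> [c|e je0].
  have [a [b [ub eab]]] := surj c.
  have [a' ea] := redP a; have [b' eb] := redP b; move: ub eab; rewrite ea eb !muE.
  move=> /morphism_local ub eab; exists (a' / b'); rewrite rmorph_div //= -eab mulrK //.
  exact: rmorph_unit.
have [u [uu ub]] := ker (red e) (etrans (muE e) je0).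
have [u' eu] := redP u; move: uu ub; rewrite eu muE => /morphism_local uu.
rewrite -rmorphM => /red_eq0 Iue I I0 ID IM Ir.
by rewrite -(mulKr uu e); apply: (IM); exact: Iue.
Qed.
End FibreStalk.

(** * Quadratic extensions of polynomial rings *)

Section Quad.
Context (D : comNzRingType) (e : D).

(** D[t] / (t^2 - e), on pairs (p, q) standing for p + q t. The type is made to
    mention e because its multiplication depends on it. *)
Definition quad : Type := (fun _ => D * D)%type e.

HB.instance Definition _ := GRing.Zmodule.on quad.

Implicit Types p q r : quad.

Definition quad_mul p q : quad := (p.1 * q.1 + e * (p.2 * q.2), p.1 * q.2 + p.2 * q.1).
Definition quad_one : quad := (1, 0).

Fact quad_mulA : associative quad_mul.
Proof. by case=> a b [c d] [f g]; rewrite /quad_mul /=; congr (_, _); ring. Qed.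
Fact quad_mulC : commutative quad_mul.
Proof. by case=> a b [c d]; rewrite /quad_mul /=; congr (_, _); ring. Qed.
Fact quad_mul1 : left_id quad_one quad_mul.
Proof. by case=> a b; rewrite /quad_mul /=; congr (_, _); ring. Qed.
Fact quad_mulD : left_distributive quad_mul +%R.
Proof. by case=> a b [c d] [f g]; rewrite /quad_mul /=; congr (_, _); rewrite /=; ring. Qed.
Fact quad_1neq0 : quad_one != 0.
Proof. by apply/eqP => -[/eqP]; rewrite oner_eq0. Qed.
HB.instance Definition _ := GRing.Zmodule_isComNzRing.Build quad
  quad_mulA quad_mulC quad_mul1 quad_mulD quad_1neq0.

Definition qconst (d : D) : quad := (d, 0).
Fact qconst_additive : {morph qconst : a b / a - b}.
Proof. by move=> a b; rewrite /qconst; congr (_, _); rewrite subrr. Qed.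
Fact qconst_mul : monoid_morphism qconst.
Proof. by split=> // a b; apply: injective_projections => /=; ring. Qed.
HB.instance Definition _ := GRing.isZmodMorphism.Build D quad qconst qconst_additive.
HB.instance Definition _ := GRing.isMonoidMorphism.Build D quad qconst qconst_mul.

Definition qgen : quad := (0, 1).

Lemma qgen_sqr : qgen * qgen = qconst e.
Proof. by apply: injective_projections => /=; ring. Qed.

Lemma quadE p : p = qconst p.1 + qconst p.2 * qgen.
Proof. by apply: injective_projections => /=; ring. Qed.

Lemma quad_eval (E : comNzRingType) (f : {rmorphism D -> E}) (x : E) :
  x * x = f e -> exists g : {rmorphism quad -> E}, forall p, g p = f p.1 + f p.2 * x.
Proof.
move=> xx; pose g (p : quad) := f p.1 + f p.2 * x.
have gB : {morph g : p q / p - q}.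
  by move=> p q; rewrite /g [(p - q).1]rmorphB [(p - q).2]rmorphB !rmorphB; ring.
have gM : monoid_morphism g.
  split=> [|p q]; first by rewrite /g rmorph1 rmorph0 mul0r addr0.
  rewrite /g /= !(rmorphD, rmorphM) -xx; ring.
pose ga := GRing.isZmodMorphism.Build quad E g gB.
pose gm := GRing.isMonoidMorphism.Build quad E g gM.
pose g' : {rmorphism quad -> E} := HB.pack g ga gm.
by exists g'.
Qed.

End Quad.

Lemma poly_eval (R : nzRingType) (E : comNzRingType) (f : {rmorphism R -> E}) (a : E) :
  exists g : {rmorphism {poly R} -> E}, (forall c, g c%:P = f c) /\ g 'X = a.
Proof.
have cfa : commr_rmorph f a by move=> x; exact: mulrC.
exists (horner_morph cfa); split=> [c|].
  exact: horner_morphC.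
exact: horner_morphX.
Qed.

Lemma poly_morph_eq (R : nzRingType) (E : nzRingType) (f g : {rmorphism {poly R} -> E}) :
  (forall c, f c%:P = g c%:P) -> f 'X = g 'X -> f =1 g.
Proof.
move=> ec eX; elim/poly_ind => [|p c IH]; first by rewrite !rmorph0.
by rewrite !(rmorphD, rmorphM) /= IH eX ec.
Qed.

(** The scalars of a polynomial ring over a k-algebra R are R; this alias of a ring
    has k as its scalars. *)
Section AlgOf.
Context (k : fieldType) (B : comNzRingType) (i : {rmorphism k -> B}).
Definition alg_of : Type := (fun _ => B : Type) i.
HB.instance Definition _ := GRing.ComNzRing.on alg_of.
Definition alg_scale (c : k) (b : alg_of) : alg_of := (i c : alg_of) * b.
Fact alg_scaleA (c d : k) b : alg_scale c (alg_scale d b) = alg_scale (c * d) b.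
Proof. by rewrite /alg_scale rmorphM mulrA. Qed.
Fact alg_scale1 : left_id 1 alg_scale.
Proof. by move=> b; rewrite /alg_scale rmorph1 mul1r. Qed.
Fact alg_scaleDr : right_distributive alg_scale +%R.
Proof. by move=> c x y; rewrite /alg_scale mulrDr. Qed.
Fact alg_scaleDl x : {morph alg_scale^~ x : c d / c + d}.
Proof. by move=> c d; rewrite /alg_scale rmorphD mulrDl. Qed.
HB.instance Definition _ := GRing.Zmodule_isLmodule.Build k alg_of
  alg_scaleA alg_scale1 alg_scaleDr alg_scaleDl.
Fact alg_scaleAl (c : k) (x y : alg_of) : c *: (x * y) = c *: x * y.
Proof. exact: mulrA. Qed.
HB.instance Definition _ := GRing.Lmodule_isLalgebra.Build k alg_of alg_scaleAl.
HB.instance Definition _ := GRing.Lalgebra_isComAlgebra.Build k alg_of.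

Lemma alg_of_morph (E : comAlgType k) (f : {rmorphism B -> E}) :
  (forall c, f (i c) = c%:A) -> exists g : {lrmorphism alg_of -> E}, forall b, g b = f b.
Proof.
move=> fi; apply: (@lrmorph_exists k alg_of E f).
- exact: rmorphB.
- exact: rmorph1.
- exact: rmorphM.
- by move=> c b /=; rewrite [c *: b]/(i c * b) rmorphM fi mulr_algl.
Qed.
End AlgOf.

(** * Divisibility in a polynomial ring in two variables *)

Lemma Mmonic_eq0 (R : nzRingType) (p m : {poly R}) : m \is monic -> p * m = 0 -> p = 0.
Proof.
move=> mm pm0; apply/eqP; apply: contraT => p0.
have := size_Mmonic p0 mm; rewrite pm0 size_poly0.
have : (0 < size m)%N by rewrite size_poly_gt0 monic_neq0.
have : (0 < size p)%N by rewrite size_poly_gt0.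
by case: (size p) (size m) => [|m1] [|m2]//; rewrite addnS.
Qed.

Lemma monic_polyCmap (R : nzRingType) (c : {poly R}) : c \is monic -> c^:P \is monic.
Proof. by rewrite !monicE => /eqP e; rewrite lead_coef_map_inj ?e //; exact: polyC_inj. Qed.

(** c(a) and d(b) form a regular sequence over any ring. Divide Q by c with
    remainder T, coefficient by coefficient: multiplication by d, whose
    coefficients do not involve a, keeps the degree in a of d T below that of c,
    so d T, being divisible by c, is zero. *)
Lemma monic_vars_regular (R : comNzRingType) (c d : {poly R}) (Q Q' : {poly {poly R}}) :
  c \is monic -> d \is monic -> d^:P * Q = c%:P * Q' -> exists S, Q = c%:P * S.
Proof.
move=> mc md dQ.
pose S := map_poly (fun p => Pdiv.Ring.rdivp p c) Q.
pose T := map_poly (fun p => Pdiv.Ring.rmodp p c) Q.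
have QE : Q = c%:P * S + T.
  apply/polyP=> i; rewrite coefD coefCM !coef_map_id0 ?Pdiv.CommonRing.rdiv0p ?Pdiv.CommonRing.rmod0p //.
  by rewrite mulrC -Pdiv.RingMonic.rdivp_eq.
exists S; rewrite QE; suff -> : T = 0 by rewrite addr0.
have dT : d^:P * T = c%:P * (Q' - d^:P * S).
  by rewrite mulrBr -dQ QE mulrDr mulrCA addrAC subrr add0r.
suff dT0 : d^:P * T = 0 by apply: (Mmonic_eq0 (monic_polyCmap md)); rewrite mulrC.
have c0 : (0 < size c)%N by rewrite size_poly_gt0 monic_neq0.
apply/polyP => i; rewrite coef0.
pose u := (d^:P * T)`_i; have sz : (size u < size c)%N.
  rewrite /u coefM -(prednK c0) ltnS; apply: leq_trans (size_sum _ _ _) _.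
  apply/bigmax_leqP => l _; rewrite coef_map /= mul_polyC.
  apply: leq_trans (size_scale_leq _ _) _; rewrite -ltnS (prednK c0).
  rewrite coef_map_id0 ?Pdiv.CommonRing.rmod0p //.
  by apply: Pdiv.CommonRing.ltn_rmodpN0; exact: monic_neq0.
move: sz; rewrite /u dT coefCM mulrC; set V := _`_i => sz.
apply/eqP; apply: contraLR sz => V0; rewrite -leqNgt.
have V0' : V != 0 by apply: contraNneq V0 => ->; rewrite mul0r.
rewrite size_Mmonic //.
have : (0 < size V)%N by rewrite size_poly_gt0.
by case: (size V) => // n _; rewrite addSn /= leq_addl.
Qed.

Lemma fraction_numden (D : idomainType) (z : {fraction D}) :
  exists n d, d != 0 /\ z * tofrac d = tofrac n.
Proof.
elim/quotW: z => r; exists \n_r, \d_r; split; first exact: denom_ratioP.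
rewrite -[LHS]/(FracField.mul _ _) !piE; apply/eqmodP; rewrite /= FracField.equivfE.
rewrite /FracField.mulf !numden_Ratio ?oner_neq0 ?mulf_neq0 ?denom_ratioP ?oner_neq0 //.
by rewrite !mulr1 mulrC.
Qed.

Definition dvdr (R : comNzRingType) (a b : R) : Prop := exists q, b = a * q.

Section Field.
Context (L : fieldType).
Implicit Types (c d : {poly L}) (D N f g h : {poly {poly L}}).

(** As D Q' c = c d N = D Q d, regularity of (c, d) makes Q a multiple of c. *)
Lemma dvdr_vars c d D N : c != 0 -> d != 0 ->
  dvdr D (c%:P * N) -> dvdr D (d^:P * N) -> dvdr D N.
Proof.
wlog [mc md] : c d / c \is monic /\ d \is monic => [wl c0 d0|_ _ [Q cN] [Q' dN]].
  have lc : lead_coef c != 0 by rewrite lead_coef_eq0.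
  have ld : lead_coef d != 0 by rewrite lead_coef_eq0.
  have mc : (lead_coef c)^-1 *: c \is monic by rewrite monicE lead_coefZ mulVf.
  have md : (lead_coef d)^-1 *: d \is monic by rewrite monicE lead_coefZ mulVf.
  move=> [Q cN] [Q' dN]; apply: (wl ((lead_coef c)^-1 *: c) ((lead_coef d)^-1 *: d)).
  - by split.
  - exact: monic_neq0.
  - exact: monic_neq0.
  - exists ((lead_coef c)^-1%:P%:P * Q).
    by rewrite -mul_polyC polyCM -mulrA cN mulrCA.
  - exists ((lead_coef d)^-1%:P%:P * Q').
    rewrite -mul_polyC rmorphM /= map_polyC /= -mulrA dN mulrCA //.
have cP0 : c%:P != 0 :> {poly {poly L}} by rewrite polyC_eq0 monic_neq0.
have [D0|D0] := eqVneq D 0.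
  exists 0; rewrite mulr0; move: cN; rewrite D0 mul0r => /eqP.
  by rewrite mulf_eq0 (negPf cP0) => /eqP.
have e : d^:P * Q = c%:P * Q'.
  by apply: (mulfI D0); rewrite mulrCA -cN mulrCA dN mulrCA.
have [S QE] := monic_vars_regular mc md e; exists S.
by apply: (mulfI cP0); rewrite cN QE mulrCA.
Qed.

(** The monic equation of N / D with its denominators cleared. *)
Definition integral_rel (R : comNzRingType) n (a : nat -> R) (N D : R) : Prop :=
  N ^+ n = \sum_(i < n) a i * N ^+ i * D ^+ (n - i).

Lemma integral_rel_map (R R' : comNzRingType) (f : {rmorphism R -> R'})
    n (a : nat -> R) (N D : R) :
  integral_rel n a N D -> integral_rel n (f \o a) (f N) (f D).
Proof.
rewrite /integral_rel => e; rewrite -rmorphXn e rmorph_sum; apply: eq_bigr => i _.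
by rewrite !rmorphM !rmorphXn.
Qed.

Lemma integral_field_dvd (K : fieldType) n (a : nat -> {poly K}) (N D : {poly K}) :
  D != 0 -> integral_rel n a N D -> D %| N.
Proof.
move=> D0 rel; pose g := gcdp N D.
have g0 : g != 0 by rewrite gcdp_eq0 negb_and D0 orbT.
have [N' NE] : exists N' : {poly K}, N = N' * g.
  by exists (N %/ g); rewrite divpK // dvdp_gcdl.
have [D' DE] : exists D' : {poly K}, D = D' * g.
  by exists (D %/ g); rewrite divpK // dvdp_gcdr.
have cop : coprimep N' D'.
  have := coprimep_div_gcd (p := N) (q := D); rewrite D0 orbT => /(_ isT).
  by rewrite -/g {1}NE {1}DE !mulpK.
have rel' : integral_rel n a N' D'.
  have gn0 : g ^+ n != 0 by rewrite expf_neq0.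
  apply: (mulIf gn0); rewrite -exprMn -NE rel mulr_suml; apply: eq_bigr => i _.
  have -> : g ^+ n = g ^+ i * g ^+ (n - i) by rewrite -exprD subnKC // ltnW.
  rewrite NE DE !exprMn.
  move: (g ^+ i) (g ^+ (n - i)) (N' ^+ i) (D' ^+ (n - i)) => *; ring.
have dv : D' %| N' ^+ n.
  rewrite rel'; apply: (big_ind (fun p => D' %| p)) => [|p r|i _].
  - exact: dvdp0.
  - exact: dvdp_add.
  - by rewrite dvdp_mull // -(subnSK (ltn_ord i)) exprS dvdp_mulr.
have cop' : coprimep D' (N' ^+ n) by rewrite coprimep_sym; exact: coprimep_expl.
have D1 : D' %= 1 by exact: (coprimepP _ _ cop').
by rewrite NE DE dvdp_mul2r // (eqp_dvdl _ D1) dvd1p.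
Qed.

Lemma common_denominator (q : {poly {fraction {poly L}}}) :
  exists c (q' : {poly {poly L}}), c != 0 /\ (tofrac c)%:P * q = map_poly (@tofrac {poly L}) q'.
Proof.
elim/poly_ind: q => [|q z [c [q' [c0 cq]]]].
  by exists 1, 0; rewrite oner_neq0 mulr0 rmorph0.
have [b [d [d0 zd]]] : exists b d : {poly L}, d != 0 /\ z * tofrac d = tofrac b.
  by have [b [d []]] := fraction_numden z; exists b, d.
exists (c * d), (d%:P * q' * 'X + (c * b)%:P); rewrite mulf_neq0 //; split=> //.
rewrite [RHS]rmorphD /= [X in _ = X + _]rmorphM /= [X in _ = X * _ + _]rmorphM /= !map_polyC /= map_polyX -cq.
have alg (R : comNzRingType) (u v w t y : R) : u * v * (w * t + y) = v * (u * w) * t + u * (y * v).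
  by ring.
by rewrite !tofracM -zd !polyCM; exact: alg.
Qed.

(** L(a)[b] is a principal ideal domain, so D divides N there. *)
Lemma bivariate_dvd_outer n a D N : D != 0 -> integral_rel n a N D ->
  exists c, c != 0 /\ dvdr D (c%:P * N).
Proof.
move=> D0 rel; pose F := map_poly (@tofrac {poly L}).
have Finj : injective F by apply: map_inj_poly => [x y /eqP|]; [rewrite tofrac_eq => /eqP | exact: rmorph0].
have FD0 : F D != 0 by rewrite -(rmorph0 F) (inj_eq Finj).
have := integral_field_dvd FD0 (integral_rel_map F rel).
move=> /dvdpP[q FN]; have [c [q' [c0 cq]]] := common_denominator q.
exists c; split=> //; exists q'; apply: Finj.
have FM : {morph F : x y / x * y} by exact: rmorphM.
have {}FN : F N = q * F D := FN.
rewrite !FM FN mulrA [F c%:P](map_polyC (@tofrac {poly L})) cq; exact: mulrC.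
Qed.

(** L[a,b] is integrally closed: D divides c(a) N by the previous lemma, and
    d(b) N by the same with the variables exchanged. *)
Lemma bivariate_dvd n a D N : D != 0 -> integral_rel n a N D -> dvdr D N.
Proof.
move=> D0 rel; have [c [c0 cN]] := bivariate_dvd_outer D0 rel.
have sD0 : swapXY D != 0 by rewrite swapXY_eq0.
pose sw : {rmorphism {poly {poly L}} -> {poly {poly L}}} := @swapXY L.
have rel' : integral_rel n (sw \o a) (sw N) (sw D) by exact: integral_rel_map.
have [d [d0 [Q dN]]] := bivariate_dvd_outer sD0 rel'.
apply: (dvdr_vars c0 d0 cN); exists (swapXY Q).
by rewrite -[N]swapXYK -swapXY_polyC -rmorphM dN rmorphM /= swapXYK.
Qed.

Lemma bivariate_dvd_sqr D N : D != 0 -> dvdr (D ^+ 2) (N ^+ 2) -> dvdr D N.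
Proof.
move=> D0 [Q NQ]; apply: (@bivariate_dvd 2 (fun i => if i == 0%N then Q else 0)) => //.
by rewrite /integral_rel !big_ord_recl big_ord0 /= !mul0r !addr0 expr0 mulr1 subn0 mulrC.
Qed.

End Field.

(** * Normality of a double cover of the plane in characteristic two *)

(** The square of w = al(a) y + be(b) x in characteristic two, where
    x^2 = a^(2l+1) and y^2 = b^(2m+1). The inner variable is a, the outer b. *)
Definition cover (R : comNzRingType) (al be : {poly R}) l m : {poly {poly R}} :=
  al%:P ^+ 2 * 'X ^+ (m.*2.+1) + be^:P ^+ 2 * 'Y ^+ (l.*2.+1).

Section Normal.
Context (L : fieldType) (char_L : 2%N \in [pchar L]).
Implicit Types (al be : {poly L}) (f g h D : {poly {poly L}}).


Lemma char2 : 2%:R = 0 :> {poly {poly L}}.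
Proof. by rewrite -!(rmorph_nat polyC) (pcharf0 char_L) !rmorph0. Qed.

Lemma addpp D : D + D = 0.
Proof. by rewrite -mulr2n -mulr_natl char2 mul0r. Qed.

Lemma deriv_sqr2 D : (D ^+ 2)^`() = 0.
Proof. by rewrite deriv_exp mulr2n addpp. Qed.

Lemma deriv_sqrM f g : (f ^+ 2 * g)^`() = f ^+ 2 * g^`().
Proof. by rewrite derivM deriv_sqr2 mul0r add0r. Qed.

Lemma deriv_cover al be l m : (cover al be l m)^`() = (al%:P * 'X ^+ m) ^+ 2.
Proof.
rewrite /cover -(rmorphXn polyC l.*2.+1 'X) derivD !deriv_sqrM derivXn /= derivC.
rewrite mulr0 addr0.
by rewrite mulrSr -muln2 mulrnA mulr2n addpp add0r exprMn exprM.
Qed.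

Lemma swap_cover al be l m : swapXY (cover al be l m) = cover be al m l.
Proof.
rewrite /cover rmorphD !rmorphM !rmorphXn /= swapXY_polyC swapXY_map_polyC.
by rewrite swapXY_X swapXY_Y addrC.
Qed.

(** The derivative with respect to b kills f^2, g^2 and D^2, and takes the cover
    polynomial to (al b^m)^2: so (g al b^m / D)^2 is a polynomial, and by normality
    so is g al b^m / D. *)
Lemma cover_dvd1 al be l m f g D : D != 0 ->
  dvdr (D ^+ 2) (f ^+ 2 + g ^+ 2 * cover al be l m) -> dvdr D (g * (al%:P * 'X ^+ m)).
Proof.
move=> D0 [Q e]; apply: bivariate_dvd_sqr => //; exists Q^`().
by rewrite -deriv_sqrM -e derivD deriv_sqr2 add0r deriv_sqrM deriv_cover exprMn.
Qed.

Lemma cover_dvd2 al be l m f g D : D != 0 ->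
  dvdr (D ^+ 2) (f ^+ 2 + g ^+ 2 * cover al be l m) -> dvdr D (g * (be^:P * 'Y ^+ l)).
Proof.
move=> D0 [Q e]; have sD0 : swapXY D != 0 by rewrite swapXY_eq0.
have [] := @cover_dvd1 be al m l (swapXY f) (swapXY g) _ sD0.
  exists (swapXY Q).
  by rewrite -swap_cover -!rmorphXn -!rmorphM -rmorphD e.
move=> Q' e'; exists (swapXY Q').
have := congr1 (@swapXY L) e'.
by rewrite !rmorphM !rmorphXn /= !swapXYK swapXY_polyC swapXY_X.
Qed.

Lemma cover_eq0 al be l m f g : al != 0 ->
  f ^+ 2 + g ^+ 2 * cover al be l m = 0 -> f = 0 /\ g = 0.
Proof.
move=> al0 e; have := congr1 (@deriv _) e.
rewrite derivD deriv_sqr2 add0r deriv_sqrM deriv_cover deriv0 -exprMn => /eqP.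
rewrite expf_eq0 /= mulf_eq0 mulf_eq0 polyC_eq0 (negPf al0) expf_eq0 polyX_eq0 andbF orbF.
rewrite orbF => /eqP g0; move: e; rewrite g0 expr0n /= mul0r addr0 => /eqP.
by rewrite expf_eq0 => /eqP f0.
Qed.

(** The partial derivatives al b^m and be a^l of the cover polynomial, up to
    squares, have no common factor: the singularities are isolated. *)
Lemma cover_coprime al be l m D N : al != 0 -> be != 0 ->
  coprimep al ('X ^+ l) -> coprimep be ('X ^+ m) ->
  dvdr D (N * (al%:P * 'X ^+ m)) -> dvdr D (N * (be^:P * 'Y ^+ l)) -> dvdr D N.
Proof.
move=> al0 be0 cop1 cop2 dv1 dv2.
have dvM P Q : dvdr D P -> dvdr D (Q * P) by move=> [S ->]; exists (Q * S); rewrite mulrCA.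
have dvD P Q : dvdr D P -> dvdr D Q -> dvdr D (P + Q).
  by move=> [S ->] [S' ->]; exists (S + S'); rewrite mulrDr.
have bez (P Q : {poly L}) : coprimep P Q -> exists u v, u * P + v * Q = 1.
  by move=> /Bezout_eq1_coprimepP[[u v]] /=; exists u, v.
have X0 n : 'X ^+ n != 0 :> {poly L} by rewrite expf_neq0 ?polyX_eq0.
have YE : 'Y ^+ l = ('X ^+ l : {poly L})%:P by rewrite rmorphXn.
have XE : 'X ^+ m = ('X ^+ m : {poly L})^:P by rewrite map_polyXn.
have [u [v uv]] := bez _ _ cop1; have [u' [v' uv']] := bez _ _ cop2.
have alg (R : comNzRingType) (p r q s t n : R) : q * p + s * t = 1 ->
    forall x, r * (x * n) = (r * q) * (n * (p * x)) + (s * x) * (n * (r * t)).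
  by move=> e x; rewrite -[LHS]mulr1 -e; ring.
have h1 : dvdr D (('X ^+ m : {poly L})^:P * (be^:P * N)).
  rewrite -XE mulrCA (alg _ al%:P be^:P u%:P v%:P ('Y ^+ l)).
    by apply: dvD; apply: dvM.
  by rewrite YE -!polyCM -polyCD uv.
have h2 : dvdr D (('X ^+ l : {poly L})%:P * (al%:P * N)).
  rewrite -YE mulrCA (alg _ be^:P al%:P u'^:P v'^:P ('X ^+ m)).
    by apply: dvD; apply: dvM.
  by rewrite XE -!rmorphM -rmorphD uv' rmorph1.
have dal : dvdr D (al%:P * N).
  by apply: dvdr_vars (X0 l) (X0 m) h2 _; rewrite -XE mulrA mulrC [_ * al%:P]mulrC.
have dbe : dvdr D (be^:P * N).
  by apply: dvdr_vars (X0 l) (X0 m) _ h1; rewrite -YE mulrA mulrC [_ * be^:P]mulrC.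
exact: dvdr_vars al0 be0 dal dbe.
Qed.


Section NormalCover.
Context (G : comUnitRingType) (psi : {rmorphism {poly {poly L}} -> G}) (w : G).
Context (al be : {poly L}) (l m : nat).
Hypotheses (al0 : al != 0) (be0 : be != 0).
Hypotheses (al_cop : coprimep al ('X ^+ l)) (be_cop : coprimep be ('X ^+ m)).
Let h := cover al be l m.
Hypothesis w_sqr : w * w = psi h.
Hypothesis G_frac : forall x, exists f f' Q, psi Q \is a GRing.unit /\ x * psi Q = psi f + psi f' * w.
Hypothesis G_free : forall f f', psi f + psi f' * w = 0 -> f = 0 /\ f' = 0.

Lemma cover_pchar2 : 2%N \in [pchar G].
Proof.
by apply/andP; split=> //; rewrite -(rmorph_nat psi) char2 rmorph0.
Qed.

Lemma cover_inj f : psi f = 0 -> f = 0.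
Proof. by move=> f0; case: (@G_free f 0); rewrite // f0 rmorph0 mul0r addr0. Qed.

Lemma cover_sqr f f' : (psi f + psi f' * w) * (psi f + psi f' * w) = psi (f ^+ 2 + f' ^+ 2 * h).
Proof.
have addGG (x : G) : x + x = 0 by exact: (addrr_pchar2 cover_pchar2).
rewrite !expr2 rmorphD !rmorphM /= -w_sqr.
have -> : (psi f + psi f' * w) * (psi f + psi f' * w) = psi f * psi f +
    psi f' * psi f' * (w * w) + (psi f * psi f' * w + psi f * psi f' * w) by ring.
by rewrite addGG addr0.
Qed.

(** The square of a nonzero element is, up to a unit, f^2 + f'^2 h, which is nonzero
    because h is not a square. *)
Lemma cover_domain : GRing.integral_domain_axiom G.
Proof.
move=> x y xy0.
have nsq z : z != 0 -> exists f u, [/\ f != 0, u \is a GRing.unit & z * z * u = psi f].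
  move=> z0; have [f [f' [Q [uQ zQ]]]] := G_frac z.
  exists (f ^+ 2 + f' ^+ 2 * h), (psi Q * psi Q); split.
  - apply/eqP => /(cover_eq0 al0)[f0 f'0]; move: zQ; rewrite f0 f'0 rmorph0 mul0r addr0.
    by move=> zQ; move: z0; rewrite -(mulrK uQ z) zQ mul0r eqxx.
  - by rewrite unitrM uQ.
  - by rewrite mulrACA zQ cover_sqr.
apply: contraT; rewrite negb_or => /andP[/nsq[f [u [f0 uu fE]]] /nsq[f' [u' [f'0 uu' fE']]]].
have : psi (f * f') = 0.
  by rewrite rmorphM /= -fE -fE' mulrACA [x * x * _]mulrACA xy0 !mul0r.
by move=> /cover_inj/eqP; rewrite mulf_eq0 (negPf f0) (negPf f'0).
Qed.


End NormalCover.

Section IntegrallyClosed.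
Context (G : idomainType) (psi : {rmorphism {poly {poly L}} -> G}) (w : G).
Context (al be : {poly L}) (l m : nat).
Hypotheses (al0 : al != 0) (be0 : be != 0).
Hypotheses (al_cop : coprimep al ('X ^+ l)) (be_cop : coprimep be ('X ^+ m)).
Let h := cover al be l m.
Hypothesis w_sqr : w * w = psi h.
Hypothesis G_frac : forall x, exists f f' Q, psi Q \is a GRing.unit /\ x * psi Q = psi f + psi f' * w.
Hypothesis G_free : forall f f', psi f + psi f' * w = 0 -> f = 0 /\ f' = 0.

Let w_norm f f' : (psi f + psi f' * w) * (psi f + psi f' * w) = psi (f ^+ 2 + f' ^+ 2 * h).
Proof. exact: (cover_sqr w_sqr). Qed.

Let iota : {rmorphism G -> {fraction G}} := @tofrac G.

Let iota_inj x : iota x = 0 -> x = 0.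
Proof. by move=> /eqP; rewrite tofrac_eq0 => /eqP. Qed.

(* Squares of elements of G are fractions from L[a,b]: this turns the square of a
   monic equation of z over G into one of z ^ 2 over L[a,b]. *)
Let common_den n (c : nat -> G) : exists Q (d : nat -> {poly {poly L}}),
  psi Q \is a GRing.unit /\ forall i, (i < n)%N -> c i * c i * psi Q = psi (d i).
Proof.
elim: n => [|n [Q [d [uQ cd]]]]; first by exists 1, (fun=> 0); rewrite rmorph1 unitr1.
have [f [f' [Q' [uQ' cQ']]]] := G_frac (c n).
exists (Q * (Q' * Q')), (fun i => if i == n then Q * (f ^+ 2 + f' ^+ 2 * h) else d i * (Q' * Q')).
split; first by rewrite !rmorphM /= !unitrM uQ uQ'.
move=> i; rewrite ltnS leq_eqVlt; case: eqVneq => [-> _|_ /= ilt].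
  by rewrite !rmorphM /= mulrCA mulrACA cQ' w_norm.
by rewrite !rmorphM /= mulrA cd.
Qed.

Let psi_inj f : psi f = 0 -> f = 0.
Proof. exact: (cover_inj G_free). Qed.

Let i0 u : u != 0 -> iota (psi u) != 0.
Proof. by apply: contraNneq => /iota_inj/psi_inj ->. Qed.

Let fraction_cover (z : {fraction G}) : exists D f g,
  D != 0 /\ z * iota (psi D) = iota (psi f + psi g * w).
Proof.
have [x [y [y0 zy]]] := fraction_numden z.
have [f [g [Q [uQ yQ]]]] := G_frac y.
have [f' [g' [Q' [uQ' xQ']]]] := G_frac (x * (y * psi Q) * psi Q).
have n0 q : psi q \is a GRing.unit -> q != 0.
  by apply: contraTneq => ->; rewrite rmorph0 unitr0.
exists ((f ^+ 2 + g ^+ 2 * h) * Q'), f', g'; split.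
  apply: mulf_neq0; last exact: n0.
  apply/eqP => /(cover_eq0 al0)[f0 g0].
  move: yQ; rewrite f0 g0 rmorph0 mul0r addr0 => /eqP.
  by rewrite mulf_eq0 (negPf y0) /= => /eqP q0; move: uQ; rewrite q0 unitr0.
rewrite -xQ'.
have -> : psi ((f ^+ 2 + g ^+ 2 * h) * Q') = (y * psi Q) * (y * psi Q) * psi Q'.
  by rewrite yQ w_norm -rmorphM.
have alg (R : comNzRingType) (a b c d : R) : a * (b * c * (b * c) * d) = a * b * (b * c) * c * d.
  by ring.
by rewrite !rmorphM /= -[tofrac x]zy; exact: alg.
Qed.

(** For z = (f + g w) / D integral over G, z^2 = (f^2 + g^2 h) / D^2 satisfies the
    squared equation, so D^2 divides f^2 + g^2 h up to a unit Q; then D divides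
    Q g by the two derivatives, and finally Q f. *)
Lemma cover_integrally_closed : integrally_closed G.
Proof.
move=> z [p pmon pz].
have [D [f [g [D0 zD]]]] := fraction_cover z.
pose N := f ^+ 2 + g ^+ 2 * h.
pose n := (size p).-1.
have [Q [d [uQ pd]]] := common_den n (fun i => p`_i).
pose F : {rmorphism {poly {poly L}} -> {fraction G}} := iota \o psi; pose z2 := z ^+ 2.
have FM : {morph F : x y / x * y} by exact: rmorphM.
have FX i : {morph F : x / x ^+ i} by exact: rmorphXn.
have z2N : z2 * F (D ^+ 2) = F N.
  by rewrite FX -exprMn /F /= zD -rmorphXn expr2 w_norm.
have p2F : 2%N \in [pchar {fraction G}].
  by apply/andP; split=> //; rewrite -(rmorph_nat iota) (pcharf0 (cover_pchar2 psi)) rmorph0.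
have z2n : z2 ^+ n = \sum_(i < n) iota (p`_i * p`_i) * z2 ^+ i.
  have sp : size p = n.+1 by rewrite prednK // size_poly_gt0 monic_neq0.
  have pn : p`_n = 1 by move/eqP: pmon; rewrite lead_coefE -/n.
  have := rootP pz; rewrite horner_coef size_map_inj_poly ?rmorph0 //; last first.
    by move=> x y /eqP; rewrite tofrac_eq => /eqP.
  rewrite sp big_ord_recr /= coef_map /= pn rmorph1 mul1r => /eqP.
  rewrite addrC addr_eq0 oppr_pchar2 // => /eqP zn.
  rewrite /z2 -exprM mulnC exprM zn -(pFrobenius_autE p2F) rmorph_sum; apply: eq_bigr => i _.
  by rewrite /= pFrobenius_autE exprMn coef_map /= -expr2 rmorphXn /= -!exprM mulnC.
clearbody z2.
have {z2N} rel : integral_rel n (fun i => d i * Q ^+ (n - i).-1) (Q * N) (D ^+ 2).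
  move: (D ^+ 2) z2N => E z2N.
  have Finj : injective F.
    by move=> x y /eqP; rewrite tofrac_eq -subr_eq0 -rmorphB => /eqP/psi_inj/eqP; rewrite subr_eq0 => /eqP.
  apply: Finj; rewrite /integral_rel FX FM -z2N !exprMn z2n.
  rewrite rmorph_sum mulrCA mulr_suml.
  apply: eq_bigr => i _; rewrite !FM !FX FM -z2N !exprMn.
  have -> : F (d i) = iota (p`_i * p`_i) * F Q by rewrite /F /= -pd // rmorphM.
  have -> : F Q ^+ n = F Q ^+ i * (F Q * F Q ^+ (n - i).-1).
    by rewrite -exprS -exprD prednK ?subn_gt0 // subnKC // ltnW.
  have -> : F E ^+ n = F E ^+ i * F E ^+ (n - i).
    by rewrite -exprD subnKC // ltnW.
  move: (F Q ^+ i) (F Q) (F Q ^+ (n - i).-1) (F E ^+ i) (F E ^+ (n - i)) (z2 ^+ i).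
  move: (iota _) => *; ring.
have Q0 : Q != 0.
  by apply: contraTneq uQ => ->; rewrite rmorph0 unitr0.
have D20 : D ^+ 2 != 0 by rewrite expf_neq0.
have [R QN] := bivariate_dvd D20 rel.
have dv : dvdr (D ^+ 2) ((Q * f) ^+ 2 + (Q * g) ^+ 2 * h).
  exists (Q * R); rewrite mulrCA -QN /N.
  have alg (A : comNzRingType) (a b c t : A) :
    (a * b) ^+ 2 + (a * c) ^+ 2 * t = a * (a * (b ^+ 2 + c ^+ 2 * t)) by ring.
  exact: alg.
have [g' gE] := cover_coprime al0 be0 al_cop be_cop (cover_dvd1 D0 dv) (cover_dvd2 D0 dv).
have [f' fE] : dvdr D (Q * f).
  apply: bivariate_dvd_sqr => //; have [T e] := dv; exists (T - g' ^+ 2 * h).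
  by rewrite mulrBr -e gE [(D * g') ^+ 2]exprMn -mulrA addrK.
exists ((psi f' + psi g' * w) / psi Q).
apply: (mulIf (i0 (mulf_neq0 D0 Q0))).
rewrite rmorphM rmorphM mulrA zD -!rmorphM; congr (tofrac _).
have e1 : psi f * psi Q = psi D * psi f' by rewrite -!rmorphM -fE mulrC.
have e2 : psi g * psi Q = psi D * psi g' by rewrite -!rmorphM -gE mulrC.
rewrite [psi (D * Q)]rmorphM /= [psi D * psi Q]mulrC mulrA mulrVK //.
by rewrite mulrDl mulrAC e1 e2 mulrDl [psi g' * w * _]mulrAC [psi f' * _]mulrC [psi g' * _]mulrC.
Qed.
End IntegrallyClosed.

Lemma cover_normal (G : comUnitRingType) (psi : {rmorphism {poly {poly L}} -> G}) (w : G)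
    (al be : {poly L}) (l m : nat) :
  al != 0 -> be != 0 -> coprimep al ('X ^+ l) -> coprimep be ('X ^+ m) ->
  w * w = psi (cover al be l m) ->
  (forall x, exists f f' Q, psi Q \is a GRing.unit /\ x * psi Q = psi f + psi f' * w) ->
  (forall f f', psi f + psi f' * w = 0 -> f = 0 /\ f' = 0) ->
  normal_ring G.
Proof.
move=> al0 be0 cal cbe w2 Gf Gfree.
pose Gd := GRing.ComUnitRing_isIntegral.Build (GRing.ComUnitRing.sort G)
  (cover_domain al0 w2 Gf Gfree).
pose GD : idomainType := HB.pack (GRing.ComUnitRing.sort G) Gd.
exists GD, (idfun : {rmorphism G -> G}); split; first by exists id.
exact: (@cover_integrally_closed GD psi w al be l m al0 be0 cal cbe w2 Gf Gfree).
Qed.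

End Normal.

(** * Coordinates on the cuspidal curve *)

Section Coordinates.
Context (k : fieldType).
Implicit Types (p q P : {poly k}).

Lemma horner_alg_comp (E : comAlgType k) (U : E) p q :
  horner_alg U (p \Po q) = horner_alg (horner_alg U q) p.
Proof.
apply: (poly_morph_eq (f := horner_alg U \o comp_poly q)
  (g := horner_alg (horner_alg U q))) => [c|] /=.
  by rewrite comp_polyC !horner_algC.
by rewrite comp_polyX horner_algX.
Qed.

Lemma parity_free p q : p \Po 'X^2 + (q \Po 'X^2) * 'X = 0 -> p = 0 /\ q = 0.
Proof.
move=> e; have ce i : (p \Po 'X^2)`_i + (if i == 0%N then 0 else (q \Po 'X^2)`_i.-1) = 0.
  by rewrite -coefMX -coefD e coef0.
split; apply/polyP => i; rewrite coef0.
  have := ce i.*2; rewrite coef_comp_poly_Xn // dvdn2 odd_double /= divn2 doubleK.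
  case: i => [|i] /=; first by rewrite addr0.
  by rewrite coef_comp_poly_Xn // dvdn2 /= odd_double /= addr0.
have := ce i.*2.+1; rewrite /= !coef_comp_poly_Xn // !dvdn2 /= odd_double /= add0r.
by rewrite divn2 doubleK.
Qed.

(** P is the reversed polynomial. *)
Lemma horner_inv q : exists n P, (forall (E : comUnitAlgType k) (U : E), U \is a GRing.unit ->
  U ^+ n * horner_alg U^-1 q = horner_alg U P) /\ (P = 0 -> q = 0).
Proof.
suff [n [P [_ PE P0]]] : exists n P, [/\ (size P <= n.+1)%N,
    forall (E : comUnitAlgType k) (U : E), U \is a GRing.unit ->
      U ^+ n * horner_alg U^-1 q = horner_alg U P & P = 0 -> q = 0].
  by exists n, P.
elim/poly_ind: q => [|q c [n [P [sP PE P0]]]].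
  by exists 0%N, 0; split=> [|E U uU|//]; rewrite ?size_poly0 // !rmorph0 mulr0.
exists n.+1, (P + c%:P * 'X ^+ n.+1); split=> [|E U uU|].
- apply: leq_trans (size_polyD _ _) _; rewrite geq_max (leq_trans sP) //=.
  by apply: leq_trans (size_polyMleq _ _) _; rewrite size_polyXn addnS /= -[n.+2]add1n leq_add2r size_polyC; case: eqP.
- rewrite rmorphD rmorphM /= horner_algX horner_algC.
  rewrite [horner_alg U _]rmorphD /= -PE // rmorphM /= rmorphXn /= horner_algX horner_algC.
  by rewrite mulrDr exprS -mulrA mulrCA [U * (_ / U)]mulrC divrK // [_ * c%:A]mulrC.
- move=> e; have c0 : c = 0.
    have := congr1 (fun p : {poly k} => p`_n.+1) e.
    by rewrite coefD coefCM coefXn eqxx mulr1 coef0 nth_default // add0r.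
  by rewrite c0 addr0 P0 ?mul0r //; rewrite -e c0 mul0r addr0.
Qed.

(** Both charts of the cuspidal curve have a coordinate ring k[a] + k[a] x with
    x^2 = a^(2 l + 1), where l is [lev b]. For b = true, a = u^-2, x = u^-1 and
    l = 0; for b = false, the chart of the cusp, a = u^2, x = u^3 and l = 1. *)
Definition coord_a (b : bool) (E : comUnitAlgType k) (U : E) : E :=
  if b then U ^- 2 else U ^+ 2.
Definition coord_x (b : bool) (E : comUnitAlgType k) (U : E) : E :=
  if b then U^-1 else U ^+ 3.

Definition lev (b : bool) : nat := if b then 0%N else 1%N.

Lemma coord_rel b (E : comUnitAlgType k) (U : E) :
  coord_x b U ^+ 2 = coord_a b U ^+ (lev b).*2.+1.
Proof. by case: b => /=; rewrite ?expr1 -?exprM // exprVn. Qed.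

Lemma coord_free b p q : exists n P, (forall (E : comUnitAlgType k) (U : E), U \is a GRing.unit ->
    U ^+ n * (horner_alg (coord_a b U) p + horner_alg (coord_a b U) q * coord_x b U) =
    horner_alg U P) /\ (P = 0 -> p = 0 /\ q = 0).
Proof.
case: b => /=.
  have [n [P [PE P0]]] := horner_inv (p \Po 'X^2 + (q \Po 'X^2) * 'X).
  exists n, P; split=> [E U uU|/P0 /parity_free //].
  rewrite -PE // rmorphD rmorphM /= !horner_alg_comp horner_algX.
  by rewrite rmorphXn /= horner_algX exprVn.
exists 0%N, (p \Po 'X^2 + (q \Po 'X^2) * 'X^3); split=> [E U uU|e].
  by rewrite mul1r rmorphD rmorphM /= !horner_alg_comp !rmorphXn /= !horner_algX.
have := @parity_free p (q * 'X).
rewrite comp_polyM comp_polyX -mulrA -exprSr => /(_ e)[-> /eqP].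
by rewrite mulf_eq0 polyX_eq0 orbF => /eqP.
Qed.

(** Where a is invertible, u is recovered in either chart as x / a. *)
Lemma coord_inv b (E : comUnitAlgType k) (a x : E) : a \is a GRing.unit ->
  x ^+ 2 = a ^+ (lev b).*2.+1 ->
  [/\ x / a \is a GRing.unit, coord_a b (x / a) = a & coord_x b (x / a) = x].
Proof.
move=> ua xa; have ux : x \is a GRing.unit.
  by rewrite -(unitrX_pos _ (n := 2)) // xa unitrX.
split; first by rewrite unitrM ux unitrV.
- case: b xa => /= xa; last by rewrite expr_div_n xa [a ^+ 3]exprS mulrK // unitrX.
  by rewrite expr_div_n xa expr1 invrM ?unitrV ?unitrX // invrK expr2 mulrK.
- case: b xa => /= xa; first by rewrite invrM ?unitrV // invrK -[a]expr1 -[a ^+ 1]xa expr2 mulrK.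
  by rewrite expr_div_n exprS xa mulrK // unitrX.
Qed.

End Coordinates.

(** * Sections on the cuspidal curve *)

Section CuspCurve.
Context (k : fieldType) (C : cuspidal_curve k).
Let W := overlap C.
Let u := cusp_coord C.
Implicit Types (s t : forall x, stalk C x).

(** s is the Laurent polynomial u^-n P(u) on the overlap of the charts. *)
Definition laurent s n (P : {poly k}) : Prop :=
  forall x, W x -> u x ^+ n * s x = horner_alg (u x) P.

Definition is_laurent s : Prop := exists n P, laurent s n P.

Lemma uU x : W x -> u x \is a GRing.unit.
Proof. exact: coord_unit. Qed.

Lemma laurent_eq0 s n P : laurent s n P -> (forall x, W x -> s x = 0) <-> P = 0.
Proof.
move=> sP; split=> [s0|P0 x Wx].
  by apply: (@cusp_free _ C) => x Wx; rewrite -sP // s0 // mulr0.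
have ux : u x ^+ n \is a GRing.unit by rewrite unitrX // uU.
by apply: (mulrI ux); rewrite sP // P0 rmorph0 mulr0.
Qed.

Lemma laurent_mul s t n m P Q : laurent s n P -> laurent t m Q ->
  laurent (fun x => s x * t x) (n + m) (P * Q).
Proof. by move=> sP tQ x Wx; rewrite exprD mulrACA sP // tQ // rmorphM. Qed.

Lemma laurent_sub s t n m P Q : laurent s n P -> laurent t m Q ->
  laurent (fun x => s x - t x) (n + m) ('X ^+ m * P - 'X ^+ n * Q).
Proof.
move=> sP tQ x Wx; rewrite rmorphB !rmorphM !rmorphXn /= horner_algX.
rewrite -sP // -tQ // exprD mulrBr -!mulrA [u x ^+ n * (u x ^+ m * s x)]mulrCA.
by [].
Qed.

Lemma laurent_add s t n m P Q : laurent s n P -> laurent t m Q ->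
  laurent (fun x => s x + t x) (n + m) ('X ^+ m * P + 'X ^+ n * Q).
Proof.
move=> sP tQ x Wx; rewrite rmorphD !rmorphM !rmorphXn /= horner_algX.
rewrite -sP // -tQ // exprD mulrDr -!mulrA [u x ^+ n * (u x ^+ m * s x)]mulrCA.
by [].
Qed.

Lemma laurent_horner s n P (q : {poly k}) : laurent s n P -> is_laurent (fun x => horner_alg (s x) q).
Proof.
move=> sP; elim/poly_ind: q => [|q c [m [Q qQ]]].
  by exists 0%N, 0 => x Wx; rewrite !rmorph0 mulr0.
exists (m + n)%N, (Q * P + c%:P * 'X ^+ (m + n)) => x Wx.
rewrite !rmorphD !rmorphM /= !horner_algX !horner_algC rmorphXn /= horner_algX.
by rewrite -(qQ x Wx) -(sP x Wx) mulrDr exprD mulrACA [_ * c%:A]mulrC.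
Qed.

Lemma laurent_gen2 s s' t n P n' P' : laurent s n P -> laurent s' n' P' ->
  gen2 W s s' t -> is_laurent t.
Proof.
move=> sP sP' [q tq].
suff [m [Q qQ]] : is_laurent (fun x => (map_poly (horner_alg (s x)) q).[s' x]).
  by exists m, Q => x Wx; rewrite tq // qQ.
elim/poly_ind: q {tq} => [|q c [m [Q qQ]]].
  by exists 0%N, 0 => x Wx; rewrite !rmorph0 horner0 mulr0.
have [m' [Q' cQ]] := laurent_horner c sP.
have sum := laurent_add (laurent_mul qQ sP') cQ.
exists ((m + n') + m')%N, ('X ^+ m' * (Q * P') + 'X ^+ (m + n') * Q') => x Wx.
rewrite -sum // rmorphD rmorphM /= map_polyX map_polyC /=.
by rewrite hornerD hornerM hornerX hornerC.
Qed.

Lemma laurent_u i : laurent (fun x => u x ^+ i) 0 ('X ^+ i).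
Proof. by move=> x Wx; rewrite mul1r rmorphXn /= horner_algX. Qed.

Lemma laurent_uV : laurent (fun x => (u x)^-1) 1 1.
Proof. by move=> x Wx; rewrite expr1 mulrV ?uU // rmorph1. Qed.

Section FunctionField.
Context (V : set C) (A : comAlgType k) (phi : A -> forall x, stalk C x).
Hypotheses (HV : is_spec V phi) (WV : W `<=` V).
Hypothesis V_laurent : forall s, section C V s -> is_laurent s.
Hypothesis V_inj : forall s, section C V s -> (forall x, W x -> s x = 0) ->
  forall x, V x -> s x = 0.

Let oV : open V := spec_open HV.

Lemma phi_add a b x : V x -> phi (a + b) x = phi a x + phi b x.
Proof. by move=> /(spec_morphism HV)[g gE]; rewrite !gE rmorphD. Qed.
Lemma phi_mul a b x : V x -> phi (a * b) x = phi a x * phi b x.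
Proof. by move=> /(spec_morphism HV)[g gE]; rewrite !gE rmorphM. Qed.
Lemma phi_0 x : V x -> phi 0 x = 0.
Proof. by move=> /(spec_morphism HV)[g gE]; rewrite gE rmorph0. Qed.
Lemma phi_1 x : V x -> phi 1 x = 1.
Proof. by move=> /(spec_morphism HV)[g gE]; rewrite gE rmorph1. Qed.

(** The generic point: Laurent polynomials form a domain. *)
Lemma generic_prime : is_prime_ideal [set a | forall x, W x -> phi a x = 0].
Proof.
split=> /=.
- by move=> x /WV; exact: phi_0.
- by move=> a b a0 b0 x Wx; rewrite phi_add ?a0 ?b0 ?addr0 //; exact: WV.
- by move=> a b b0 x Wx; rewrite phi_mul ?b0 ?mulr0 //; exact: WV.
- move=> h; have : (1 : {poly k}) = 0.
    apply: (@cusp_free _ C) => x Wx; rewrite rmorph1 -(phi_1 (WV Wx)); exact: h.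
  by move/eqP; rewrite oner_eq0.
- move=> a b ab0; have [n [P aP]] := V_laurent (spec_section HV a).
  have [m [Q bQ]] := V_laurent (spec_section HV b).
  have abPQ := laurent_mul aP bQ.
  have /eqP : P * Q = 0.
    by apply/(laurent_eq0 abPQ) => x Wx; rewrite -phi_mul ?ab0 //; exact: WV.
  by rewrite mulf_eq0 => /orP[/eqP P0|/eqP Q0]; [left; exact/(laurent_eq0 aP)|right; exact/(laurent_eq0 bQ)].
Qed.

(** A section of an integral curve that vanishes near one point vanishes. The
    generic point eta lies in every nonempty basic open set, so a section vanishing
    at any point of V vanishes at eta; and near any x of V the section is a
    fraction a / b, whose numerator then vanishes at eta, hence everywhere. *)
Lemma chart_zero s y : section C V s -> V y -> s y = 0 -> forall x, V x -> s x = 0.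
Proof.
move=> sV Vy sy0; have [eta [[Veta etaE] _]] := spec_points HV generic_prime.
have phi_eta a : phi a eta = 0 -> forall x, V x -> phi a x = 0.
  move=> a0; apply: V_inj; first exact: spec_section.
  by apply/etaE; rewrite a0 unitr0.
have key t z : section C V t -> V z -> t z = 0 -> t eta = 0.
  move=> tV Vz tz0.
  have [O [oO Oz OV Ot]] := section_eq_near oV oV tV (section0 oV) Vz Vz tz0.
  have [c [uc cO]] := spec_basis HV oO Vz Oz.
  apply: (Ot eta); apply: cO => //; apply: contrapT => /negP /etaE c0.
  have := V_inj (spec_section HV c) c0 Vz => cz0.
  by move: uc; rewrite cz0 unitr0.
have seta := key s y sV Vy sy0.
move=> x Vx; have [a [b [ub sab]]] := spec_stalk_frac HV (s x) Vx.
have : s eta * phi b eta - phi a eta = 0.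
  apply: (key (fun z => s z * phi b z - phi a z) x) => //.
    by apply: section_sub => //; [apply: section_mul => //; exact: spec_section | exact: spec_section].
  by rewrite sab divrK // subrr.
rewrite seta mul0r sub0r => /eqP; rewrite oppr_eq0 => /eqP/phi_eta a0.
by rewrite sab a0 // mul0r.
Qed.

(** A germ of fraction a / b of s at y is a fraction for s on all of V. *)
Lemma chart_frac s y : section C V s -> V y -> exists a b, phi b y \is a GRing.unit /\
  forall x, V x -> phi b x * s x = phi a x.
Proof.
move=> sV Vy; have [a [b [ub sab]]] := spec_stalk_frac HV (s y) Vy.
exists a, b; split=> // x Vx; apply/eqP; rewrite -subr_eq0; apply/eqP.
apply: (chart_zero (s := fun z => phi b z * s z - phi a z) _ Vy) => //.
  by apply: section_sub => //; [apply: section_mul => //; exact: spec_section | exact: spec_section].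
by rewrite sab mulrC divrK // subrr.
Qed.

End FunctionField.
End CuspCurve.

(** * The charts as spectra *)

Section ChartRing.
Context (k : fieldType) (b : bool).

Definition chart_poly : {poly k} := 'X ^+ (lev b).*2.+1.

Definition chart_ring : comAlgType k :=
  alg_of (qconst chart_poly \o polyC : {rmorphism k -> quad chart_poly}).

Definition chart_val (E : comAlgType k) (a x : E) (n : chart_ring) : E :=
  horner_alg a n.1 + horner_alg a n.2 * x.

Lemma chart_val_morph (E : comAlgType k) (a x : E) : x ^+ 2 = a ^+ (lev b).*2.+1 ->
  exists g : {lrmorphism chart_ring -> E}, forall n, chart_val a x n = g n.
Proof.
move=> xa; have [f fE] : exists f : {rmorphism quad chart_poly -> E},
    forall p, f p = horner_alg a p.1 + horner_alg a p.2 * x.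
  by apply: quad_eval; rewrite -expr2 xa rmorphXn /= horner_algX.
have [g gE] : exists g : {lrmorphism chart_ring -> E}, forall p, g p = f p.
  by apply: alg_of_morph => c; rewrite fE /= rmorph0 mul0r addr0 horner_algC.
by exists g => n; rewrite gE fE.
Qed.

End ChartRing.

Lemma section_horner (k : fieldType) (X : lrs k) (U : set X) a (p : {poly k}) : open U ->
  section X U a -> section X U (fun x => horner_alg (a x) p).
Proof.
move=> oU aU; elim/poly_ind: p => [|p c IH].
  by apply: section_ext (section0 oU) _ => // x _; rewrite rmorph0.
apply: section_ext (section_add oU (section_mul oU IH aU) (section_scalar c oU)) _ => // x _.
by rewrite rmorphD rmorphM /= horner_algX horner_algC.
Qed.

Section Charts.
Context (k : fieldType) (C : cuspidal_curve k).
Let W := overlap C.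
Let u := cusp_coord C.
Implicit Types (s t : forall x, stalk C x).

Definition chart (b : bool) : set C := if b then chart1 C else chart0 C.

(** That the chart is the spectrum of [chart_ring], and that it meets the other
    chart where a is invertible, is derived in chart_exists below. *)
Record chart_coords (b : bool) (a x : forall c, stalk C c) : Prop := ChartCoords {
  chart_a : section C (chart b) a;
  chart_x : section C (chart b) x;
  chart_rel : forall c, chart b c -> x c ^+ 2 = a c ^+ (lev b).*2.+1;
  chart_a_u : forall c, W c -> a c = coord_a b (u c);
  chart_x_u : forall c, W c -> x c = coord_x b (u c);
  chart_spec : is_spec (chart b) (fun n c => chart_val (b := b) (a c) (x c) n);
  chart_unit : forall c, chart b c -> a c \is a GRing.unit -> W c
}.

Lemma chart_overlap b : W `<=` chart b.
Proof. by case: b => c []. Qed.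

Lemma overlap_laurent s : section C W s -> is_laurent s.
Proof.
have [_ WR _ _] := overlap_ring C => /WR.
exact: (laurent_gen2 (laurent_u (C := C) 1) (laurent_uV (C := C))).
Qed.

Lemma overlap_affine : affine W.
Proof. by have [] := overlap_ring C. Qed.

Lemma chart_facts b : [/\ affine (chart b),
  forall s, section C (chart b) s -> exists p q : {poly k}, forall c, W c ->
    s c = horner_alg (coord_a b (u c)) p + horner_alg (coord_a b (u c)) q * coord_x b (u c),
  exists a, section C (chart b) a /\ forall c, W c -> a c = coord_a b (u c),
  exists x, section C (chart b) x /\ forall c, W c -> x c = coord_x b (u c) &
  forall s, section C (chart b) s -> (forall x, W x -> s x = 0) -> forall x, chart b x -> s x = 0].
Proof.
case: b => /=.
  have [aff R ex inj] := chart1_ring C.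
  have [x [xV xE]] : exists x, section C (chart1 C) x /\ forall c, W c -> x c = (u c)^-1.
    by apply: ex; exists 'X => c Wc; rewrite horner_algX.
  split=> //.
  - move=> s /R[q qE]; exists (even_poly q), (odd_poly q) => c Wc.
    rewrite qE // -[in LHS](poly_even_odd q) rmorphD rmorphM /= !horner_alg_comp.
    by rewrite rmorphXn /= horner_algX exprVn.
  - exists (fun c => x c ^+ 2); split=> [|c Wc]; last by rewrite xE // exprVn.
    by apply: section_exp => //; case: aff => A [phi []].
  - by exists x.
have [aff R ex inj] := chart0_ring C.
split=> //.
- move=> s /R[q qE].
  suff [p [r pr]] : exists p r : {poly k}, forall c, W c ->
      (map_poly (horner_alg (u c ^+ 2)) q).[u c ^+ 3] =
      horner_alg (u c ^+ 2) p + horner_alg (u c ^+ 2) r * u c ^+ 3.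
    by exists p, r => c Wc; rewrite qE // pr.
  elim/poly_ind: q {qE} => [|q d [p [r pr]]].
    by exists 0, 0 => c Wc; rewrite !rmorph0 horner0 mul0r addr0.
  exists (r * 'X ^+ 3 + d), p => c Wc.
  rewrite rmorphD rmorphM /= map_polyX map_polyC /= hornerD hornerM hornerX hornerC pr //.
  rewrite rmorphD rmorphM /= rmorphXn /= horner_algX -exprM mulrDl -mulrA -exprD.
  by rewrite [RHS]addrC addrA.
- by apply: ex; exists ('X%:P) => c Wc; rewrite map_polyC /= horner_algX hornerC.
- by apply: ex; exists 'X => c Wc; rewrite map_polyX hornerX.
Qed.

Section Model.
Context (b : bool) (a x : forall c, stalk C c).
Let V := chart b.
Hypotheses (aV : section C V a) (xV : section C V x).
Hypothesis a_u : forall c, W c -> a c = coord_a b (u c).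
Hypothesis x_u : forall c, W c -> x c = coord_x b (u c).
Let ev (n : chart_ring k b) c := chart_val (a c) (x c) n.

Let V_inj : forall s, section C V s -> (forall x, W x -> s x = 0) -> forall x, V x -> s x = 0.
Proof. by have [] := chart_facts b. Qed.

Let oV : open V.
Proof. by have [[A [phi []]]] := chart_facts b. Qed.

Let ev_section n : section C V (ev n).
Proof.
apply: section_add => //; first exact: section_horner.
by apply: section_mul => //; exact: section_horner.
Qed.

Let ev_surj s : section C V s -> exists n, forall c, V c -> s c = ev n c.
Proof.
move=> sV; have [_ rep _ _ _] := chart_facts b.
have [p [q pq]] := rep s sV; exists ((p, q) : chart_ring k b) => c Vc.
apply/eqP; rewrite -subr_eq0; apply/eqP.
apply: (V_inj (s := fun c => s c - ev (p, q) c)) => //; first exact: section_sub.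
by move=> y Wy; rewrite pq // /ev /chart_val /= a_u // x_u // subrr.
Qed.

Lemma ev_laurent n : exists m P, laurent (ev n) m P /\
  (forall c, a c \is a GRing.unit -> x c ^+ 2 = a c ^+ (lev b).*2.+1 ->
     (x c / a c) ^+ m * ev n c = horner_alg (x c / a c) P) /\ (P = 0 -> n = 0).
Proof.
have [m [P [PE P0]]] := coord_free b n.1 n.2; exists m, P; split; [|split].
- by move=> c Wc; rewrite /ev /chart_val a_u // x_u // PE //; exact: coord_unit.
- move=> c ua xa; have [uU aE xE] := coord_inv ua xa.
  by rewrite -PE // aE xE.
- by move=> /P0[n1 n2]; apply: injective_projections.
Qed.

Let V_laurent s : section C V s -> is_laurent s.
Proof.
move=> sV; have [n nE] := ev_surj sV; have [m [P [mP _]]] := ev_laurent n.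
by exists m, P => c Wc; rewrite nE ?mP //; exact: chart_overlap.
Qed.

Let ev_inj n : (forall c, W c -> ev n c = 0) -> n = 0.
Proof.
move=> n0; have [m [P [mP [_ ]]]] := ev_laurent n; apply.
exact/(laurent_eq0 mP).
Qed.

Lemma model_rel c : V c -> x c ^+ 2 = a c ^+ (lev b).*2.+1.
Proof.
move=> Vc; apply/eqP; rewrite -subr_eq0; apply/eqP.
apply: (V_inj (s := fun c => x c ^+ 2 - a c ^+ (lev b).*2.+1)) => //.
  by apply: section_sub => //; exact: section_exp.
by move=> y Wy; rewrite a_u // x_u // coord_rel subrr.
Qed.

Let ev_morph c : V c -> exists g : {lrmorphism chart_ring k b -> stalk C c}, forall n, ev n c = g n.
Proof. by move=> /model_rel/chart_val_morph. Qed.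

Let evM n m c : V c -> ev (n * m) c = ev n c * ev m c.
Proof. by move=> /ev_morph[g gE]; rewrite !gE rmorphM. Qed.
Let evB n m c : V c -> ev (n - m) c = ev n c - ev m c.
Proof. by move=> /ev_morph[g gE]; rewrite !gE rmorphB. Qed.
Let evD n m c : V c -> ev (n + m) c = ev n c + ev m c.
Proof. by move=> /ev_morph[g gE]; rewrite !gE rmorphD. Qed.

Let ev_eq n m : (forall c, V c -> ev n c = ev m c) -> n = m.
Proof.
move=> e; apply/eqP; rewrite -subr_eq0; apply/eqP/ev_inj => c /(@chart_overlap b) Vc.
by rewrite evB // e // subrr.
Qed.

(** The affine chart is the spectrum of some algebra A, whose elements are sections
    and so have coordinates th in [chart_ring]. A prime ideal p of [chart_ring] is
    pulled back along th to find its point; conversely n in [chart_ring] is, on the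
    whole chart, a fraction of sections from A with denominator invertible at that
    point, which decides whether n is in p. *)
Lemma model_spec : is_spec V ev.
Proof.
have [[A [phi HV]] _ _ _ _] := chart_facts b; rewrite -/V in HV.
have [th thE] : exists th : A -> chart_ring k b, forall al c, V c -> phi al c = ev (th al) c.
  have h al := ev_surj (spec_section HV al).
  by exists (fun al => projT1 (cid (h al))) => al c Vc; case: cid => n /= ->.
have thM al be : th (al * be) = th al * th be.
  by apply: ev_eq => c Vc; rewrite evM // -!thE // (phi_mul HV).
have thD al be : th (al + be) = th al + th be.
  by apply: ev_eq => c Vc; rewrite evD // -!thE // (phi_add HV).
have th0 : th 0 = 0.
  by apply: ev_inj => c /(@chart_overlap b) Vc; rewrite -thE // (phi_0 HV).
have th1 : th 1 = 1.
  by apply: ev_eq => c Vc; rewrite -thE // (phi_1 HV) //; have [g ->] := ev_morph Vc; rewrite rmorph1.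
split=> //.
- move=> p [p0 pD pM p1 pP].
  have thp : is_prime_ideal [set al | p (th al)].
    split=> /=; rewrite ?th0 ?th1 //.
    + by move=> al be; rewrite thD; exact: pD.
    + by move=> al be; rewrite thM; exact: pM.
    + by move=> al be; rewrite thM; exact: pP.
  have [c [[Vc cE] cu]] := spec_points HV thp; exists c; split.
    split=> // n.
    have [al [be [ube nab]]] :=
      chart_frac HV (@chart_overlap b) V_laurent V_inj (ev_section n) Vc.
    have thab : th be * n = th al by apply: ev_eq => y Vy; rewrite evM // -!thE // nab.
    have nbe : ~ p (th be) by move=> /cE; rewrite ube.
    have : ev n c \is a GRing.unit <-> phi al c \is a GRing.unit.
      by rewrite -nab // unitrM ube.
    move=> nal; split=> [pn|/negP un].
      have : p (th al) by rewrite -thab; exact: pM.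
      by move=> /cE ual; apply/negP => /nal; exact/negP.
    have : p (th al) by apply/cE/negP => /nal.
    by rewrite -thab => /pP[/nbe|].
  move=> c' [Vc' cE']; apply: cu; split=> // al.
  by rewrite thE //; exact: cE'.
- move=> O c oO Vc Oc; have [al [ual alO]] := spec_basis HV oO Vc Oc.
  exists (th al); split=> [|y Vy uy]; first by rewrite -thE.
  by apply: alO => //; rewrite thE.
- move=> c g Vc; have [al [be [ube e]]] := spec_stalk_frac HV g Vc.
  by exists (th al), (th be); rewrite -!thE.
- move=> c n Vc n0; exists 1; split.
    by have [g ->] := ev_morph Vc; rewrite rmorph1 unitr1.
  rewrite mul1r; apply: ev_inj => y /(@chart_overlap b) Vy.
  exact: (chart_zero HV (@chart_overlap b) V_laurent V_inj (ev_section n) Vc n0).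
Qed.

(** With U = x / a at c, evaluating Laurent polynomials at u = U defines a prime
    ideal of the coordinate ring of the overlap, hence a point c' of the overlap.
    Elements of [chart_ring] are invertible at c' if and only if they are at c, so
    c = c'. *)
Lemma model_unit c : V c -> a c \is a GRing.unit -> W c.
Proof.
move=> Vc ua; have xa := model_rel Vc.
have [uU _ _] := coord_inv ua xa; set U := x c / a c in uU.
have [A [phi HW]] := overlap_affine.
have W_inj : forall s, section C W s -> (forall x, W x -> s x = 0) -> forall x, W x -> s x = 0 by [].
have WW : W `<=` W by [].
(* The representation of a section as u^-n P(u) is unique up to powers of u. *)
have wd s n P m Q : laurent s n P -> laurent s m Q ->
    (horner_alg U P \is a GRing.unit) = (horner_alg U Q \is a GRing.unit).
  move=> sP sQ.
  have e : 'X ^+ m * P = 'X ^+ n * Q.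
    apply/eqP; rewrite -subr_eq0; apply/eqP.
    by apply/(laurent_eq0 (laurent_sub sP sQ)) => y Wy; rewrite subrr.
  have := congr1 (fun p => horner_alg U p \is a GRing.unit) e.
  by rewrite !rmorphM !rmorphXn /= horner_algX !unitrM !unitrX.
have [P PE] : exists P : A -> {poly k}, forall om, exists n, laurent (phi om) n (P om).
  have h om : exists P n, laurent (phi om) n P.
    by have [n [P nP]] := overlap_laurent (spec_section HW om); exists P, n.
  by exists (fun om => projT1 (cid (h om))) => om; case: cid.
have Pwd om n Q : laurent (phi om) n Q ->
    (horner_alg U (P om) \is a GRing.unit) = (horner_alg U Q \is a GRing.unit).
  by move=> omQ; have [m omP] := PE om; exact: wd omP omQ.
have PM om om' : (horner_alg U (P (om * om')) \is a GRing.unit) =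
    (horner_alg U (P om) \is a GRing.unit) && (horner_alg U (P om') \is a GRing.unit).
  have [n nP] := PE om; have [n' nP'] := PE om'.
  rewrite (Pwd _ (n + n')%N (P om * P om')) ?rmorphM ?unitrM //.
  by move=> y Wy; rewrite (phi_mul HW) // (laurent_mul nP nP').
have pp : is_prime_ideal [set om | horner_alg U (P om) \isn't a GRing.unit].
  split=> /=.
  - rewrite (Pwd 0 0%N 0) ?rmorph0 ?unitr0 //.
    by move=> y Wy; rewrite (phi_0 HW) // mulr0 rmorph0.
  - move=> om om' /negP uo /negP uo'; apply/negP.
    have [n nP] := PE om; have [n' nP'] := PE om'.
    rewrite (Pwd _ (n + n')%N ('X ^+ n' * P om + 'X ^+ n * P om')); last first.
      by move=> y Wy; rewrite (phi_add HW) // (laurent_add nP nP').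
    rewrite rmorphD => /stalk_local[]; rewrite rmorphM unitrM => /andP[_ //].
  - by move=> om om' uo; rewrite PM negb_and uo orbT.
  - rewrite (Pwd 1 0%N 1) ?rmorph1 ?unitr1 //.
    by move=> y Wy; rewrite (phi_1 HW) // rmorph1 mul1r.
  - by move=> om om'; rewrite PM negb_and => /orP.
have [c' [[Wc' cE'] _]] := spec_points HW pp.
have cU om : phi om c' \is a GRing.unit = (horner_alg U (P om) \is a GRing.unit).
  apply/idP/idP => h; apply: contrapT => /negP.
    by move=> /cE'; rewrite h.
  by move=> /cE' /=; rewrite h.
suff -> : c = c' by [].
apply: (spec_pt_unique model_spec) => //; first exact: chart_overlap.
move=> n; have [m [Q [nQ [cQ _]]]] := ev_laurent n.
have nW : section C W (ev n).
  exact: section_restr oV (spec_open HW) (ev_section n) (@chart_overlap b).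
have [al [be [ube nab]]] := chart_frac HW WW overlap_laurent W_inj nW Wc'.
have [i bP] := PE be.
have ual : phi al c' \is a GRing.unit = (horner_alg U Q \is a GRing.unit).
  rewrite cU (Pwd _ (i + m)%N (P be * Q)) ?rmorphM ?unitrM ?(esym (cU _)) ?ube //.
  by move=> y Wy; rewrite -nab // (laurent_mul bP nQ).
have -> : ev n c' \is a GRing.unit = (phi al c' \is a GRing.unit).
  by rewrite -nab // unitrM ube.
have -> : ev n c \is a GRing.unit = (horner_alg U Q \is a GRing.unit).
  by rewrite -cQ // unitrM unitrX.
by rewrite ual.
Qed.

End Model.

Lemma chart_exists b : exists a x, chart_coords b a x.
Proof.
have [_ _ [a [aV au]] [x [xV xu]] _] := chart_facts b.
exists a, x; split=> //.
- exact: (model_rel aV xV au xu).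
- exact: (model_spec aV xV au xu).
- exact: (model_unit aV xV au xu).
Qed.

End Charts.

Arguments chart {k} C b.

(** * The coordinate ring of a product of two charts and a base *)

Lemma rmorph_comb (A E : nzRingType) (f : {rmorphism A -> E}) c0 c1 c2 c3 x y :
  f (c0 + c1 * x + c2 * y + c3 * (x * y)) =
  f c0 + f c1 * f x + f c2 * f y + f c3 * (f x * f y).
Proof. by rewrite !rmorphD !rmorphM. Qed.

(** The tensor product over k of two chart rings and R, as a free module over
    R[a,b] with basis 1, x, y, xy. The inner variable of {poly {poly R}} is a, the
    outer one is b. *)
Section ProductRing.
Context (k : fieldType) (R : comAlgType k) (b1 b2 : bool).

Definition rel1 : {poly {poly R}} := 'X%:P ^+ (lev b1).*2.+1.
Definition rel2 : quad rel1 := qconst rel1 ('X ^+ (lev b2).*2.+1).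

Definition prod_const : {rmorphism {poly {poly R}} -> quad rel2} := qconst rel2 \o qconst rel1.

Definition prod_ring : comAlgType k :=
  alg_of (prod_const \o polyC \o polyC \o in_alg R : {rmorphism k -> quad rel2}).

Definition pconst (f : {poly {poly R}}) : prod_ring := prod_const f.
Fact pconst_additive : {morph pconst : f g / f - g}.
Proof. exact: (rmorphB prod_const). Qed.
Fact pconst_mul : monoid_morphism pconst.
Proof. by split; [exact: (rmorph1 prod_const) | exact: (rmorphM prod_const)]. Qed.
HB.instance Definition _ := GRing.isZmodMorphism.Build {poly {poly R}} prod_ring pconst pconst_additive.
HB.instance Definition _ := GRing.isMonoidMorphism.Build {poly {poly R}} prod_ring pconst pconst_mul.

Definition gen_a : prod_ring := pconst 'X%:P.
Definition gen_b : prod_ring := pconst 'X.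
Definition gen_x : prod_ring := qconst rel2 (qgen rel1).
Definition gen_y : prod_ring := qgen rel2.

Lemma gen_x_sqr : gen_x ^+ 2 = gen_a ^+ (lev b1).*2.+1.
Proof.
rewrite expr2 [LHS](_ : _ = qconst rel2 (qgen rel1 * qgen rel1)); last by rewrite rmorphM.
by rewrite qgen_sqr /gen_a -rmorphXn.
Qed.

Lemma gen_y_sqr : gen_y ^+ 2 = gen_b ^+ (lev b2).*2.+1.
Proof. by rewrite expr2 [LHS]qgen_sqr /gen_b -rmorphXn. Qed.

Lemma pconst_gen_x f : pconst f * gen_x = qconst rel2 (0, f).
Proof.
rewrite /pconst /gen_x /= -[LHS]/(qconst rel2 (qconst rel1 f) * qconst rel2 (qgen rel1)).
rewrite -rmorphM /=; congr qconst; rewrite [RHS]quadE /=.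
by rewrite [qconst rel1 0]rmorph0 add0r.
Qed.

Lemma pconst_coords f0 f1 f2 f3 :
  pconst f0 + pconst f1 * gen_x + pconst f2 * gen_y + pconst f3 * (gen_x * gen_y) =
  ((f0, f1), (f2, f3)).
Proof.
have gen_yE (p : quad rel1) : qconst rel2 p * qgen rel2 = (0, p).
  by rewrite [RHS]quadE /= [qconst rel2 0]rmorph0 add0r.
have -> : pconst f3 * (gen_x * gen_y) = (0, (0, f3)).
  by rewrite mulrA pconst_gen_x -gen_yE.
have -> : pconst f2 * gen_y = (0, (f2, 0)) by exact: gen_yE.
rewrite pconst_gen_x; apply: injective_projections; apply: injective_projections => /=.
- by rewrite !addr0.
- by rewrite add0r !addr0.
- by rewrite !add0r addr0.
- by rewrite !add0r.
Qed.

Lemma prod_ringE (m : prod_ring) : exists f0 f1 f2 f3,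
  m = pconst f0 + pconst f1 * gen_x + pconst f2 * gen_y + pconst f3 * (gen_x * gen_y).
Proof. by case: m => -[f0 f1] [f2 f3]; exists f0, f1, f2, f3; rewrite pconst_coords. Qed.

Lemma prod_ring_free f0 f1 f2 f3 :
  pconst f0 + pconst f1 * gen_x + pconst f2 * gen_y + pconst f3 * (gen_x * gen_y) = 0 ->
  [/\ f0 = 0, f1 = 0, f2 = 0 & f3 = 0].
Proof. by rewrite pconst_coords => -[]. Qed.

Lemma prod_eval (E : comAlgType k) (rho : {lrmorphism R -> E}) (a x b y : E) :
  x ^+ 2 = a ^+ (lev b1).*2.+1 -> y ^+ 2 = b ^+ (lev b2).*2.+1 ->
  exists mu : {lrmorphism prod_ring -> E},
    (forall r, mu (pconst r%:P%:P) = rho r) /\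
    [/\ mu gen_a = a, mu gen_b = b, mu gen_x = x & mu gen_y = y].
Proof.
move=> xa yb.
have [g1 [g1C g1X]] := poly_eval rho a.
have [g2 [g2C g2X]] := poly_eval g1 b.
have [g3 g3E] : exists g : {rmorphism quad rel1 -> E}, forall p, g p = g2 p.1 + g2 p.2 * x.
  by apply: quad_eval; rewrite -expr2 xa rmorphXn /= g2C g1X.
have [g4 g4E] : exists g : {rmorphism quad rel2 -> E}, forall p, g p = g3 p.1 + g3 p.2 * y.
  by apply: quad_eval; rewrite -expr2 yb g3E rmorphXn /= rmorph0 mul0r addr0 g2X.
have cE f : g4 (pconst f) = g2 f.
  by rewrite g4E /= rmorph0 mul0r addr0 g3E /= rmorph0 mul0r addr0.
have [mu muE] : exists mu : {lrmorphism prod_ring -> E}, forall m, mu m = g4 m.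
  apply: alg_of_morph => c; rewrite [LHS]cE /= g2C g1C.
  exact: rmorph_alg.
exists mu; split=> [r|]; first by rewrite muE cE g2C g1C.
split; rewrite muE.
- by rewrite cE g2C.
- by rewrite cE g2X.
- by rewrite g4E /= rmorph0 mul0r addr0 g3E /= rmorph0 rmorph1 mul1r add0r.
- by rewrite g4E /= rmorph0 rmorph1 mul1r add0r.
Qed.

Lemma prod_morph_eq (E : comAlgType k) (f g : {lrmorphism prod_ring -> E}) :
  (forall r, f (pconst r%:P%:P) = g (pconst r%:P%:P)) ->
  f gen_a = g gen_a -> f gen_b = g gen_b -> f gen_x = g gen_x -> f gen_y = g gen_y ->
  f =1 g.
Proof.
move=> eR ea eb ex ey m.
have pB : {morph pconst : p q / p + q} by exact: rmorphD.
have pM : {morph pconst : p q / p * q} by exact: rmorphM.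
have p0 : pconst 0 = 0 by exact: rmorph0.
have fB : {morph f : p q / p + q} by exact: rmorphD.
have fM : {morph f : p q / p * q} by exact: rmorphM.
have gB : {morph g : p q / p + q} by exact: rmorphD.
have gM : {morph g : p q / p * q} by exact: rmorphM.
have cE1 (p : {poly R}) : f (pconst p%:P) = g (pconst p%:P).
  elim/poly_ind: p => [|p c IH]; first by rewrite p0 !rmorph0.
  by rewrite polyCD polyCM pB pM fB fM gB gM IH eR -/gen_a ea.
have cE p : f (pconst p) = g (pconst p).
  elim/poly_ind: p => [|p c IH]; first by rewrite p0 !rmorph0.
  by rewrite pB pM fB fM gB gM IH cE1 -/gen_b eb.
have [f0 [f1 [f2 [f3 ->]]]] := prod_ringE m.
apply: etrans (rmorph_comb f _ _ _ _ _ _) _; apply: etrans _ (esym (rmorph_comb g _ _ _ _ _ _)).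
by rewrite /= ex ey !cE.
Qed.

Lemma prod_base : exists c : {lrmorphism R -> prod_ring}, forall r, c r = pconst r%:P%:P.
Proof.
apply: (@lrmorph_exists k R prod_ring (fun r => pconst r%:P%:P)).
- by move=> r r'; rewrite !polyCB; exact: pconst_additive.
- exact: pconst_mul.1.
- by move=> r r'; rewrite !polyCM; exact: pconst_mul.2.
- by move=> c r /=; rewrite -mulr_algl !polyCM; exact: pconst_mul.2.
Qed.

End ProductRing.

(** * Stalks of the product *)

Lemma horner_alg_morph (k : fieldType) (E E' : comAlgType k) (f : {lrmorphism E -> E'}) a p :
  f (horner_alg a p) = horner_alg (f a) p.
Proof.
apply: (poly_morph_eq (f := f \o horner_alg a) (g := horner_alg (f a))) => [c|] /=.
  by rewrite !horner_algC rmorph_alg.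
by rewrite !horner_algX.
Qed.

Lemma chart_val_map (k : fieldType) (b : bool) (E E' : comAlgType k)
    (f : {lrmorphism E -> E'}) a x (n : chart_ring k b) :
  f (chart_val a x n) = chart_val (f a) (f x) n.
Proof. by rewrite /chart_val rmorphD rmorphM /= !horner_alg_morph. Qed.

Section ToChart.
Context (k : fieldType) (C : cuspidal_curve k) (b : bool) (a x : forall c, stalk C c).
Hypothesis ch : chart_coords b a x.

Let open_chart : open (chart C b) := spec_open (chart_spec ch).

Lemma to_chart_unique (T : scheme k) (m m' : lrs_morphism T C) :
  (forall t, chart C b (m t)) -> (forall t, chart C b (m' t)) ->
  pullback_section m a = pullback_section m' a ->
  pullback_section m x = pullback_section m' x -> m = m'.
Proof.
move=> mU mU' ea ex; apply: (to_spec_unique (chart_spec ch)) => // n.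
apply: functional_extensionality_dep => t; rewrite /pullback_section !chart_val_map.
congr (chart_val _ _ n).
  exact: (congr1 (fun h => h t) ea).
exact: (congr1 (fun h => h t) ex).
Qed.

Lemma to_chart_exists (B : comAlgType k) (a' x' : B) : x' ^+ 2 = a' ^+ (lev b).*2.+1 ->
  exists m : lrs_morphism (Spec B) C, [/\ forall t, chart C b (m t),
    pullback_section m a = @germ k B a' & pullback_section m x = @germ k B x'].
Proof.
move=> /chart_val_morph[f fE].
have [m [mU mE]] : exists m : lrs_morphism (Spec B) C, (forall t, chart C b (m t)) /\
    forall n, pullback_section m (fun c => chart_val (a c) (x c) n) = @germ k B (f n).
  apply: (to_spec (chart_spec ch)) => [n|t].
    exact: (spec_section (spec_is_spec B)).
  by exists (tofr (loc_data t) \o f).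
have valX (E : comAlgType k) (d z : E) : chart_val (b := b) d z ('X, 0) = d.
  by rewrite /chart_val /= rmorph0 mul0r addr0 horner_algX.
have val1 (E : comAlgType k) (d z : E) : chart_val (b := b) d z (0, 1) = z.
  by rewrite /chart_val /= rmorph0 rmorph1 mul1r add0r.
exists m; split=> //; apply: functional_extensionality_dep => t.
- have /(congr1 (fun h => h t)) := mE ('X, 0).
  by rewrite -fE valX /pullback_section valX.
- have /(congr1 (fun h => h t)) := mE (0, 1).
  by rewrite -fE val1 /pullback_section val1.
Qed.

Lemma from_stalk_chart (X : scheme k) (p : lrs_morphism X C) (y : X) (B : comAlgType k)
    (f : {lrmorphism stalk X y -> B}) m : from_stalk f m -> chart C b (p y) ->
  [/\ forall t, chart C b (compose p m t),
      pullback_section (compose p m) a = @germ k B (f (pullback_section p a y)) &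
      pullback_section (compose p m) x = @germ k B (f (pullback_section p x y))].
Proof.
move=> fm Vy; have [mU ma] := from_stalk_pull fm open_chart Vy (chart_a ch).
by have [_ mx] := from_stalk_pull fm open_chart Vy (chart_x ch).
Qed.

End ToChart.

(** Replaces on_stalks h t, a map from the stalk at h t, by a map from the stalk at a
    point that is only provably equal to h t. *)
Lemma pullback_at (k : fieldType) (T X : lrs k) (h : lrs_morphism T X) t y :
  h t = y -> exists K : {lrmorphism stalk X y -> stalk T t},
    forall s, pullback_section h s t = K (s y).
Proof. by move=> <-; exists (on_stalks h t). Qed.

Section ProductStalk.
Context (k : fieldType) (C : cuspidal_curve k) (Y S YS : scheme k).
Context (p1 p2 : lrs_morphism Y C) (prY : lrs_morphism YS Y) (prS : lrs_morphism YS S).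
Hypotheses (Y_prod : is_product p1 p2) (YS_prod : is_product prY prS).
Context (y : YS) (b1 b2 : bool) (a1 x1 a2 x2 : forall c, stalk C c).
Hypotheses (ch1 : chart_coords b1 a1 x1) (ch2 : chart_coords b2 a2 x2).
Hypotheses (Vy1 : chart C b1 (p1 (prY y))) (Vy2 : chart C b2 (p2 (prY y))).

Let R : comAlgType k := stalk S (prS y).
Let M := prod_ring R b1 b2.
Let E := stalk YS y.
Let a : E := pullback_section (compose p1 prY) a1 y.
Let x : E := pullback_section (compose p1 prY) x1 y.
Let b : E := pullback_section (compose p2 prY) a2 y.
Let z : E := pullback_section (compose p2 prY) x2 y.

Lemma pull_rel b' a' x' (q : lrs_morphism YS C) : chart_coords b' a' x' -> chart C b' (q y) ->
  pullback_section q x' y ^+ 2 = pullback_section q a' y ^+ (lev b').*2.+1.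
Proof. by move=> ch V; rewrite /pullback_section -!rmorphXn (chart_rel ch). Qed.

(** The spectrum of M maps to C x C x S by the universal properties of the products;
    stalk_recognition then shows that O_y is a localization of M. The base enters
    through its stalk R at the image of y only, because the spectrum of R maps to
    S. *)
Theorem product_stalk : exists mu : {lrmorphism M -> E},
  [/\ forall r, mu (pconst b1 b2 r%:P%:P) = on_stalks prS y r,
      [/\ mu (gen_a _ _ _) = a, mu (gen_b _ _ _) = b, mu (gen_x _ _ _) = x & mu (gen_y _ _ _) = z],
      forall e, exists m m', mu m' \is a GRing.unit /\ e * mu m' = mu m &
      forall m, mu m = 0 -> exists n, mu n \is a GRing.unit /\ n * m = 0].
Proof.
have [mu [muR [mua mub mux muy]]] := prod_eval (on_stalks prS y)
  (pull_rel (q := compose p1 prY) ch1 Vy1) (pull_rel (q := compose p2 prY) ch2 Vy2).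
exists mu.
have [f1 [f1U f1a f1x]] := to_chart_exists ch1 (gen_x_sqr R b1 b2).
have [f2 [f2U f2a f2x]] := to_chart_exists ch2 (gen_y_sqr R b1 b2).
have [cR cRE] := prod_base R b1 b2.
have [fS fSE] := from_stalk_exists cR.
have [h12 [[h12_1 h12_2] _]] := Y_prod f1 f2.
have [h [[hY hS] _]] := YS_prod h12 fS.
have [i iE] := from_stalk_exists (idfun : {lrmorphism E -> E}).
have [g gE] := Spec_map mu.
have pullg (X : lrs k) (m : lrs_morphism (Spec M) X) s e : pullback_section m s = @germ k M e ->
    pullback_section (compose m g) s = @germ k E (mu e).
  by move=> me; rewrite -gE -me.
have hg : compose h g = i.
  have [h' [_ h'u]] := YS_prod (compose prY i) (compose prS i).
  rewrite -(h'u i) // -(h'u (compose h g)) // !compose_assoc hY hS; split.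
    have [h'' [_ h''u]] := Y_prod (compose p1 (compose prY i)) (compose p2 (compose prY i)).
    rewrite -(h''u (compose prY i)) // -(h''u (compose h12 g)) // !compose_assoc h12_1 h12_2.
    have [iU1 ia1 ix1] := from_stalk_chart ch1 (p := compose p1 prY) iE Vy1.
    have [iU2 ia2 ix2] := from_stalk_chart ch2 (p := compose p2 prY) iE Vy2.
    split.
      apply: (to_chart_unique ch1) => //.
      + by move=> t; exact: f1U.
      + by rewrite (pullg _ _ _ _ f1a) mua -ia1.
      + by rewrite (pullg _ _ _ _ f1x) mux -ix1.
    apply: (to_chart_unique ch2) => //.
    + by move=> t; exact: f2U.
    + by rewrite (pullg _ _ _ _ f2a) mub -ia2.
    + by rewrite (pullg _ _ _ _ f2x) muy -ix2.
  apply: (@from_stalk_unique _ _ _ _ _ (prS y)) => O s oO Ox sO.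
  have [iU is_] := from_stalk_pull iE oO Ox sO.
  have [fSU fSs] := fSE O s oO Ox sO.
  split=> // [t|]; first exact: fSU.
  by rewrite is_ (pullg _ _ _ _ fSs) cRE muR.
have hs m : exists s, s y = mu m /\ forall t, h t = y -> pullback_section h s t = germ m t.
  have [O [s [_ _ _ sE]]] := germ_section (mu m); exists s; split=> // t hty.
  have [K KE] := pullback_at hty; rewrite KE sE.
  apply: (prod_morph_eq (f := K \o mu) (g := tofr (loc_data t))) => [r||||] /=.
  - have [O' [s' [oO' Ox' sO' <-]]] := germ_section r.
    rewrite muR -[on_stalks prS y _]/(pullback_section prS s' y) -KE.
    have [_ /(congr1 (fun h => h t))] := fSE O' s' oO' Ox' sO'.
    by rewrite -hS cRE.
  - by rewrite mua -KE -[LHS]/(pullback_section (compose p1 (compose prY h)) a1 t) hY h12_1 f1a.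
  - by rewrite mub -KE -[LHS]/(pullback_section (compose p2 (compose prY h)) a2 t) hY h12_2 f2a.
  - by rewrite mux -KE -[LHS]/(pullback_section (compose p1 (compose prY h)) x1 t) hY h12_1 f1x.
  - by rewrite muy -KE -[LHS]/(pullback_section (compose p2 (compose prY h)) x2 t) hY h12_2 f2x.
have [surj ker] := stalk_recognition iE gE hg hs.
by split.
Qed.

End ProductStalk.

(** * Sections vanishing where a function is invertible *)

Record is_ideal (A : comNzRingType) (I : set A) : Prop := IsIdeal {
  ideal0 : I 0;
  idealD : forall a b, I a -> I b -> I (a + b);
  idealM : forall a b, I b -> I (a * b)
}.

(** An ideal that is maximal among those containing I and no power of f is prime. *)
Lemma prime_avoiding (A : comNzRingType) (I : set A) (f : A) : is_ideal I ->
  (forall n, ~ I (f ^+ n)) -> exists p, [/\ is_prime_ideal p, I `<=` p & ~ p f].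
Proof.
move=> II If.
pose good J := [/\ is_ideal J, I `<=` J & forall n, ~ J (f ^+ n)].
(* The empty set is included because the empty chain needs an upper bound. *)
pose P (J : set A) := J = set0 \/ good J.
have [F FP chain|J [PJ Jmax]] := @Zorn_bigcup _ P.
  have [[J0 FJ0 gJ0]|none] := pselect (exists2 J, F J & good J); last first.
    left; apply/seteqP; split=> // a [J FJ Ja].
    by have [J0|gJ] := FP J FJ; [rewrite -J0 | case: none; exists J].
  have good_of J a : F J -> J a -> good J.
    by move=> /FP[->//|].
  right; split.
  - split; first by exists J0 => //; case: gJ0 => [[]].
      move=> a b [J FJ Ja] [J' FJ' J'b].
      have [[iJ _ _] [iJ' _ _]] := (good_of J a FJ Ja, good_of J' b FJ' J'b).
      have [JJ'|J'J] := chain _ _ FJ FJ'.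
        by exists J' => //; apply: (idealD iJ') => //; exact: JJ'.
      by exists J => //; apply: (idealD iJ) => //; exact: J'J.
    move=> a b [J FJ Jb]; have [iJ _ _] := good_of J b FJ Jb.
    by exists J => //; exact: (idealM iJ).
  - by move=> a Ia; exists J0 => //; case: gJ0 => _ + _; apply.
  - by move=> n [J FJ Jf]; have [_ _ /(_ n)] := good_of J _ FJ Jf; exact.
have gI : good I by split.
have [iJ IJ Jf] : good J.
  case: PJ => // J0; case: (Jmax I); last by right.
  by rewrite J0; split=> // h; exact: (h 0 (ideal0 II)).
have ext a : ~ J a -> exists n j r, J j /\ f ^+ n = j + r * a.
  move=> Ja; apply: contrapT => none.
  pose Ja' : set A := [set c | exists j r, J j /\ c = j + r * a].
  have JJa : J `<=` Ja' by move=> c Jc; exists c, 0; rewrite mul0r addr0.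
  apply: (Jmax Ja').
    split=> // h; apply: Ja; apply: h; exists 0, 1; rewrite mul1r add0r; split=> //.
    exact: ideal0.
  right; split.
  - split.
    + exact: JJa (ideal0 iJ).
    + move=> _ _ [j [r [Jj ->]]] [j' [r' [Jj' ->]]]; exists (j + j'), (r + r').
      by split; [exact: (idealD iJ) | rewrite mulrDl addrACA].
    + move=> c _ [j [r [Jj ->]]]; exists (c * j), (c * r).
      by split; [exact: (idealM iJ) | rewrite mulrDr mulrA].
  - by apply: subset_trans JJa.
  - by move=> n [j [r h]]; apply: none; exists n, j, r.
exists J; split=> //; last by have := Jf 1%N; rewrite expr1.
split; [exact: ideal0 | exact: (idealD iJ) | exact: (idealM iJ) | by have := Jf 0%N |].
move=> a b Jab; apply: contrapT => /not_orP[/ext[n [j [r [Jj fn]]]] /ext[m [j' [r' [Jj' fm]]]]].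
apply: (Jf (n + m)%N); rewrite exprD fn fm.
have -> : (j + r * a) * (j' + r' * b) = (j' + r' * b) * j + (r * a * j' + r * r' * (a * b)).
  by ring.
by apply: (idealD iJ); [|apply: (idealD iJ)]; exact: (idealM iJ).
Qed.

(** The open set where f is invertible is dense up to f-torsion. On a basic open set
    D(c) around x, t and f are fractions ta / tc and fa / fc. If no power of
    c fc fa killed ta near x, some prime ideal would contain the annihilator of ta
    but not c fc fa, giving a point where f is invertible and t is not zero. *)
Lemma vanish_unit_locus (k : fieldType) (X : scheme k) (O : set X) t f x : open O -> O x ->
  section X O t -> section X O f ->
  (forall z, O z -> f z \is a GRing.unit -> t z = 0) -> exists n, f x ^+ n * t x = 0.
Proof.
move=> oO Ox tO fO t0.
have [U [[A [phi HU]] Ux]] := locally_affine x.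
have oU := spec_open HU; have sU := spec_section HU.
have phiE z : U z -> exists g : {lrmorphism A -> stalk X z}, forall a, phi a z = g a.
  exact: spec_morphism.
have loc s : section X O s -> exists a c, phi c x \is a GRing.unit /\ exists V,
    [/\ open V, V x, V `<=` O `&` U & forall z, V z -> s z * phi c z = phi a z].
  move=> sO; have [a [c [uc sE]]] := spec_stalk_frac HU (s x) Ux; exists a, c; split=> //.
  have oOU : open (O `&` U) by exact: openI.
  have sOU : section X (O `&` U) (fun z => s z * phi c z).
    apply: section_mul => //; first exact: section_restr oO _ sO (@subIsetl _ _ _).
    exact: section_restr oU _ (sU c) (@subIsetr _ _ _).
  have [|V [oV Vx VOU VE]] := section_eq_near oOU oU sOU (sU a) (conj Ox Ux) Ux.
    by rewrite sE divrK.
  by exists V; split=> // z /VOU[].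
have [ta [tc [utc [V1 [oV1 V1x V1O tE]]]]] := loc t tO.
have [fa [fc [ufc [V2 [oV2 V2x V2O fE]]]]] := loc f fO.
have [c [uc cV]] := spec_basis HU (openI oV1 oV2) Ux (conj V1x V2x).
have [n [e [ue en]]] : exists n, exists e, phi e x \is a GRing.unit /\ e * ((c * fc * fa) ^+ n * ta) = 0.
  pose I : set A := [set d | d * ta = 0].
  have II : is_ideal I.
    split; first exact: mul0r.
      by move=> d d'; rewrite /I /= => e e'; rewrite mulrDl e e' addr0.
    by move=> d d'; rewrite /I /= => e'; rewrite -mulrA e' mulr0.
  apply: contrapT => none.
  have [m|p [pp Ip pf]] := prime_avoiding (f := c * fc * fa) II.
    move=> /= h; apply: none; exists m, 1; rewrite h mulr0; split=> //.
    by have [g ->] := phiE x Ux; rewrite rmorph1 unitr1.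
  have [z [[Uz zp] _]] := spec_points HU pp.
  have : phi (c * fc * fa) z \is a GRing.unit by apply: contrapT => /negP /zp.
  have [g gE] := phiE z Uz; rewrite gE !rmorphM !unitrM => /andP[/andP[cz fcz] faz].
  have [V1z V2z] : (V1 `&` V2) z by apply: cV => //; rewrite gE.
  have Oz : O z by have [] := V1O z V1z.
  have fz : f z \is a GRing.unit.
    have : f z * phi fc z \is a GRing.unit by rewrite fE // gE.
    by rewrite unitrM => /andP[].
  have taz : phi ta z = 0 by rewrite -tE // t0 // mul0r.
  have [d [ud dta]] := spec_stalk_ker HU Uz taz.
  by have /zp := Ip d dta; rewrite ud.
exists n; have [g gE] := phiE x Ux.
have fax : g fa = f x * phi fc x by rewrite fE // gE.
have tax : g ta = t x * phi tc x by rewrite tE // gE.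
have := congr1 g en; rewrite !rmorphM rmorphXn !rmorphM rmorph0 /= fax tax => e0.
have ue' : g e \is a GRing.unit by rewrite -gE.
have W1 : (g c * g fc * phi fc x) ^+ n \is a GRing.unit.
  by rewrite unitrX // !unitrM -!gE uc ufc.
apply: (mulIr utc); apply: (mulrI W1); apply: (mulrI ue').
rewrite mul0r !mulr0 -[RHS]e0; congr (_ * _); rewrite -!mulrA [in RHS]mulrA.
rewrite !exprMn; ring.
Qed.

(** * The vector field in coordinates *)

Lemma pchar_alg (k : fieldType) (E : comAlgType k) : 2%N \in [pchar k] -> 2%N \in [pchar E].
Proof.
move=> /andP[_ /eqP c]; apply/andP; split=> //.
by rewrite -(rmorph_nat (in_alg E)) c rmorph0.
Qed.

Section Derivation.
Context (E : comUnitRingType) (char_E : 2%N \in [pchar E]) (d : E -> E).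
Hypothesis dM : forall a b, d (a * b) = a * d b + d a * b.

Let addEE (x : E) : x + x = 0.
Proof. exact: addrr_pchar2. Qed.

Lemma der_sqr a : d (a ^+ 2) = 0.
Proof. by rewrite expr2 dM [d a * a]mulrC addEE. Qed.

Lemma der_sqrM a b : d (a ^+ 2 * b) = a ^+ 2 * d b.
Proof. by rewrite dM der_sqr mul0r addr0. Qed.

Lemma der_odd a l : d (a ^+ l.*2.+1) = (a ^+ l) ^+ 2 * d a.
Proof. by rewrite exprSr -muln2 exprM der_sqrM. Qed.

Lemma der_inv a : a \is a GRing.unit -> d a^-1 = a ^- 2 * d a.
Proof.
move=> ua; have -> : a^-1 = a^-1 ^+ 2 * a by rewrite expr2 -mulrA mulVr // mulr1.
by rewrite der_sqrM exprVn.
Qed.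

End Derivation.

(** The value of delta on x in each chart: (u^-2 + r) D_u maps x = u^-1 to
    a^2 + r a, where a = u^-2, and x = u^3 to 1 + r a, where a = u^2. *)
Definition slope (E : nzRingType) (b : bool) (r a : E) : E :=
  if b then a ^+ 2 + r * a else 1 + r * a.

(** One of the two factors of Y, with the roles of u and v not distinguished: q is
    the projection to this factor, q' to the other one. *)
Section DeltaCoord.
Context (k : fieldType) (char_k : 2%N \in [pchar k]) (C : cuspidal_curve k).
Context (X S : scheme k) (pr : lrs_morphism X S) (q q' : lrs_morphism X C).
Context (b b' : bool) (a x a' x' : forall c, stalk C c).
Hypotheses (ch : chart_coords b a x) (ch' : chart_coords b' a' x').
Let u := pullback_section q (cusp_coord C).
Context (D D' delta : forall z, stalk X z -> stalk X z) (W : set X).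
Hypothesis W_def : forall z, overlap C (q z) -> overlap C (q' z) -> W z.
Hypotheses (D_vf : is_vector_field pr W D) (D'_vf : is_vector_field pr W D').
Hypotheses (Du : forall z, W z -> D (u z) = 1) (D'u : forall z, W z -> D' (u z) = 0).
Context (rho coef : forall z, stalk X z) (rho_section : section X setT rho).
Hypothesis delta_vf : is_vector_field pr setT delta.
Hypothesis delta_def : forall z e, W z ->
  delta e = (u z ^- 2 + rho z) * D e + coef z * D' e.
Context (y : X) (Vy : chart C b (q y)) (Vy' : chart C b' (q' y)).
Hypothesis a_reg : forall e : stalk X y, pullback_section q a y * e = 0 -> e = 0.
Hypothesis a'_reg : forall e : stalk X y, pullback_section q' a' y * e = 0 -> e = 0.

Let charX z : 2%N \in [pchar (stalk X z)].
Proof. exact: pchar_alg. Qed.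

(** delta kills x^2 = a^(2l+1), whose derivative is a^(2l) delta(a), and a is not a
    zero divisor. *)
Lemma delta_a : delta (pullback_section q a y) = 0.
Proof.
have dM a0 b0 := vf_leibniz delta_vf a0 b0 (I : setT y).
have := pull_rel ch Vy => /(congr1 (@delta y)).
rewrite (der_sqr (charX y) dM) (der_odd (charX y) dM).
move: (pullback_section q a y) a_reg => A reg /esym.
have regX n e : A ^+ n * e = 0 -> e = 0.
  by elim: n => [|n IH]; rewrite ?mul1r // exprS -mulrA => /reg.
by rewrite expr2 -mulrA => /regX/regX.
Qed.

(** The formula for delta gives this on W, which is where both a and a' are
    invertible; the difference of the two sides is a section near y that is killed
    by a power of a a', hence zero. *)
Lemma delta_x : delta (pullback_section q x y) = slope b (rho y) (pullback_section q a y).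
Proof.
pose O := q @^-1` chart C b `&` q' @^-1` chart C b'.
have openq (p : lrs_morphism X C) (V : set C) : open V -> open (p @^-1` V).
  by move=> oV; apply: open_comp => // t _; exact: morphism_continuous.
have oV := spec_open (chart_spec ch); have oV' := spec_open (chart_spec ch').
have oO : open O by apply: openI; exact: openq.
pose A := pullback_section q a; pose A' := pullback_section q' a'.
have sA : section X O A.
  exact: section_restr (openq _ _ oV) oO (morphism_section q oV (chart_a ch)) (@subIsetl _ _ _).
have sA' : section X O A'.
  exact: section_restr (openq _ _ oV') oO (morphism_section q' oV' (chart_a ch')) (@subIsetr _ _ _).
have sx : section X O (pullback_section q x).
  exact: section_restr (openq _ _ oV) oO (morphism_section q oV (chart_x ch)) (@subIsetl _ _ _).
have srho : section X O rho by exact: section_restr openT oO rho_section _.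
have sslope : section X O (fun z => slope b (rho z) (A z)).
  rewrite /slope; case: (b); apply: section_add => //.
  - exact: section_exp.
  - exact: section_mul.
  - exact: section1.
  - exact: section_mul.
pose t z := delta (pullback_section q x z) - slope b (rho z) (A z).
have st : section X O t.
  by apply: section_sub => //; exact: (vf_section delta_vf oO _ sx).
have [|n] := vanish_unit_locus oO (conj Vy Vy') st (section_mul oO sA sA').
  move=> z [Vz Vz']; rewrite unitrM => /andP[uA uA'].
  have Wz1 : overlap C (q z) by apply: (chart_unit ch Vz); apply: morphism_local uA.
  have Wz2 : overlap C (q' z) by apply: (chart_unit ch' Vz'); apply: morphism_local uA'.
  have Wz := W_def Wz1 Wz2.
  have uu : u z \is a GRing.unit by apply: rmorph_unit; exact: coord_unit.
  have AE : A z = coord_a b (u z).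
    rewrite /A /pullback_section (chart_a_u ch) // /coord_a.
    by case: (b); rewrite ?rmorphV ?unitrX ?coord_unit //= rmorphXn.
  have xE : pullback_section q x z = coord_x b (u z).
    rewrite /pullback_section (chart_x_u ch) // /coord_x.
    by case: (b); rewrite ?rmorphV ?coord_unit //= rmorphXn.
  have dM e f := vf_leibniz D_vf e f Wz; have dM' e f := vf_leibniz D'_vf e f Wz.
  have DxE (d : stalk X z -> stalk X z) : (forall e f, d (e * f) = e * d f + d e * f) ->
      d (coord_x b (u z)) = (if b then u z ^- 2 else u z ^+ 2) * d (u z).
    move=> dMz; rewrite /coord_x; case: (b); first exact: (der_inv (charX z) dMz uu).
    by rewrite (@der_odd _ (charX z) d dMz (u z) 1) expr1.
  rewrite /t xE AE delta_def // !DxE // Du // D'u // mulr1 !mulr0 addr0.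
  rewrite /slope /coord_a; case: (b).
    by rewrite mulrDl -!expr2 subrr.
  by rewrite mulrDl mulVr ?unitrX // subrr.
move=> /= e; apply/eqP; rewrite -subr_eq0; apply/eqP; move: e.
rewrite -/(t y); elim: n => [|n IH]; first by rewrite mul1r.
by rewrite exprS -!mulrA => /a_reg/a'_reg/IH.
Qed.

End DeltaCoord.

(** * Germs on the product in coordinates *)

Lemma sqr_comb (A : comNzRingType) (c0 c1 c2 c3 x y : A) : 2%N \in [pchar A] ->
  (c0 + c1 * x + c2 * y + c3 * (x * y)) ^+ 2 =
  c0 ^+ 2 + c1 ^+ 2 * x ^+ 2 + c2 ^+ 2 * y ^+ 2 + c3 ^+ 2 * (x ^+ 2 * y ^+ 2).
Proof.
move=> char_A; have F (u v : A) : (u + v) ^+ 2 = u ^+ 2 + v ^+ 2.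
  by rewrite sqrrD mulr2n (addrr_pchar2 char_A) addr0.
by rewrite !F !exprMn.
Qed.

Lemma scale_comb (A : comNzRingType) (q c0 c1 c2 c3 x y : A) :
  q * (c0 + c1 * x + c2 * y + c3 * (x * y)) =
  q * c0 + q * c1 * x + q * c2 * y + q * c3 * (x * y).
Proof. by ring. Qed.

(** In characteristic two squares of elements of the product ring lie in R[a,b], so
    denominators can be taken there. *)
Section ProductCoords.
Context (k : fieldType) (char_k : 2%N \in [pchar k]) (R : comAlgType k) (b1 b2 : bool).
Let M := prod_ring R b1 b2.

Lemma prod_ring_sqr (m : M) : exists Q, m * m = pconst b1 b2 Q.
Proof.
have cM : 2%N \in [pchar M] by exact: pchar_alg.
have [f0 [f1 [f2 [f3 ->]]]] := prod_ringE m.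
have pX f n : pconst b1 b2 (f ^+ n) = pconst b1 b2 f ^+ n by exact: rmorphXn.
have pD := @rmorphD _ _ (pconst (R := R) b1 b2).
have pM := (pconst_mul R b1 b2).2.
rewrite -expr2 (sqr_comb _ _ _ _ _ _ cM) gen_x_sqr gen_y_sqr /gen_a /gen_b.
exists (f0 ^+ 2 + f1 ^+ 2 * 'X%:P ^+ (lev b1).*2.+1 + f2 ^+ 2 * 'X ^+ (lev b2).*2.+1 +
  f3 ^+ 2 * ('X%:P ^+ (lev b1).*2.+1 * 'X ^+ (lev b2).*2.+1)).
by rewrite -!pX -!pM -!pD.
Qed.

Lemma prod_ring_scale Q f0 f1 f2 f3 : let p := pconst b1 b2 in
  p Q * (p f0 + p f1 * gen_x R b1 b2 + p f2 * gen_y R b1 b2 + p f3 * (gen_x R b1 b2 * gen_y R b1 b2)) = 0 ->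
  [/\ Q * f0 = 0, Q * f1 = 0, Q * f2 = 0 & Q * f3 = 0].
Proof.
move=> p; rewrite scale_comb -!(pconst_mul R b1 b2).2; exact: prod_ring_free.
Qed.

Context (E : comUnitAlgType k) (mu : {lrmorphism M -> E}).
Hypothesis mu_surj : forall e, exists m m', mu m' \is a GRing.unit /\ e * mu m' = mu m.
Hypothesis mu_ker : forall m, mu m = 0 -> exists n, mu n \is a GRing.unit /\ n * m = 0.

Lemma product_coords (x y : E) : mu (gen_x R b1 b2) = x -> mu (gen_y R b1 b2) = y ->
  exists ev : {rmorphism {poly {poly R}} -> E},
  [/\ forall f, ev f = mu (pconst b1 b2 f),
      forall e, exists Q f0 f1 f2 f3, ev Q \is a GRing.unit /\
        e * ev Q = ev f0 + ev f1 * x + ev f2 * y +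
                   ev f3 * (x * y) &
      forall f0 f1 f2 f3, ev f0 + ev f1 * x + ev f2 * y +
                   ev f3 * (x * y) = 0 ->
        exists Q, ev Q \is a GRing.unit /\
          [/\ Q * f0 = 0, Q * f1 = 0, Q * f2 = 0 & Q * f3 = 0]].
Proof.
move=> <- <-.
pose ev : {rmorphism {poly {poly R}} -> E} := mu \o pconst b1 b2.
have comb f0 f1 f2 f3 := rmorph_comb mu (pconst b1 b2 f0) (pconst b1 b2 f1)
  (pconst b1 b2 f2) (pconst b1 b2 f3) (gen_x R b1 b2) (gen_y R b1 b2).
have muM : {morph mu : x y / x * y} by exact: rmorphM.
exists ev; split=> [//|e|f0 f1 f2 f3 e0].
  have [m [m' [um' em]]] := mu_surj e; have [Q mQ] := prod_ring_sqr m'.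
  have [f0 [f1 [f2 [f3 mm]]]] := prod_ringE (m * m').
  exists Q, f0, f1, f2, f3; split; first by rewrite /ev /= -mQ muM unitrM um'.
  by rewrite /ev /= -mQ muM mulrA em -muM mm; exact: comb.
have [n [un n0]] := mu_ker (etrans (comb f0 f1 f2 f3) e0).
have [Q nQ] := prod_ring_sqr n; exists Q; split; first by rewrite /ev /= -nQ muM unitrM un.
by apply: prod_ring_scale; rewrite -nQ -mulrA n0 mulr0.
Qed.

End ProductCoords.

(** * The kernel of the vector field *)

Definition slope_poly (R : comNzRingType) (b : bool) (r : R) : {poly R} :=
  slope b r%:P 'X.

Lemma polyC_reg (R : comNzRingType) (c : {poly R}) (f : {poly {poly R}}) :
  c \is monic -> c%:P * f = 0 -> f = 0.
Proof.
move=> mc cf0; apply/polyP => i; rewrite coef0; apply: (Mmonic_eq0 mc).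
by rewrite mulrC -coefCM cf0 coef0.
Qed.

Lemma der_ev0 (R E : comUnitRingType) (ev : {rmorphism {poly {poly R}} -> E}) (d : E -> E) :
  (forall a b, d (a + b) = d a + d b) -> (forall a b, d (a * b) = a * d b + d a * b) ->
  (forall r, d (ev r%:P%:P) = 0) -> d (ev 'X%:P) = 0 -> d (ev 'X) = 0 ->
  forall f, d (ev f) = 0.
Proof.
move=> dD dM dr dX dY; have d1 (p : {poly R}) : d (ev p%:P) = 0.
  elim/poly_ind: p => [|p c IH]; first by rewrite -[0]/(0%:P : {poly R}) dr.
  by rewrite polyCD polyCM rmorphD rmorphM /= dD dM IH dX dr mulr0 mul0r !addr0.
elim/poly_ind => [|p c IH]; first by rewrite -[0]/(0%:P : {poly {poly R}}) d1.
by rewrite rmorphD rmorphM /= dD dM IH dY d1 mulr0 mul0r !addr0.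
Qed.

(** E stands for the local ring of Y x S at a point, ev for its structure over
    R[a,b]; E is a localization of the free module on 1, x, y, xy. *)
Section Kernel.
Context (R E : comUnitRingType) (char_R : 2%N \in [pchar R]).
Context (ev : {rmorphism {poly {poly R}} -> E}) (x y : E).
Hypothesis coords : forall e, exists Q f0 f1 f2 f3, ev Q \is a GRing.unit /\
  e * ev Q = ev f0 + ev f1 * x + ev f2 * y + ev f3 * (x * y).
Hypothesis free : forall f0 f1 f2 f3, ev f0 + ev f1 * x + ev f2 * y + ev f3 * (x * y) = 0 ->
  exists Q, ev Q \is a GRing.unit /\ [/\ Q * f0 = 0, Q * f1 = 0, Q * f2 = 0 & Q * f3 = 0].
Lemma ev_regular g : (forall f, g * f = 0 -> f = 0) -> forall e, ev g * e = 0 -> e = 0.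
Proof.
move=> g_reg e ge; have [Q [f0 [f1 [f2 [f3 [uQ eQ]]]]]] := coords e.
have [|N [uN [N0 N1 N2 N3]]] := free (f0 := g * f0) (f1 := g * f1) (f2 := g * f2) (f3 := g * f3).
  have : ev g * (e * ev Q) = 0 by rewrite mulrA ge mul0r.
  by rewrite eQ scale_comb !rmorphM.
have Nf f : N * (g * f) = 0 -> ev N * ev f = 0.
  by rewrite mulrCA => /g_reg Nf0; rewrite -rmorphM Nf0 rmorph0.
apply: (mulIr uQ); apply: (mulrI uN); rewrite mul0r mulr0 eQ scale_comb.
by rewrite !Nf // !mul0r !addr0.
Qed.

Context (al be : {poly R}).
(* The ways in which the pair (al, be) is regular: both are monic when both
   coordinates are in the smooth chart, and the slope is a unit at the cusp. *)
Hypothesis al_be : [\/ ev al%:P \is a GRing.unit, ev be^:P \is a GRing.unit |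
  al \is monic /\ be \is monic].

(** Killed by d, which takes y to be and x to al. *)
Definition wel : E := ev al%:P * y + ev be^:P * x.

Let addPP (f : {poly {poly R}}) : f + f = 0.
Proof.
apply: addrr_pchar2; apply/andP; split=> //.
by rewrite -!(rmorph_nat polyC) (pcharf0 char_R) !rmorph0.
Qed.

Let eq_of_add (f g : {poly {poly R}}) : f + g = 0 -> f = g.
Proof. by move=> e; rewrite -[LHS]addr0 -(addPP g) addrA e add0r. Qed.

Lemma wel_free f g : ev f + ev g * wel = 0 ->
  exists Q, ev Q \is a GRing.unit /\ (Q * f = 0 /\ Q * g = 0).
Proof.
move=> e; have [|Q [uQ [Qf Qgbe Qgal _]]] := free (f0 := f) (f1 := g * be^:P) (f2 := g * al%:P) (f3 := 0).
  rewrite -[RHS]e /wel !rmorphM rmorph0 /=; ring.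
case: al_be => [ual|ube|[mal _]].
- exists (Q * al%:P); rewrite rmorphM unitrM uQ ual; split=> //.
  by rewrite mulrAC Qf mul0r -mulrA [al%:P * g]mulrC.
- exists (Q * be^:P); rewrite rmorphM unitrM uQ ube; split=> //.
  by rewrite mulrAC Qf mul0r -mulrA [be^:P * g]mulrC.
- exists Q; split=> //; split=> //; apply: (polyC_reg mal).
  by rewrite mulrC -mulrA.
Qed.

Context (d : E -> E).
Hypothesis dD : forall a b, d (a + b) = d a + d b.
Hypothesis dM : forall a b, d (a * b) = a * d b + d a * b.
Hypothesis d_ev : forall f, d (ev f) = 0.
Hypotheses (dx : d x = ev al%:P) (dy : d y = ev be^:P).

Let dev f e : d (ev f * e) = ev f * d e.
Proof. by rewrite dM d_ev mul0r addr0. Qed.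

Lemma wel_der : d wel = 0.
Proof.
rewrite /wel dD !dev dx dy -!rmorphM -rmorphD [be^:P * _]mulrC.
by rewrite addPP rmorph0.
Qed.

(** For e = f0 + f1 x + f2 y + f3 xy, d e = 0 says that f3 al, f3 be and
    f1 al + f2 be vanish after localization. As (al, be) is regular, f3 = 0 and
    (f1, f2) is a multiple of (be, al), which makes e a combination of 1 and w. *)
Lemma der_kernel e : d e = 0 -> exists f g Q,
  ev Q \is a GRing.unit /\ e * ev Q = ev f + ev g * wel.
Proof.
move=> de; have [Q [f0 [f1 [f2 [f3 [uQ eQ]]]]]] := coords e.
have [|N [uN [N12 N3be N3al _]]] :=
    free (f0 := f1 * al%:P + f2 * be^:P) (f1 := f3 * be^:P) (f2 := f3 * al%:P) (f3 := 0).
  have : d (e * ev Q) = 0 by rewrite mulrC dev de mulr0.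
  rewrite eQ !dD d_ev !dev dM dx dy => <-.
  rewrite !rmorphD !rmorphM rmorph0 /=; ring.
have Nal : al%:P * (N * f1) = be^:P * (N * f2).
  by apply: eq_of_add; rewrite -[RHS]N12; ring.
have eQP P : e * ev (Q * P) = ev (P * f0) + ev (P * f1) * x + ev (P * f2) * y + ev (P * f3) * (x * y).
  rewrite rmorphM mulrA eQ !rmorphM /=; ring.
case: al_be => [ual|ube|[mal mbe]].
- exists (N * al%:P * f0), (N * f2), (Q * (N * al%:P)).
  rewrite !rmorphM /= !unitrM uQ uN ual -!rmorphM; split=> //; rewrite eQP.
  have -> : N * al%:P * f3 = 0 by rewrite -mulrA [al%:P * _]mulrC.
  have -> : N * al%:P * f1 = be^:P * (N * f2) by rewrite -Nal; ring.
  rewrite rmorph0 /wel !rmorphM /=; ring.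
- exists (N * be^:P * f0), (N * f1), (Q * (N * be^:P)).
  rewrite !rmorphM /= !unitrM uQ uN ube -!rmorphM; split=> //; rewrite eQP.
  have -> : N * be^:P * f3 = 0 by rewrite -mulrA [be^:P * _]mulrC.
  have -> : N * be^:P * f2 = al%:P * (N * f1) by rewrite Nal; ring.
  rewrite rmorph0 /wel !rmorphM /=; ring.
- have [S Nf2] := monic_vars_regular mal mbe (esym Nal).
  have Nf1 : N * f1 = be^:P * S.
    apply/eqP; rewrite -subr_eq0; apply/eqP; apply: (polyC_reg mal).
    rewrite mulrBr Nal Nf2; ring.
  have Nf3 : N * f3 = 0 by apply: (polyC_reg mal); rewrite -N3al; ring.
  exists (N * f0), S, (Q * N); rewrite rmorphM unitrM uQ uN -rmorphM; split=> //.
  rewrite eQP Nf3 Nf1 Nf2 rmorph0 /wel !rmorphM /=; ring.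
Qed.

Context (l m : nat).
Hypotheses (x_sqr : x ^+ 2 = ev 'X%:P ^+ l.*2.+1) (y_sqr : y ^+ 2 = ev 'X ^+ m.*2.+1).

Lemma wel_sqr : wel * wel = ev (cover al be l m).
Proof.
rewrite /cover rmorphD !rmorphM !rmorphXn /= -y_sqr -x_sqr /wel.
have addEE (u : E) : u + u = 0.
  apply: addrr_pchar2; apply/andP; split=> //.
  by rewrite -(rmorph_nat (ev \o polyC \o polyC)) (pcharf0 char_R) rmorph0.
have -> : (ev al%:P * y + ev be^:P * x) * (ev al%:P * y + ev be^:P * x) =
    ev al%:P ^+ 2 * y ^+ 2 + ev be^:P ^+ 2 * x ^+ 2 +
    (ev al%:P * y * (ev be^:P * x) + ev al%:P * y * (ev be^:P * x)) by ring.
by rewrite addEE addr0.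
Qed.

Section Residue.
Context (L : fieldType) (char_L : 2%N \in [pchar L]) (red : {rmorphism R -> L}).
Hypothesis red_surj : forall c, exists r, red r = c.
Context (O G : comUnitRingType) (K : {rmorphism O -> E}) (jx : {rmorphism O -> G}).
Hypotheses (K_inj : forall e, K e = 0 -> e = 0) (K_ker : forall e, d e = 0 -> exists f, K f = e).
Hypothesis K_der : forall e, d (K e) = 0.
Hypothesis K_unit : forall e, K e \is a GRing.unit -> e \is a GRing.unit.
Context (rhoO : {rmorphism R -> O}) (rhoG : {rmorphism L -> G}).
Hypotheses (K_rho : forall r, K (rhoO r) = ev r%:P%:P) (jx_rho : forall r, jx (rhoO r) = rhoG (red r)).
Hypothesis jx_surj : forall g, exists e, jx e = g.
Hypothesis jx_ker : forall e, jx e = 0 -> forall I, is_ideal I ->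
  (forall r, red r = 0 -> I (rhoO r)) -> I e.

Let red2 : {rmorphism {poly {poly R}} -> {poly {poly L}}} := map_poly (map_poly red).

Let red2_surj (f : {poly {poly L}}) : exists g, red2 g = f.
Proof.
have s1 (p : {poly L}) : exists q, map_poly red q = p.
  elim/poly_ind: p => [|p c [q <-]]; first by exists 0; rewrite rmorph0.
  have [r <-] := red_surj c; exists (q * 'X + r%:P).
  by rewrite rmorphD rmorphM /= map_polyX map_polyC.
elim/poly_ind: f => [|f c [g <-]]; first by exists 0; rewrite rmorph0.
have [r <-] := s1 c; exists (g * 'X + r%:P).
by rewrite rmorphD rmorphM /= map_polyX map_polyC.
Qed.

Let red2C (p : {poly R}) : red2 p%:P = (map_poly red p)%:P.
Proof. exact: map_polyC. Qed.

Let red2M (p : {poly R}) : red2 p^:P = (map_poly red p)^:P.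
Proof. by rewrite /red2 /= -!map_poly_comp; apply: eq_map_poly => c /=; rewrite map_polyC. Qed.

Lemma residue_evals : exists (evO : {rmorphism {poly {poly R}} -> O})
    (psi : {rmorphism {poly {poly L}} -> G}),
  (forall f, K (evO f) = ev f) /\ (forall f, jx (evO f) = psi (red2 f)).
Proof.
have [aO aE] := K_ker (d_ev 'X%:P); have [bO bE] := K_ker (d_ev 'X).
have [o1 [o1C o1X]] := poly_eval rhoO aO; have [o2 [o2C o2X]] := poly_eval o1 bO.
have [g1 [g1C g1X]] := poly_eval rhoG (jx aO); have [g2 [g2C g2X]] := poly_eval g1 (jx bO).
exists o2, g2; split.
  apply: (poly_morph_eq (f := K \o o2) (g := ev)) => [p|] /=; last by rewrite o2X.
  rewrite o2C; move: p.
  apply: (poly_morph_eq (f := K \o o1) (g := ev \o polyC)) => [r|] /=; last by rewrite o1X.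
  by rewrite o1C.
apply: (poly_morph_eq (f := jx \o o2) (g := g2 \o red2)) => [p|] /=; last by rewrite map_polyX o2X g2X.
rewrite o2C map_polyC /= g2C; move: p.
apply: (poly_morph_eq (f := jx \o o1) (g := g1 \o map_poly red)) => [r|] /=; last by rewrite map_polyX o1X g1X.
by rewrite o1C map_polyC /= g1C.
Qed.

Hypotheses (al0 : map_poly red al != 0) (be0 : map_poly red be != 0).
Hypotheses (al_cop : coprimep (map_poly red al) ('X ^+ l)).
Hypotheses (be_cop : coprimep (map_poly red be) ('X ^+ m)).

(** O, the kernel of d, is free over the localized R[a,b] on 1 and w; so its
    quotient G by the maximal ideal of R is free on 1 and w over the localized
    L[a,b], and cover_normal applies. Freeness is read off from the ideal I of
    elements whose coordinates reduce to zero, which contains the kernel of jx. *)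
Theorem quotient_fibre_normal : normal_ring G.
Proof.
have [evO [psi [KE jE]]] := residue_evals.
have [wO wE] := K_ker wel_der.
have K_eq e f : K e = K f -> e = f.
  by move=> ef; apply/eqP; rewrite -subr_eq0; apply/eqP/K_inj; rewrite rmorphB ef subrr.
have evO_unit Q : ev Q \is a GRing.unit -> psi (red2 Q) \is a GRing.unit.
  by rewrite -KE -jE => /K_unit; exact: rmorph_unit.
have red2_unit Q : ev Q \is a GRing.unit -> red2 Q != 0.
  by move=> /evO_unit; apply: contraTneq => ->; rewrite rmorph0 unitr0.
have wO_sqr : wO * wO = evO (cover al be l m).
  by apply: K_eq; rewrite rmorphM wE wel_sqr KE.
have red_cover : red2 (cover al be l m) = cover (map_poly red al) (map_poly red be) l m.
  rewrite /cover [LHS]rmorphD ![red2 (_ * _)]rmorphM ![red2 (_ ^+ _)]rmorphXn /=.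
  by rewrite -!/(red2 _) red2C red2M red2C !map_polyX.
have O_frac e : exists f g Q, ev Q \is a GRing.unit /\ e * evO Q = evO f + evO g * wO.
  have [f [g [Q [uQ eQ]]]] := der_kernel (K_der e); exists f, g, Q; split=> //.
  by apply: K_eq; rewrite rmorphM rmorphD rmorphM !KE wE.
apply: (cover_normal char_L (psi := psi) (w := jx wO) al0 be0 al_cop be_cop).
- by rewrite -rmorphM wO_sqr jE red_cover.
- move=> g; have [e <-] := jx_surj g.
  have [f [f' [Q [uQ eQ]]]] := O_frac e.
  exists (red2 f), (red2 f'), (red2 Q); split; first exact: evO_unit.
  by rewrite -!jE -!rmorphM -rmorphD eQ.
- move=> fL gL; have [f <-] := red2_surj fL; have [g <-] := red2_surj gL.
  rewrite -!jE -rmorphM -rmorphD => /jx_ker ker.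
  pose I : set O := [set e | exists f' g' Q, [/\ ev Q \is a GRing.unit, red2 f' = 0,
    red2 g' = 0 & e * evO Q = evO f' + evO g' * wO]].
  have II : is_ideal I.
    split.
    - by exists 0, 0, 1; rewrite !rmorph0 rmorph1 unitr1 mul0r mul0r addr0.
    - move=> e e' [f1 [g1 [Q [uQ f1_0 g1_0 eQ]]]] [f2 [g2 [Q' [uQ' f2_0 g2_0 eQ']]]].
      exists (f1 * Q' + f2 * Q), (g1 * Q' + g2 * Q), (Q * Q').
      split; rewrite ?(rmorphD red2, rmorphM red2) ?f1_0 ?f2_0 ?g1_0 ?g2_0 ?mul0r ?addr0 //.
        by rewrite rmorphM unitrM uQ.
      rewrite !(rmorphD evO, rmorphM evO) mulrDl mulrA eQ.
      rewrite [e' * _](_ : _ = e' * evO Q' * evO Q); last by ring.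
      by rewrite eQ'; ring.
    - move=> e e' [f1 [g1 [Q [uQ f1_0 g1_0 eQ]]]].
      have [f2 [g2 [Q' [uQ' eQ']]]] := O_frac e.
      exists (f2 * f1 + g2 * g1 * cover al be l m), (f2 * g1 + g2 * f1), (Q' * Q).
      split; rewrite ?(rmorphD red2) ?(rmorphM red2) ?f1_0 ?g1_0 ?mulr0 ?mul0r ?addr0 //.
        by rewrite rmorphM unitrM uQ'.
      rewrite [evO (_ + _ * cover _ _ _ _)]rmorphD [evO (_ * cover _ _ _ _)]rmorphM -wO_sqr.
      rewrite !(rmorphD evO, rmorphM evO).
      rewrite [LHS](_ : _ = (e * evO Q') * (e' * evO Q)); last by ring.
      by rewrite eQ eQ'; ring.
  have [r r0|f' [g' [Q [uQ f'0 g'0 e]]]] := ker I II.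
    exists r%:P%:P, 0, 1; rewrite rmorph1 unitr1 red2C map_polyC /= r0 !rmorph0; split=> //.
    by rewrite rmorph1 mulr1 mul0r addr0; apply: K_eq; rewrite KE K_rho.
  have [|N [uN [Nf Ng]]] := wel_free (f := f * Q - f') (g := g * Q - g').
    have e' : K ((evO f + evO g * wO) * evO Q) = K (evO f' + evO g' * wO) by rewrite e.
    move: e'; rewrite (rmorphM K) !(rmorphD K) !(rmorphM K) !KE wE => e'.
    rewrite !(rmorphB ev) !(rmorphM ev) /=; move/eqP: e'; rewrite -subr_eq0 => /eqP <-; ring.
  have fin h h' : red2 h' = 0 -> N * (h * Q - h') = 0 -> red2 h = 0.
    move=> h'0 /(congr1 red2); rewrite rmorphM rmorphB rmorphM h'0 subr0 rmorph0 => /eqP.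
    by rewrite !mulf_eq0 (negPf (red2_unit _ uN)) (negPf (red2_unit _ uQ)) orbF => /eqP.
  by split; [exact: fin f'0 Nf | exact: fin g'0 Ng].
Qed.

End Residue.
End Kernel.

(** * Normality of the fibres *)

Lemma slope_map (R R' : nzRingType) (f : {rmorphism R -> R'}) b r a :
  f (slope b r a) = slope b (f r) (f a).
Proof. by rewrite /slope; case: b; rewrite !(rmorphD, rmorphM) ?rmorph1. Qed.

Lemma slope_poly_map (R R' : comNzRingType) (f : {rmorphism R -> R'}) b r :
  map_poly f (slope_poly b r) = slope_poly b (f r).
Proof. by rewrite /slope_poly (slope_map (map_poly f)) /= map_polyC map_polyX. Qed.

Lemma slope_monic (R : comNzRingType) (r : R) : slope_poly true r \is monic.
Proof.
rewrite /slope_poly /slope monicE lead_coefDl ?lead_coefXn //.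
rewrite size_polyXn; apply: leq_ltn_trans (size_polyMleq _ _) _.
by rewrite size_polyX addn2 /= !ltnS size_polyC_leq1.
Qed.

Lemma slope_poly_neq0 (L : fieldType) b (r : L) : slope_poly b r != 0.
Proof.
case: b; first exact: monic_neq0 (slope_monic r).
apply/eqP => /(congr1 (fun p : {poly L} => p`_0)).
by rewrite /slope_poly /slope coefD coef1 coefMX addr0 coef0 => /eqP; rewrite oner_eq0.
Qed.

Lemma slope_poly_coprime (L : fieldType) b (r : L) : coprimep (slope_poly b r) ('X ^+ lev b).
Proof.
case: b; first by rewrite expr0 coprimep1.
rewrite expr1; apply/Bezout_eq1_coprimepP; exists (1, - r%:P) => /=.
by rewrite /slope_poly /slope mul1r mulNr addrK.
Qed.

(** A point of the chart of the cusp where a = u^2 is invertible also lies in the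
    smooth chart, and is treated there. *)
Lemma good_chart (k : fieldType) (C : cuspidal_curve k) (c : C) : exists b a x,
  [/\ chart_coords b a x, chart C b c & b \/ ~ a c \is a GRing.unit].
Proof.
have : (chart0 C `|` chart1 C) c by rewrite cusp_cover.
case=> [c0|c1]; last first.
  by have [a [x ch]] := chart_exists C true; exists true, a, x; split=> //; left.
have [a [x ch]] := chart_exists C false.
have [ua|nua] := pselect (a c \is a GRing.unit); last by exists false, a, x; split=> //; right.
have [_ c1] := chart_unit ch c0 ua.
by have [a' [x' ch']] := chart_exists C true; exists true, a', x'; split=> //; left.
Qed.

Lemma kernel_stalk (k : fieldType) (X Z : scheme k) (D : forall x, stalk X x -> stalk X x)
    (q : lrs_morphism X Z) : is_kernel_quotient D q ->
  forall y z, q y = z -> exists K : {lrmorphism stalk Z z -> stalk X y},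
  [/\ forall s, pullback_section q s y = K (s z), forall e, K e = 0 -> e = 0,
      forall e, D y e = 0 <-> exists f, K f = e &
      forall e, K e \is a GRing.unit -> e \is a GRing.unit].
Proof.
move=> Hq y z <-; exists (on_stalks q y); split=> //.
- by move=> e; rewrite -(rmorph0 (on_stalks q y)) => /(quotient_inj Hq).
- exact: (quotient_ker Hq).
- by move=> e; exact: morphism_local.
Qed.

(** At the cusp, 1 + r a is invertible because a is not. *)
Lemma slope_unit (k : fieldType) (X : lrs k) (x : X) (r a : stalk X x) :
  ~ a \is a GRing.unit -> slope false r a \is a GRing.unit.
Proof.
move=> na; have : slope false r a + - (r * a) \is a GRing.unit by rewrite /slope addrK unitr1.
by move=> /stalk_local[//|]; rewrite unitrN unitrM => /andP[_ /na].
Qed.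

(** The residue field comes as a ring whose nonzero elements are units; here it is
    made into a field. *)
Lemma residue_fibre_normal (R E L O G : comUnitRingType) :
  2%N \in [pchar R] -> forall (ev : {rmorphism {poly {poly R}} -> E}) (x y : E),
  (forall e, exists Q f0 f1 f2 f3, ev Q \is a GRing.unit /\
    e * ev Q = ev f0 + ev f1 * x + ev f2 * y + ev f3 * (x * y)) ->
  (forall f0 f1 f2 f3, ev f0 + ev f1 * x + ev f2 * y + ev f3 * (x * y) = 0 ->
    exists Q, ev Q \is a GRing.unit /\ [/\ Q * f0 = 0, Q * f1 = 0, Q * f2 = 0 & Q * f3 = 0]) ->
  forall (b1 b2 : bool) (r1 r2 : R),
  let al := slope_poly b1 r1 in let be := slope_poly b2 r2 in
  b1 \/ ev al%:P \is a GRing.unit -> b2 \/ ev be^:P \is a GRing.unit ->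
  forall d : E -> E, (forall a b, d (a + b) = d a + d b) ->
  (forall a b, d (a * b) = a * d b + d a * b) -> (forall f, d (ev f) = 0) ->
  d x = ev al%:P -> d y = ev be^:P ->
  x ^+ 2 = ev 'X%:P ^+ (lev b1).*2.+1 -> y ^+ 2 = ev 'X ^+ (lev b2).*2.+1 ->
  (forall a : L, a != 0 -> a \is a GRing.unit) ->
  forall red : {rmorphism R -> L}, (forall c, exists r, red r = c) ->
  forall (K : {rmorphism O -> E}) (jx : {rmorphism O -> G}),
  (forall e, K e = 0 -> e = 0) -> (forall e, d e = 0 <-> exists f, K f = e) ->
  (forall e, K e \is a GRing.unit -> e \is a GRing.unit) ->
  forall (rhoO : {rmorphism R -> O}) (rhoG : {rmorphism L -> G}),
  (forall r, K (rhoO r) = ev r%:P%:P) -> (forall r, jx (rhoO r) = rhoG (red r)) ->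
  (forall g, exists e, jx e = g) ->
  (forall e, jx e = 0 -> forall I, is_ideal I -> (forall r, red r = 0 -> I (rhoO r)) -> I e) ->
  normal_ring G.
Proof.
move=> cR ev x y coords free b1 b2 r1 r2 al be ual ube d dD dM dev dx dy x2 y2 Lf red red_surj
  K jx Ki Kk Ku rhoO rhoG Kr jr js jk.
pose Lm := GRing.ComUnitRing_isField.Build (GRing.ComUnitRing.sort L) Lf.
pose L' : fieldType := HB.pack (GRing.ComUnitRing.sort L) Lm.
have al_be : [\/ ev al%:P \is a GRing.unit, ev be^:P \is a GRing.unit |
    al \is monic /\ be \is monic].
  case: ual => [b1T|]; last by constructor 1.
  case: ube => [b2T|]; last by constructor 2.
  by constructor 3; rewrite /al /be b1T b2T; split; exact: slope_monic.
have cL : 2%N \in [pchar L'].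
  apply/andP; split=> //; rewrite -(rmorph_nat (red : {rmorphism R -> L'})).
  by rewrite (pcharf0 cR) rmorph0.
pose red' : {rmorphism R -> L'} := red.
have al0 : map_poly red' al != 0 by rewrite slope_poly_map; exact: slope_poly_neq0.
have be0 : map_poly red' be != 0 by rewrite slope_poly_map; exact: slope_poly_neq0.
have al_cop : coprimep (map_poly red' al) ('X ^+ lev b1).
  by rewrite slope_poly_map; exact: slope_poly_coprime.
have be_cop : coprimep (map_poly red' be) ('X ^+ lev b2).
  by rewrite slope_poly_map; exact: slope_poly_coprime.
apply: (@quotient_fibre_normal R E cR ev x y coords free al be al_be d dD dM dev dx dy
  (lev b1) (lev b2) x2 y2 L' cL red' red_surj O G K jx Ki _ _ Ku rhoO rhoG Kr jr js jk) => //.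
- by move=> e /Kk.
- by move=> e; apply/Kk; exists e.
Qed.

Theorem proposition4p3
  (k : fieldType) (char_k : 2%N \in [pchar k])
  (C : cuspidal_curve k)
  (* Y = C x C *)
  (Y : scheme k) (p1 p2 : lrs_morphism Y C) (Y_prod : is_product p1 p2)
  (S : scheme k) (r s : forall x, stalk S x)
  (r_section : section S setT r) (s_section : section S setT s)
  (* YS = Y x S *)
  (YS : scheme k) (prY : lrs_morphism YS Y) (prS : lrs_morphism YS S)
  (YS_prod : is_product prY prS)
  (u v : forall x, stalk YS x)
  (u_def : u = pullback_section (compose p1 prY) (cusp_coord C))
  (v_def : v = pullback_section (compose p2 prY) (cusp_coord C))
  (* the open set of YS where u, u^-1, v and v^-1 are defined *)
  (W : set YS)
  (W_def : W = (compose p1 prY) @^-1` overlap C `&`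
               (compose p2 prY) @^-1` overlap C)
  (Du Dv : forall x, stalk YS x -> stalk YS x)
  (Du_vf : is_vector_field prS W Du) (Dv_vf : is_vector_field prS W Dv)
  (Du_coord : forall x, W x -> Du x (u x) = 1 /\ Du x (v x) = 0)
  (Dv_coord : forall x, W x -> Dv x (u x) = 0 /\ Dv x (v x) = 1)
  (delta : forall x, stalk YS x -> stalk YS x)
  (delta_vf : is_vector_field prS setT delta)
  (delta_def : forall x a, W x ->
     delta x a = (u x ^- 2 + pullback_section prS r x) * Du x a
               + (v x ^- 2 + pullback_section prS s x) * Dv x a)
  (* Z = (Y x S) / alpha_2, and its structure morphism to S *)
  (Z : scheme k) (q : lrs_morphism YS Z) (Z_quotient : is_kernel_quotient delta q)
  (piZ : lrs_morphism Z S) (pi_def : compose piZ q = prS) :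
  forall (sigma : S) (F : scheme k) (j : lrs_morphism F Z),
    is_fibre piZ sigma j -> normal_scheme F.
Proof.
move=> sigma F j [K [i [qK [Hres Hfib]]]] x.
have [inv qinv invq] := quotient_bij Z_quotient.
(* y is the point of Y x S over x; germs on S at its image act on all stalks. *)
pose y := inv (j x); have qy : q y = j x by exact: invq.
have prS_y : prS y = piZ (j x) by rewrite -qy -pi_def.
have i_y : i (qK x) = prS y.
  by rewrite prS_y; have := Hfib.1 => /(congr1 (fun m => on_points m x)).
have [red redE] := pullback_at i_y.
have [rhoO rhoOE] := pullback_at (esym prS_y).
have [Kq [KqE Kq_inj Kq_ker Kq_unit]] := kernel_stalk Z_quotient qy.
have stalk_fam (X : lrs k) (z : X) (e : stalk X z) : exists t, t z = e.
  by have [_ [t [_ _ _ te]]] := germ_section e; exists t.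
have Kq_rho e : Kq (rhoO e) = on_stalks prS y e.
  have [t <-] := stalk_fam _ _ e.
  by rewrite -rhoOE -KqE -[RHS]/(pullback_section prS t y) -pi_def.
have j_rho e : on_stalks j x (rhoO e) = on_stalks qK x (red e).
  have [t <-] := stalk_fam _ _ e.
  by rewrite -rhoOE -redE; exact: (fibre_pull Hfib).
have red_surj c : exists e, red e = c.
  have [e <-] := residue_surj Hres c; have [t <-] := stalk_fam _ _ e.
  by exists (t (prS y)); rewrite -redE.
have [j_surj j_ker] := fibre_stalk Hres Hfib x.
have [b1 [a1 [x1 [ch1 V1 alt1]]]] := good_chart (p1 (prY y)).
have [b2 [a2 [x2 [ch2 V2 alt2]]]] := good_chart (p2 (prY y)).
have [mu [muR [mua mub mux muy] mu_surj mu_ker]] := product_stalk Y_prod YS_prod ch1 ch2 V1 V2.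
have [ev [evE coords free]] := product_coords char_k mu_surj mu_ker mux muy.
have evR e : ev e%:P%:P = on_stalks prS y e by rewrite evE muR.
have evA : ev 'X%:P = pullback_section (compose p1 prY) a1 y by rewrite evE -mua.
have evB : ev 'X = pullback_section (compose p2 prY) a2 y by rewrite evE -mub.
(* Multiplication by a polynomial that is regular in R[a,b] stays injective in the
   local ring at y. *)
have A_reg (e : stalk YS y) : pullback_section (compose p1 prY) a1 y * e = 0 -> e = 0.
  rewrite -evA.
  apply: (@ev_regular (stalk S (prS y)) (stalk YS y) ev _ _ coords free) => f.
  exact: polyC_reg (monicX _).
have B_reg (e : stalk YS y) : pullback_section (compose p2 prY) a2 y * e = 0 -> e = 0.
  rewrite -evB; apply: (@ev_regular (stalk S (prS y)) (stalk YS y) ev _ _ coords free) => f; rewrite mulrC.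
  exact: Mmonic_eq0 (monicX _).
have WE z : overlap C (compose p1 prY z) -> overlap C (compose p2 prY z) -> W z.
  by rewrite W_def.
have WE' z : overlap C (compose p2 prY z) -> overlap C (compose p1 prY z) -> W z.
  by move=> h h'; exact: WE.
have rY : section YS setT (pullback_section prS r).
  exact: (morphism_section prS openT r_section).
have sY : section YS setT (pullback_section prS s).
  exact: (morphism_section prS openT s_section).
have dD e f := vf_add delta_vf e f (I : setT y).
have dM e f := vf_leibniz delta_vf e f (I : setT y).
have dR e : delta y (on_stalks prS y e) = 0 by exact: (vf_base delta_vf).
have da : delta y (pullback_section (compose p1 prY) a1 y) = 0.
  exact: (delta_a (q := compose p1 prY) char_k ch1 delta_vf V1 A_reg).
have db : delta y (pullback_section (compose p2 prY) a2 y) = 0.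
  exact: (delta_a (q := compose p2 prY) char_k ch2 delta_vf V2 B_reg).
have dx : delta y (pullback_section (compose p1 prY) x1 y) =
    slope b1 (pullback_section prS r y) (pullback_section (compose p1 prY) a1 y).
  apply: (delta_x (q := compose p1 prY) (q' := compose p2 prY) char_k ch1 ch2 WE Du_vf Dv_vf (coef := fun z => v z ^- 2 + pullback_section prS s z)
    _ _ rY delta_vf _ V1 V2 A_reg B_reg).
  - by move=> z Wz; rewrite -u_def; have [] := Du_coord z Wz.
  - by move=> z Wz; rewrite -u_def; have [] := Dv_coord z Wz.
  - by move=> z e Wz; rewrite -u_def delta_def.
have dy : delta y (pullback_section (compose p2 prY) x2 y) =
    slope b2 (pullback_section prS s y) (pullback_section (compose p2 prY) a2 y).
  apply: (delta_x (q := compose p2 prY) (q' := compose p1 prY) char_k ch2 ch1 WE' Dv_vf Du_vf (coef := fun z => u z ^- 2 + pullback_section prS r z)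
    _ _ sY delta_vf _ V2 V1 B_reg A_reg).
  - by move=> z Wz; rewrite -v_def; have [] := Dv_coord z Wz.
  - by move=> z Wz; rewrite -v_def; have [] := Du_coord z Wz.
  - by move=> z e Wz; rewrite -v_def delta_def // addrC.
have ev_al : ev (slope_poly b1 (r (prS y)))%:P =
    slope b1 (pullback_section prS r y) (pullback_section (compose p1 prY) a1 y).
  apply: etrans (slope_map (ev \o polyC : {rmorphism {poly _} -> _}) _ _ _) _.
  by rewrite /= evR evA.
have ev_be : ev (slope_poly b2 (s (prS y)))^:P =
    slope b2 (pullback_section prS s y) (pullback_section (compose p2 prY) a2 y).
  by rewrite slope_poly_map /slope_poly slope_map evR evB.
have dev f : delta y (ev f) = 0.
  by apply: der_ev0 dD dM _ _ _ f => [e||]; rewrite ?evR ?evA ?evB.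
have cR : 2%N \in [pchar (stalk S (prS y))] by exact: pchar_alg.
have unit1 : b1 \/ ev (slope_poly b1 (r (prS y)))%:P \is a GRing.unit.
  case: alt1 => [->|na]; first by left.
  rewrite ev_al; case: (b1); [by left | right; apply: slope_unit => ua].
  by apply: na; exact: morphism_local ua.
have unit2 : b2 \/ ev (slope_poly b2 (s (prS y)))^:P \is a GRing.unit.
  case: alt2 => [->|na]; first by left.
  rewrite ev_be; case: (b2); [by left | right; apply: slope_unit => ua].
  by apply: na; exact: morphism_local ua.
rewrite -ev_al in dx; rewrite -ev_be in dy.
have x2E := pull_rel (q := compose p1 prY) ch1 V1; rewrite -evA in x2E.
have y2E := pull_rel (q := compose p2 prY) ch2 V2; rewrite -evB in y2E.
have Kq_ev e : Kq (rhoO e) = ev e%:P%:P by rewrite evR.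
apply: (residue_fibre_normal cR coords free unit1 unit2 dD dM dev dx dy x2E y2E
  (residue_field Hres (y := qK x)) red_surj Kq_inj Kq_ker Kq_unit Kq_ev j_rho j_surj).
move=> e /j_ker fe I II Ir; apply: fe; try by case: II.
by move=> t t0; rewrite rhoOE; apply: Ir; exact: etrans (esym (redE t)) t0.
Qed.
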